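(* Suppose that $\mathfrak p=(p_d)_{d\ge1}$ and $\mathfrak q=(q_d)_{d\ge1}$, with $p_d,q_d\in\mathcal P_d(\mathbb R)$, are two sequences of polynomials with infinitesimal distributions $(\mu,\mu')$ and $(\nu,\nu')$, respectively. Let $(\gamma,\gamma')$ denote the infinitesimal free additive convolution $(\mu,\mu')\boxplus_B(\nu,\nu')$. Then the finite-free additive convolution $\mathfrak p\boxplus\mathfrak q=(p_d\boxplus_d q_d)_{d\ge1}$ has infinitesimal distribution $(\rho,\rho')$, where $\rho=\mu\boxplus\nu$ and $\rho'$ has Cauchy transform $G_{\rho'}$ given by $$G_{\rho'}=G_{\gamma'}+H_{\mu\boxplus\nu}+\frac{\omega_1''}{2\omega_1'}+\frac{\omega_2''}{2\omega_2'},$$ where $\omega_1$ and $\omega_2$ are the subordination functions of $\mu\boxplus\nu$ with respect to $\mu$ and $\nu$, respectively.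
   Context: $\mathcal P_d(\mathbb R)$ is the set of monic real polynomials of degree $d$ with only real roots. For $p_d\in\mathcal P_d(\mathbb R)$ with roots $\lambda_1,\dots,\lambda_d$ (with multiplicity), $m_n(p_d)=\frac1d\sum_k\lambda_k^n$. Write $p_d(x)=\sum_{k=0}^d x^{d-k}(-1)^k\binom dk\mathsf e_k(p_d)$. The finite-free additive convolution is $[p_d\boxplus_d q_d](x)=\sum_{k=0}^d x^{d-k}(-1)^k\binom dk\bigl[\sum_{i=0}^k\binom ki\mathsf e_i(p_d)\mathsf e_{k-i}(q_d)\bigr]$ (again in $\mathcal P_d(\mathbb R)$). A sequence $\mathfrak p$ has infinitesimal distribution $(\mu,\mu')$ if $\mu$ is a probability distribution on $\mathbb R$ with finite moments $m_n(\mu)$ of all orders, $m_n(p_d)\to m_n(\mu)$ for all $n\ge0$, the limits $m_n'(\mathfrak p)=\lim_{d\to\infty}d\,(m_n(p_d)-m_n(\mu))$ exist for all $n\ge1$, and $\mu':\mathbb R[x]\to\mathbb R$ is the linear functional with $\mu'(1)=0$, $\mu'(x^n)=m_n'(\mathfrak p)$. Write $m_n(\mu')=\mu'(x^n)$. $NC(n)$ is the set of non-crossing partitions of $[n]=\{1,\dots,n\}$; for a sequence $(u_n)$, $u_\pi=\prod_{V\in\pi}u_{|V|}$, $u_{\pi\setminus V}=\prod_{W\in\pi,W\ne V}u_{|W|}$, and $u_\sigma=\prod_c u_{|c|}$ over cycles $c$ (fixed points included) of a permutation $\sigma$. Free cumulants $r_n(\mu)$ are defined recursively by $m_n(\mu)=\sum_{\pi\in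 NC(n)}r_\pi(\mu)$. Throughout, only distributions determined by their moments are considered; $\mu\boxplus\nu$ is the probability measure with $r_n(\mu\boxplus\nu)=r_n(\mu)+r_n(\nu)$ for all $n\ge1$. The infinitesimal free cumulants $r_n'(\mu,\mu')$ are defined recursively by $m_n(\mu')=\sum_{\pi\in NC(n)}\sum_{V\in\pi}r'_{|V|}(\mu,\mu')\,r_{\pi\setminus V}(\mu)$, $n\ge1$. The infinitesimal free additive convolution $(\mu,\mu')\boxplus_B(\nu,\nu')=(\gamma,\gamma')$ is given by $\gamma=\mu\boxplus\nu$ and $\gamma'$ the linear functional on $\mathbb R[x]$ with $\gamma'(1)=0$ and $r_n'(\gamma,\gamma')=r_n'(\mu,\mu')+r_n'(\nu,\nu')$ for all $n\ge1$. Formal power series: $G_\mu(z)=\sum_{n\ge0}m_n(\mu)z^{-n-1}$; for a linear functional $\mu'$, $G_{\mu'}(z)=\sum_{n\ge0}\mu'(x^n)z^{-n-1}$; $H_\mu(z)=\sum_{n\ge2}h_n(\mu)z^{-n-1}$ with $h_n(\mu)=\frac n2\sum_{t+s=n,\ \sigma\in S_{NC}(t,s)}\frac{r_\sigma(\mu)}{ts}$, the sum over ordered pairs of integers $t,s\ge1$. Here, with $\gamma_{t,s}=(1,\dots,t)(t+1,\dots,t+s)\in S_{t+s}$, $S_{NC}(t,s)$ is the set of $\sigma\in S_{t+s}$ such that $\langle\sigma,\gamma_{t,s}\rangle$ acts transitively on $[t+s]$ and $|\sigma|+|\sigma^{-1}\gamma_{t,s}|=t+s$, $|\cdot|$ counting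 cycles including fixed points. The subordination functions are the unique analytic maps $\omega_1,\omega_2:\mathbb C^+\to\mathbb C^+$ with $\mathcal G_{\mu\boxplus\nu}(z)=\mathcal G_\mu(\omega_1(z))=\mathcal G_\nu(\omega_2(z))=\frac1{\omega_1(z)+\omega_2(z)-z}$ for $z\in\mathbb C^+$, where $\mathcal G_\mu(z)=\int_{\mathbb R}\frac{1}{z-t}\,d\mu(t)$. In the claim, an identity of formal series in $z^{-1}$, $\omega_1,\omega_2$ are read as their expansions at infinity, i.e. as the formal series of the form $z+c_0+c_1z^{-1}+\cdots$ with $G_{\mu\boxplus\nu}=G_\mu\circ\omega_1=G_\nu\circ\omega_2$. *)

(* Defs.v *)
From HB Require Import structures.
From mathcomp Require Import all_boot all_order all_algebra all_fingroup.
From mathcomp Require Import all_classical all_reals all_analysis.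

Set Implicit Arguments.
Unset Strict Implicit.
Unset Printing Implicit Defensive.

Import Order.TTheory GRing.Theory Num.Theory.
Import numFieldNormedType.Exports.

Local Open Scope classical_set_scope.
Local Open Scope ring_scope.

(* [srec F] is the sequence [f] with [f n = F f n], for [F f n] depending only
   on the values of [f] below [n]; see [srecE]. *)
Fixpoint srec_seq (R : nmodType) (F : (nat -> R) -> nat -> R) (n : nat) :
    seq R :=
  if n is k.+1 then let s := srec_seq F k in rcons s (F (nth 0 s) k) else [::].

Definition srec (R : nmodType) (F : (nat -> R) -> nat -> R) (n : nat) : R :=
  nth 0 (srec_seq F n.+1) n.

Lemma size_srec_seq (R : nmodType) (F : (nat -> R) -> nat -> R) n :
  size (srec_seq F n) = n.
Proof. by elim: n => //= n IH; rewrite size_rcons IH. Qed.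

Lemma nth_srec_seq (R : nmodType) (F : (nat -> R) -> nat -> R) n k :
  (k < n)%N -> nth 0 (srec_seq F n) k = srec F k.
Proof.
elim: n => // n IH; rewrite ltnS leq_eqVlt => /predU1P[->//|kn].
by rewrite /= nth_rcons size_srec_seq kn IH.
Qed.

Lemma srecE (R : nmodType) (F : (nat -> R) -> nat -> R) n :
  (forall f g : nat -> R, (forall k, (k < n)%N -> f k = g k) -> F f n = F g n) ->
  srec F n = F (srec F) n.
Proof.
move=> HF; rewrite /srec /= nth_rcons size_srec_seq ltnn eqxx.
by apply: HF => k kn; rewrite nth_srec_seq.
Qed.

Definition real_rooted (R : realType) (d : nat) (p : {poly R}) : Prop :=
  exists2 s : seq R, size s = d & p = \prod_(x <- s) ('X - x%:P).

(* The roots listed with multiplicity, in an unspecified order; [[::]] if [p]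
   is not a product of monic linear factors. *)
Definition poly_roots (R : realType) (p : {poly R}) : seq R :=
  xget [::] [set s | p = \prod_(x <- s) ('X - x%:P)].

Definition poly_moment (R : realType) (d : nat) (p : {poly R}) (n : nat) : R :=
  d%:R^-1 * \sum_(x <- poly_roots p) x ^+ n.

(* Solved from p = \sum_k (-1)^k 'C(d, k) e_k 'X^(d - k). *)
Definition ffcoef (R : realType) (d : nat) (p : {poly R}) (k : nat) : R :=
  (-1) ^+ k * p`_(d - k) / 'C(d, k)%:R.

Definition ffconv (R : realType) (d : nat) (p q : {poly R}) : {poly R} :=
  \sum_(k < d.+1) ((-1) ^+ k * 'C(d, k)%:R *
    \sum_(i < k.+1) 'C(k, i)%:R * ffcoef d p i * ffcoef d q (k - i))
      *: 'X^(d - k).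

Lemma ffcoefK (R : realType) (d : nat) (p : {poly R}) : (size p <= d.+1)%N ->
  p = \sum_(k < d.+1) ((-1) ^+ k * 'C(d, k)%:R * ffcoef d p k) *: 'X^(d - k).
Proof.
move=> sp; rewrite -[LHS]coefK poly_def.
under [RHS]eq_bigr => k _.
  rewrite /ffcoef mulrACA mulfV; last first.
    by rewrite pnatr_eq0 -lt0n bin_gt0 -ltnS.
  rewrite mulr1 signrMK; over.
rewrite (big_ord_widen _ (fun i => p`_i *: 'X^i) sp) big_mkcond /=.
rewrite (reindex_inj rev_ord_inj) /=; apply: eq_bigr => i _; rewrite subSS.
by case: ltnP => // h; rewrite nth_default ?scale0r.
Qed.

Definition noncrossing (n : nat) (P : {set {set 'I_n}}) : bool :=
  [forall V in P, forall W in P, (V != W) ==>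
    ~~ [exists a : 'I_n, exists b : 'I_n, exists c : 'I_n, exists d : 'I_n,
          [&& (a < b)%N, (b < c)%N, (c < d)%N,
              a \in V, b \in W, c \in V & d \in W]]].

Definition NC (n : nat) : {set {set {set 'I_n}}} :=
  [set P | finset.partition P [set: 'I_n] & noncrossing P]%SET.

Definition part_prod (R : realType) (u : nat -> R) (n : nat)
    (P : {set {set 'I_n}}) : R :=
  \prod_(V in P) u #|V|.

Definition part_prodD (R : realType) (u : nat -> R) (n : nat)
    (P : {set {set 'I_n}}) (V : {set 'I_n}) : R :=
  \prod_(W in P | W != V) u #|W|.

(* [free_cumulant m n] is the [n]-th free cumulant attached to the moment
   sequence [m]: the moment-cumulant formula [free_cumulantP] solved for the
   term of the one-block partition. The value at [n = 0] is irrelevant. *)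
Definition free_cumulant (R : realType) (m : nat -> R) : nat -> R :=
  srec (fun r n =>
    m n - \sum_(P in NC n | P != [set [set: 'I_n]]%SET) part_prod r P).

(* Same convention, for the formula [inf_free_cumulantP]. *)
Definition inf_free_cumulant (R : realType) (m m' : nat -> R) : nat -> R :=
  srec (fun r' n =>
    m' n - \sum_(P in NC n | P != [set [set: 'I_n]]%SET)
             \sum_(V in P) r' #|V| * part_prodD (free_cumulant m) P V).

Lemma NC_one (n : nat) : (0 < n)%N -> [set [set: 'I_n]]%SET \in NC n.
Proof.
move=> n0; rewrite inE; apply/andP; split.
  apply/and3P; split; first by rewrite /finset.cover big_set1.
    by apply/finset.trivIsetP => A B /set1P-> /set1P->; rewrite eqxx.
  apply/negP => /set1P /esym/finset.setP/(_ (Ordinal n0)).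
  by rewrite !inE.
apply/forall_inP => V /set1P->; apply/forall_inP => W /set1P->.
by rewrite eqxx.
Qed.

Lemma NC_block_lt (n : nat) (P : {set {set 'I_n}}) (V : {set 'I_n}) :
  P \in NC n -> P != [set [set: 'I_n]]%SET -> V \in P -> (#|V| < n)%N.
Proof.
rewrite inE => /andP[/and3P[_ tP P0] _] PnT VP.
have := max_card (mem V); rewrite card_ord leq_eqVlt => /predU1P[cV|//].
have VT : V = [set: 'I_n]%SET.
  by apply/eqP; rewrite eqEcard finset.subsetT cardsT card_ord cV leqnn.
case/eqP: PnT; apply/finset.setP => W; rewrite inE; apply/idP/eqP => [WP|->].
  apply/eqP; rewrite -VT; apply: contraT => WV.
  move/finset.trivIsetP/(_ W V WP VP WV): tP.
  rewrite -finset.setI_eq0 VT finset.setIT => /eqP W0.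
  by rewrite -W0 WP in P0.
by rewrite -VT.
Qed.

Lemma free_cumulantP (R : realType) (m : nat -> R) (n : nat) : (0 < n)%N ->
  m n = \sum_(P in NC n) part_prod (free_cumulant m) P.
Proof.
move=> n0; rewrite (bigD1 [set [set: 'I_n]]%SET) ?NC_one //=.
rewrite {1}/part_prod big_set1 cardsT card_ord {1}/free_cumulant srecE.
  by rewrite subrK.
move=> f g fg; congr (_ - _); apply: eq_bigr => P /andP[PN P1].
by apply: eq_bigr => V VP; apply: fg; apply: NC_block_lt VP.
Qed.

Lemma inf_free_cumulantP (R : realType) (m m' : nat -> R) (n : nat) :
  (0 < n)%N ->
  m' n = \sum_(P in NC n) \sum_(V in P)
           inf_free_cumulant m m' #|V| * part_prodD (free_cumulant m) P V.
Proof.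
move=> n0; rewrite (bigD1 [set [set: 'I_n]]%SET) ?NC_one //=.
rewrite big_set1 /part_prodD big_pred0 ?mulr1; last first.
  by move=> W; rewrite inE; case: eqP.
rewrite cardsT card_ord {1}/inf_free_cumulant srecE; first by rewrite subrK.
move=> f g fg; congr (_ - _); apply: eq_bigr => P /andP[PN P1].
by apply: eq_bigr => V VP; rewrite fg //; apply: NC_block_lt VP.
Qed.

(* On the 0-based ['I_(t + s)], the permutation with the two cycles
   (0, ..., t - 1) and (t, ..., t + s - 1). *)
Definition two_cycle_fun (t s : nat) (i : 'I_(t + s)) : 'I_(t + s) :=
  unsplit (match fintype.split i with
           | inl j => inl (ordS j)
           | inr j => inr (ordS j)
           end).

Lemma two_cycle_fun_inj (t s : nat) : injective (@two_cycle_fun t s).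
Proof.
move=> i j /(can_inj (@unsplitK t s)) E; apply: (can_inj (@splitK t s)).
by case: (fintype.split i) (fintype.split j) E => [a|a] [b|b] // [E];
  congr (_ _); apply: ordS_inj; apply: val_inj.
Qed.

Definition two_cycle (t s : nat) : 'S_(t + s) := perm (@two_cycle_fun_inj t s).

(* [*] of permutations is composition in diagrammatic order; the cycle count
   of [sigma^-1 * two_cycle t s] is the same in either order. *)
Definition S_NC (t s : nat) : {set 'S_(t + s)} :=
  [set sigma |
    [transitive <<[set sigma; two_cycle t s]>>, on [set: 'I_(t + s)] | 'P]
    && (#|porbits sigma| + #|porbits (sigma^-1 * two_cycle t s)%g|
        == t + s)%N]%SET.

Definition cycle_prod (R : realType) (u : nat -> R) (n : nat) (sigma : 'S_n) :
    R :=
  \prod_(c in porbits sigma) u #|c|.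

Definition annular_coef (R : realType) (m : nat -> R) (n : nat) : R :=
  n%:R / 2 * \sum_(1 <= t < n) \sum_(sigma in S_NC t (n - t))
    cycle_prod (free_cumulant m) sigma / (t%:R * (n - t)%:R).

Definition moment (R : realType) (mu : probability (measurableTypeR R) R)
    (n : nat) : R :=
  \int[mu]_x (x ^+ n).

Definition finite_moments (R : realType)
    (mu : probability (measurableTypeR R) R) : Prop :=
  forall n, mu.-integrable [set: measurableTypeR R] (fun x => (x ^+ n)%:E).

Definition moment_determinate (R : realType)
    (mu : probability (measurableTypeR R) R) : Prop :=
  finite_moments mu /\
  forall nu : probability (measurableTypeR R) R,
    finite_moments nu -> (forall n, moment nu n = moment mu n) ->
    forall A : set (measurableTypeR R), measurable A -> nu A = mu A.

Definition functional_moment (R : realType) (mu' : {scalar {poly R}})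
    (n : nat) : R :=
  mu' 'X^n.

Definition infinitesimal_distribution (R : realType) (p : nat -> {poly R})
    (mu : probability (measurableTypeR R) R) (mu' : {scalar {poly R}}) : Prop :=
  [/\ forall d, (0 < d)%N -> real_rooted d (p d),
      finite_moments mu,
      forall n, poly_moment d (p d) n @[d --> \oo] --> moment mu n,
      mu' 1 = 0
    & forall n, (0 < n)%N ->
        d%:R * (poly_moment d (p d) n - moment mu n) @[d --> \oo]
          --> functional_moment mu' n].

(* gam = mu boxplus nu *)
Definition free_convolution (R : realType)
    (mu nu gam : probability (measurableTypeR R) R) : Prop :=
  moment_determinate gam /\
  forall n, (0 < n)%N ->
    free_cumulant (moment gam) n =
    free_cumulant (moment mu) n + free_cumulant (moment nu) n.

(* (gam, gam') = (mu, mu') boxplus_B (nu, nu') *)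
Definition inf_free_convolution (R : realType)
    (mu : probability (measurableTypeR R) R) (mu' : {scalar {poly R}})
    (nu : probability (measurableTypeR R) R) (nu' : {scalar {poly R}})
    (gam : probability (measurableTypeR R) R) (gam' : {scalar {poly R}}) :
    Prop :=
  [/\ free_convolution mu nu gam,
      gam' 1 = 0
    & forall n, (0 < n)%N ->
        inf_free_cumulant (moment gam) (functional_moment gam') n =
        inf_free_cumulant (moment mu) (functional_moment mu') n +
        inf_free_cumulant (moment nu) (functional_moment nu') n].

(* [a : nat -> R] stands for \sum_n a_n z^(-n); sums are pointwise. *)

Definition fps_one (R : realType) (n : nat) : R := (n == 0)%:R.

Definition fps_shift (R : realType) (a : nat -> R) (n : nat) : R :=
  if n is k.+1 then a k else 0.

Definition fps_mul (R : realType) (a b : nat -> R) (n : nat) : R :=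
  \sum_(i < n.+1) a i * b (n - i)%N.

Definition fps_exp (R : realType) (a : nat -> R) (k : nat) : nat -> R :=
  iter k (fps_mul a) (@fps_one R).

(* Multiplicative inverse when [a 0 != 0], see [fps_mulV]. *)
Definition fps_inv (R : realType) (a : nat -> R) : nat -> R :=
  srec (fun b n =>
    (a 0)^-1 * (fps_one R n - \sum_(i < n) a i.+1 * b (n - i.+1)%N)).

Definition fps_div (R : realType) (a b : nat -> R) : nat -> R :=
  fps_mul a (fps_inv b).

Lemma fps_mulV (R : realType) (a : nat -> R) :
  a 0 != 0 -> fps_mul a (fps_inv a) = @fps_one R.
Proof.
move=> a0; apply/funext => n; rewrite /fps_mul big_ord_recl subn0 /=.
rewrite {1}/fps_inv srecE; first by rewrite mulVKf // subrK.
move=> f g fg; congr (_ * (_ - _)); apply: eq_bigr => i _.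
by rewrite fg // ltn_subrL /=; case: n i {fg} => [[]|].
Qed.

(* The derivative is with respect to [z]. *)
Definition fps_deriv (R : realType) (a : nat -> R) (n : nat) : R :=
  if n is k.+1 then - (k%:R * a k) else 0.

(* [c : nat -> R] encodes omega(z) = z + \sum_k c_k z^(-k).
   [omega_inv c] is 1 / omega = z^-1 / (omega / z), and in [fps_comp_omega]
   only the terms [k <= n] are summed since (1 / omega)^k starts at z^(-k). *)

Definition omega_over_z (R : realType) (c : nat -> R) : nat -> R :=
  fun n => if n is k.+1 then c k else 1.

Definition omega_inv (R : realType) (c : nat -> R) : nat -> R :=
  fps_shift (fps_inv (omega_over_z c)).

Definition fps_comp_omega (R : realType) (g c : nat -> R) (n : nat) : R :=
  \sum_(k < n.+1) g k * fps_exp (omega_inv c) k n.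

Definition omega_deriv (R : realType) (c : nat -> R) : nat -> R :=
  @fps_one R + fps_deriv c.

Definition omega_deriv2 (R : realType) (c : nat -> R) : nat -> R :=
  fps_deriv (omega_deriv c).

Definition cauchy_measure (R : realType)
    (mu : probability (measurableTypeR R) R) : nat -> R :=
  fps_shift (moment mu).

Definition cauchy_functional (R : realType) (mu' : {scalar {poly R}}) :
    nat -> R :=
  fps_shift (functional_moment mu').

Definition annular_series (R : realType)
    (mu : probability (measurableTypeR R) R) : nat -> R :=
  fps_shift (fun n => if (2 <= n)%N then annular_coef (moment mu) n else 0).

(* [c] encodes the expansion at infinity of the subordination function of
   [gam] with respect to [mu]: G_gam = G_mu \o omega. *)
Definition subordination (R : realType)
    (gam mu : probability (measurableTypeR R) R) (c : nat -> R) : Prop :=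
  cauchy_measure gam = fps_comp_omega (cauchy_measure mu) c.

(* Main.v *)
Require Import Defs.
From HB Require Import structures.
From mathcomp Require Import all_boot all_order all_algebra all_fingroup.
From mathcomp Require Import all_classical all_reals all_analysis.
From mathcomp Require Import ring lra zify.
From mathcomp Require Import complex.

(** A real-rooted polynomial p of degree d, divided by z^d, is a series a in w
    = 1/z, and its moments are read off the logarithmic derivative of a
    (Newton). Writing p = P(d/dz) z^d makes a and P differ by falling
    factorials, and turns the convolution into the product of the operators P.
    Hence the coefficients of the logarithmic derivative of P, suitably
    scaled, are additive: these are the finite free cumulants kappa_j
    ([ffcumulantM]). Reading the equation of P as a differential equation for
    a gives an exact relation m_n = [n = 0] + sum_j kappa_j (B_j)_n with B_j =
    (G + d^-1 D)^j 1, where G = w m is the Cauchy transform and D = d/dz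
    ([moment_finite_cumulant]).

    Expanding this relation to first order in 1/d, with phi = 1 + sum_k r_k
    u^k the generating series of free cumulants, yields m = phi(G) for the
    limit and, for the first-order terms m1 of the moments and s of the
    cumulants, m1 = s(G) + phi'(G) w m1 + psi(G) DG, where psi is half the
    second derivative of phi ([first_order_eq]). The system is triangular, so
    expansions of the moments give expansions of the cumulants
    ([cumulant_expansion]) and conversely ([moment_expansion]); adding
    cumulants therefore shows that the convolution has an infinitesimal
    distribution, provided that it is real-rooted. The latter is the theorem
    of Walsh, obtained from Laguerre's theorem on polar derivatives
    ([real_rooted_ffconv]).

    Infinitesimal free cumulants r' satisfy the same relation without its last
    term, m1 = r'(G) + phi'(G) w m1: the moment-cumulant formula over
    non-crossing partitions is equivalent to m = phi(G) over every commutative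
    ring ([NC_momser]), and one applies it to the weights r + r' X and
    compares coefficients of X ([inf_moment_cumulant_series]). So s and r'
    differ by an explicit expression in G alone. Put F = 1/G and q = 1/F'
    ([qser]); then 2 (r' - s)(G) DG = G Dq / q. Substituting the subordination
    functions sends the Cauchy transforms of both mu and nu to that of their
    free convolution, and F_gam = F_mu o omega gives q_mu o omega = q_gam
    omega', so that Dq / q acquires the extra term omega'' / omega'
    ([subst_relation]). The sum of the two relations, compared with the one
    for gam, is G_rho' = G_gam' + (Dq / q) / 2 + omega1'' / (2 omega1') +
    omega2'' / (2 omega2') with q attached to gam ([convolution_identity]).

    It remains to identify H with (Dq / q) / 2, that is with - F'' / (2 F').
    By the first-order relation with s = 0, the series - (Dq / q) / 2 is the
    first-order term of the Cauchy transform attached to the sequence whose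
    finite free cumulants are r_1, r_2, ... for every d. These moments are
    computed combinatorially; |alpha| denotes the number of cycles of a
    permutation alpha of n points. The series a is, up to normalization, a
    coefficientwise product of two exponential generating series of
    permutations, weighted by - d r_|c| and by (-1)^(|c| - 1) d at each cycle
    c, and by the exponential formula for pairs of permutations
    ([exponential_formula]) its logarithmic derivative counts the pairs
    (alpha, beta) acting transitively. A pair (alpha, beta) contributes the
    power |alpha| + |beta| - n - 1 of d, and the genus bound |alpha| + |beta|
    + |alpha beta| <= n + 2 ([genus_bound]) leaves for the 1/d term the pairs
    with |alpha| + |beta| = n; by parity alpha beta has then exactly two
    cycles ([planar_two_cycles]), which are the annular non-crossing
    permutations after relabelling ([annular_coef_pairs]). *)

Set Implicit Arguments.
Unset Strict Implicit.
Unset Printing Implicit Defensive.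
Import Order.TTheory GRing.Theory Num.Theory.
Import numFieldNormedType.Exports.
Local Open Scope ring_scope.

(** * Formal power series: ring structure, substitution, derivation *)

(** A type of its own, so that the product is the Cauchy product and not the
    pointwise product of functions. *)
Definition ser (K : comNzRingType) : Type := nat -> K.

Section SerRing.
Variable K : comNzRingType.
Local Notation S := (ser K).
Implicit Types f g h u v : S.

HB.instance Definition _ := GRing.Zmodule.copy S (nat -> K).

Definition sone : S := fun n => (n == 0)%:R.
Definition smul f g : S := fun n => \sum_(i < n.+1) f i * g (n - i)%N.

(** Truncations at degree n determine products up to degree n, so the ring
    laws are inherited from polynomials. *)
Definition spoly (n : nat) f : {poly K} := \poly_(i < n.+1) f i.

Lemma smul_coef n m f g : (m <= n)%N -> smul f g m = (spoly n f * spoly n g)`_m.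
Proof.
move=> mn; rewrite coefM; apply: eq_bigr => i _.
rewrite !coef_poly !ltnS (leq_trans _ mn) ?(leq_trans _ mn) ?leq_subr //.
by rewrite -ltnS.
Qed.

Lemma smulC : commutative smul.
Proof. by move=> f g; apply/funext => n; rewrite !(smul_coef _ _ (leqnn n)) mulrC. Qed.

Lemma spolyM n m f g : (m <= n)%N -> (spoly n (smul f g))`_m = (spoly n f * spoly n g)`_m.
Proof. by move=> mn; rewrite coef_poly ltnS mn (smul_coef f g mn). Qed.

Lemma smulA : associative smul.
Proof.
move=> f g h; apply/funext => n; rewrite !(smul_coef _ _ (leqnn n)).
have E1 : (spoly n f * spoly n (smul g h))`_n = (spoly n f * (spoly n g * spoly n h))`_n.
  by rewrite !coefM; apply: eq_bigr => i _; rewrite spolyM ?leq_subr.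
have E2 : (spoly n (smul f g) * spoly n h)`_n = (spoly n f * spoly n g * spoly n h)`_n.
  by rewrite !coefM; apply: eq_bigr => i _; rewrite spolyM // -ltnS.
by rewrite E1 E2 mulrA.
Qed.

Lemma smul1r : left_id sone smul.
Proof.
move=> f; apply/funext => n; rewrite /smul big_ord_recl /sone subn0 mul1r.
by rewrite big1 ?addr0 // => i _; rewrite mul0r.
Qed.

Lemma smulDl : left_distributive smul +%R.
Proof.
move=> f g h; apply/funext => n; rewrite /smul.
rewrite -[RHS]big_split; apply: eq_bigr => i _; exact: mulrDl.
Qed.

Lemma sone_neq0 : sone != 0 :> S.
Proof.
by apply/eqP => /(congr1 (fun f : S => f 0%N)); apply/eqP; rewrite oner_neq0.
Qed.

HB.instance Definition _ :=
  GRing.Zmodule_isComNzRing.Build S smulA smulC smul1r smulDl sone_neq0.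

Lemma saddE f g n : (f + g) n = f n + g n. Proof. by []. Qed.
Lemma soppE f n : (- f) n = - f n. Proof. by []. Qed.
Lemma s0E n : (0 : S) n = 0. Proof. by []. Qed.
Lemma s1E n : (1 : S) n = (n == 0)%:R. Proof. by []. Qed.
Lemma smulE f g n : (f * g) n = \sum_(i < n.+1) f i * g (n - i)%N.
Proof. by []. Qed.

Lemma smulnE f k n : (f *+ k) n = f n *+ k.
Proof. by elim: k => // k IH; rewrite !mulrS saddE IH. Qed.

Lemma smul0E f g : (f * g) 0%N = f 0%N * g 0%N.
Proof. by rewrite smulE big_ord_recl big_ord0 addr0. Qed.

Definition sC (c : K) : S := fun n => if n is 0 then c else 0.

Lemma smulCE c f n : (sC c * f) n = c * f n.
Proof.
rewrite smulE big_ord_recl subn0 big1 ?addr0 // => i _; exact: mul0r.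
Qed.

Definition sw : S := fun n => (n == 1)%:R.

Lemma smulwE f n : (sw * f) n = if n is k.+1 then f k else 0.
Proof.
rewrite smulE; case: n => [|n]; first by rewrite big_ord_recl big_ord0 mul0r addr0.
rewrite !big_ord_recl /= mul0r add0r mul1r subn1 big1 ?addr0 // => i _.
exact: mul0r.
Qed.

Lemma sw_inj f g : sw * f = sw * g -> f = g.
Proof.
move=> E; apply/funext => n.
by move: (congr1 (fun h : S => h n.+1) E); rewrite !smulwE.
Qed.

Definition stl f : S := fun n => f n.+1.

Lemma stlE f : f = sC (f 0%N) + sw * stl f.
Proof.
apply/funext => n; rewrite saddE smulwE.
by case: n => [|n] /=; rewrite ?addr0 ?add0r.
Qed.

Lemma stlM f g : stl (f * g) = sC (f 0%N) * stl g + stl f * g.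
Proof.
apply: sw_inj; apply: (@addrI _ (sC ((f * g) 0%N))).
rewrite -stlE {1}[f]stlE {1}[g]stlE smul0E.
have -> : sC (f 0%N * g 0%N) = sC (f 0%N) * sC (g 0%N).
  by apply/funext => n; rewrite smulCE; case: n => [|n] /=; rewrite ?mulr0.
rewrite {5}[g]stlE; ring.
Qed.

Lemma spow_lt v k n : v 0%N = 0 -> (n < k)%N -> (v ^+ k) n = 0.
Proof.
move=> v0; elim: k n => // k IH n nk; rewrite exprS smulE.
rewrite big_ord_recl v0 mul0r add0r big1 // => i _; rewrite IH ?mulr0 //.
by rewrite lift0; case: n nk i => [|n] nk i; [case: i | rewrite subSS; lia].
Qed.

Definition scomp f v : S := fun n => \sum_(k < n.+1) f k * (v ^+ k) n.

Lemma scomp_widen f v n N : v 0%N = 0 -> (n <= N)%N ->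
  scomp f v n = \sum_(k < N.+1) f k * (v ^+ k) n.
Proof.
move=> v0 nN; rewrite /scomp (big_ord_widen N.+1 (fun k => f k * (v ^+ k) n)) ?ltnS //.
rewrite big_mkcond /=; apply: eq_bigr => k _.
by case: ltnP => // nk; rewrite spow_lt ?mulr0.
Qed.

Lemma scomp_rec f v : v 0%N = 0 ->
  scomp f v = sC (f 0%N) + v * scomp (stl f) v.
Proof.
move=> v0; apply/funext => n; rewrite saddE /scomp big_ord_recl expr0.
congr (_ + _); first by rewrite s1E; case: n => [|n] /=; rewrite ?mulr1 ?mulr0.
rewrite smulE.
transitivity (\sum_(i < n.+1) v i * \sum_(k < n) f k.+1 * (v ^+ k) (n - i)%N).
  under [RHS]eq_bigr do rewrite mulr_sumr.
  rewrite exchange_big /=; apply: eq_bigr => k _.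
  rewrite exprS smulE mulr_sumr; apply: eq_bigr => i _; rewrite /bump /=; ring.
apply: eq_bigr => -[i /= ilt] _.
case: i ilt => [|i] ilt; first by rewrite v0 !mul0r.
congr (_ * _); case: n ilt => [|n] ilt; first by [].
by rewrite [RHS](@scomp_widen _ _ _ n) // subSS leq_subr.
Qed.

(** Identities for substitution are proved by letting [X] be the difference of
    their sides: by [scomp_rec] it satisfies the recursion of the hypothesis,
    and it vanishes because v raises the order by one at each step. *)
Lemma sfix0 (I : Type) (X : I -> S) (t : I -> I) v : v 0%N = 0 ->
  (forall i, X i = v * X (t i)) -> forall i, X i = 0.
Proof.
move=> v0 HX i; apply/funext => n.
elim/ltn_ind: n i => n IH i; rewrite HX smulE big_ord_recl v0 mul0r add0r.
rewrite big1 // => j _; rewrite IH ?mulr0 //.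
by rewrite lift0; case: n j {IH} => [|n] j; [case: j | rewrite ltn_subrL].
Qed.

Lemma scompD f g v : scomp (f + g) v = scomp f v + scomp g v.
Proof.
apply/funext => n; rewrite saddE -big_split; apply: eq_bigr => k _.
exact: mulrDl.
Qed.

Lemma scompN f v : scomp (- f) v = - scomp f v.
Proof.
apply/funext => n; rewrite soppE /scomp -sumrN; apply: eq_bigr => k _.
exact: mulNr.
Qed.

Lemma scompMn f k v : scomp (f *+ k) v = scomp f v *+ k.
Proof.
elim: k => [|k IH]; last by rewrite !mulrS scompD IH.
by apply/funext => n; rewrite /scomp big1 // => i _; exact: mul0r.
Qed.

Lemma scompZ c f v : scomp (sC c * f) v = sC c * scomp f v.
Proof.
apply/funext => n; rewrite smulCE /scomp mulr_sumr; apply: eq_bigr => k _.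
by rewrite smulCE mulrA.
Qed.

Lemma scompM f g v : v 0%N = 0 -> scomp (f * g) v = scomp f v * scomp g v.
Proof.
move=> v0; apply/eqP; rewrite -subr_eq0; apply/eqP.
pose X f := scomp (f * g) v - scomp f v * scomp g v.
apply: (@sfix0 _ X stl v v0) => {}f; rewrite /X.
rewrite [scomp (f * g) v]scomp_rec // [scomp f v]scomp_rec //.
rewrite stlM scompD scompZ smul0E.
have -> : sC (f 0%N * g 0%N) = sC (f 0%N) * sC (g 0%N).
  by apply/funext => n; rewrite smulCE; case: n => [|n] /=; rewrite ?mulr0.
rewrite [scomp g v]scomp_rec //; ring.
Qed.

Lemma scompC c v : v 0%N = 0 -> scomp (sC c) v = sC c.
Proof.
move=> v0; rewrite scomp_rec // [X in v * X](_ : _ = 0) ?mulr0 ?addr0 //.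
by apply/funext => n; rewrite /scomp big1 // => i _; exact: mul0r.
Qed.

Lemma scompw v : v 0%N = 0 -> scomp sw v = v.
Proof.
move=> v0; rewrite scomp_rec // (_ : stl sw = sC 1) ?scompC //.
  have -> : sC 1 = 1 by apply/funext => -[].
  by rewrite mulr1 (_ : sC _ = 0) ?add0r //; apply/funext => -[].
by apply/funext => -[].
Qed.

Lemma scomp1 v : v 0%N = 0 -> scomp 1 v = 1.
Proof.
move=> v0; rewrite (_ : 1 = sC 1) ?scompC //; by apply/funext => -[].
Qed.

Lemma scomp_eq0 f v : v 0%N = 0 -> (scomp f v) 0%N = f 0%N.
Proof. by move=> v0; rewrite scomp_rec // saddE smul0E v0 mul0r addr0. Qed.

Lemma scompA f u v : u 0%N = 0 -> v 0%N = 0 ->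
  scomp (scomp f u) v = scomp f (scomp u v).
Proof.
move=> u0 v0; apply/eqP; rewrite -subr_eq0; apply/eqP.
pose X f := scomp (scomp f u) v - scomp f (scomp u v).
have c0 : scomp u v 0%N = 0 by rewrite scomp_eq0.
apply: (@sfix0 _ X stl (scomp u v)) => // {}f; rewrite /X.
rewrite [scomp f u]scomp_rec // [scomp f (scomp u v)]scomp_rec //.
rewrite scompD scompC // scompM //; ring.
Qed.

(** The derivative in z of a series in w = 1/z. *)
Definition sD f : S := fun n => if n is k.+1 then - (k%:R * f k) else 0.
(** The derivative in the variable of the series, in contrast to [sD]. *)
Definition sd f : S := fun n => n.+1%:R * f n.+1.

Definition stheta f : S := fun n => n%:R * f n.

Lemma sDE f : sD f = - (sw * stheta f).
Proof. by apply/funext => n; rewrite soppE smulwE; case: n => [|n] /=; rewrite ?oppr0. Qed.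

Lemma sthetaD f g : stheta (f + g) = stheta f + stheta g.
Proof. by apply/funext => n; rewrite saddE /stheta saddE mulrDr. Qed.

Lemma sthetaM f g : stheta (f * g) = stheta f * g + f * stheta g.
Proof.
apply/funext => n; rewrite saddE !smulE -big_split /stheta smulE mulr_sumr.
apply: eq_bigr => i _ /=.
have -> : n%:R = i%:R + (n - i)%N%:R :> K by rewrite -natrD subnKC // -ltnS.
ring.
Qed.

Lemma sthetaC c : stheta (sC c) = 0.
Proof. by apply/funext => -[|n]; rewrite /stheta /= ?mul0r ?mulr0. Qed.

Lemma sDD f g : sD (f + g) = sD f + sD g.
Proof. by rewrite !sDE sthetaD; ring. Qed.
Lemma sDM f g : sD (f * g) = sD f * g + f * sD g.
Proof. by rewrite !sDE sthetaM; ring. Qed.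
Lemma sDC c : sD (sC c) = 0.
Proof. by rewrite sDE sthetaC; ring. Qed.
Lemma sD1 : sD 1 = 0.
Proof. by rewrite (_ : 1 = sC 1) ?sDC //; apply/funext => -[]. Qed.
Lemma sDN f : sD (- f) = - sD f.
Proof.
by apply/funext => -[|n] /=; rewrite soppE /= ?oppr0 // mulrN.
Qed.

Lemma sDw : sD sw = - sw ^+ 2.
Proof.
rewrite sDE expr2; congr (- (_ * _)).
by apply/funext => -[|[|n]]; rewrite /stheta /sw /= ?mul0r ?mul1r ?mulr0.
Qed.

Lemma sDX f k : sD (f ^+ k) = f ^+ k.-1 * sD f *+ k.
Proof.
elim: k => [|k IH]; first by rewrite expr0 sD1 mulr0n.
rewrite exprS sDM IH mulrnAr mulrA -exprS mulrC mulrS.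
by case: k {IH} => [|k] /=; rewrite ?mulr0n.
Qed.

Lemma sD_comp f v : v 0%N = 0 -> sD (scomp f v) = scomp (sd f) v * sD v.
Proof.
move=> v0; apply/eqP; rewrite -subr_eq0; apply/eqP.
pose X f := sD (scomp f v) - scomp (sd f) v * sD v.
apply: (@sfix0 _ X stl v v0) => {}f; rewrite /X.
have -> : sd f = stl f + sw * sd (stl f).
  apply/funext => n; rewrite saddE smulwE /sd /stl.
  by case: n => [|n]; rewrite ?mul1r ?addr0 // -natr1 mulrDl mul1r addrC.
rewrite scompD scompM // scompw // [scomp f v]scomp_rec // sDD sDC sDM; ring.
Qed.

End SerRing.

Section RealSeries.
Variable R : realType.
Implicit Types a f g v : ser R.

Lemma fps_mulE f g : fps_mul f g = f * g :> ser R.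
Proof. by []. Qed.

Lemma fps_shiftE f : fps_shift f = sw R * f :> ser R.
Proof. by apply/funext => n; rewrite smulwE. Qed.

Lemma fps_expE f k : fps_exp f k = f ^+ k :> ser R.
Proof. by elim: k => // k IH; rewrite exprS -IH. Qed.

Lemma ser_mulVr a : a 0%N != 0 -> a * (fps_inv a : ser R) = 1.
Proof. exact: fps_mulV. Qed.

Lemma ser_mulIr a f g : a 0%N != 0 -> f * a = g * a -> f = g.
Proof.
move=> a0 /(congr1 (fun h => h * (fps_inv a : ser R))).
by rewrite -!mulrA ser_mulVr // !mulr1.
Qed.

Lemma ser_mulwIr a f g : a 0%N != 0 -> f * (sw R * a) = g * (sw R * a) -> f = g.
Proof. by move=> a0; rewrite [f * _]mulrCA [g * _]mulrCA => /sw_inj/(ser_mulIr a0). Qed.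

End RealSeries.

(** * Finite free cumulants *)

Section FiniteCumulants.
Variables (R : realType) (d : R).
Hypothesis d0 : d != 0.

Definition rfall (k : nat) : R := \prod_(i < k) (d - i%:R).

Lemma rfallS k : rfall k.+1 = rfall k * (d - k%:R).
Proof. by rewrite /rfall big_ord_recr. Qed.

(** G + d^-1 D is what (1/d) d/dz becomes after conjugation by p, when G is
    the Cauchy transform p' / (d p). *)
Fixpoint twisted_pow (G : ser R) (j : nat) : ser R :=
  if j is i.+1 then G * twisted_pow G i + sC d^-1 * sD (twisted_pow G i) else 1.

Lemma twisted_pow_lt G j n : G 0%N = 0 -> (n < j)%N -> twisted_pow G j n = 0.
Proof.
move=> G0; elim: j n => // j IH n nj; rewrite /= saddE smulCE smulE.
rewrite big_ord_recl G0 mul0r add0r big1 => [|i _].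
  case: n nj => [|n] nj /=; rewrite ?mulr0 ?addr0 //.
  by rewrite IH ?mulr0 ?oppr0 ?mulr0 ?addr0.
rewrite IH ?mulr0 // lift0.
by case: n nj i => [|n] nj i; [case: i | rewrite subSS; lia].
Qed.

(* [a] is z^-d P(d/dz) z^d. The hypothesis [kapP] says that the kap_j are the
   scaled coefficients of - t P'(t) / P(t), and [mP] is Newton's identity for
   [a]. *)
Variables (P kap m : ser R).
Let a : ser R := fun k => rfall k * P k.
Let G : ser R := sw R * m.
Hypothesis P0 : P 0%N = 1.
Hypothesis kapP : forall k,
  k%:R * P k = - \sum_(j < k) kap j.+1 * d^-1 ^+ j * P (k - j.+1)%N.
Hypothesis mP : stheta a = - (sC d * ((m - 1) * a)).

Let a0 : a 0%N = 1.
Proof. by rewrite /a P0 /rfall big_ord0 mulr1. Qed.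

Let G0 : G 0%N = 0. Proof. by rewrite /G smulwE. Qed.

(* (1/d) d/dz conjugated by z^d *)
Let L (b : ser R) : ser R := sw R * b + sC d^-1 * sD b.

Let iterL j k : iter j L a k =
  if (j <= k)%N then d^-1 ^+ j * rfall k * P (k - j)%N else 0.
Proof.
elim: j k => [|j IH] k; first by rewrite /= expr0 mul1r subn0.
rewrite iterS /L saddE smulwE smulCE.
case: k => [|k] /=; first by rewrite mulr0 addr0.
rewrite !IH ltnS; case: ifP => jk; last by rewrite !mulr0 oppr0 mulr0 addr0.
rewrite rfallS exprS subSS; field; exact: d0.
Qed.

Let sCV : sC d^-1 * sC d = 1 :> ser R.
Proof.
by apply/funext => n; rewrite smulCE s1E; case: n => [|n] /=; rewrite ?mulr0 ?mulVf.
Qed.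

Let LB j : iter j L a = twisted_pow G j * a.
Proof.
elim: j => [|j IH]; first by rewrite mul1r.
rewrite iterS IH /L sDM /=.
have -> : sD a = sC d * ((G - sw R) * a).
  by rewrite sDE mP /G; ring.
transitivity (sw R * (twisted_pow G j * a) + sC d^-1 * sD (twisted_pow G j) * a +
  (sC d^-1 * sC d) * (twisted_pow G j * ((G - sw R) * a))); first by ring.
rewrite sCV; ring.
Qed.

(** Newton's identity expresses (m - 1) a through the coefficients k P_k, and
    the equation of P rewrites this as sum_j kap_j L^j a, where L is (1/d)
    d/dz conjugated by z^d. Conjugation by a turns L^j a into B_j a, and a is
    invertible. *)
Lemma moment_finite_cumulant n :
  m n = (n == 0)%:R + \sum_(j < n) kap j.+1 * twisted_pow G j.+1 n.
Proof.
pose E : ser R := fun n => \sum_(j < n) kap j.+1 * twisted_pow G j.+1 n.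
suff: m - 1 = E.
  move/(congr1 (fun f : ser R => f n)); rewrite saddE soppE s1E => H.
  rewrite -[X in _ = _ + X]/(E n) -H.
  by rewrite addrC subrK.
apply: (@ser_mulIr _ a); rewrite ?a0 ?oner_neq0 //.
apply/funext => k.
have : (m - 1) * a = - (sC d^-1 * stheta a).
  by rewrite mP mulrN opprK [RHS]mulrA sCV mul1r.
move=> ->; rewrite soppE smulCE /stheta.
rewrite {1}/a [k%:R * _]mulrCA kapP !mulrN opprK.
transitivity (\sum_(j < k) kap j.+1 * (twisted_pow G j.+1 * a) k).
  rewrite !mulr_sumr; apply: eq_bigr => j _; rewrite -LB iterL ltn_ord exprS; ring.
rewrite smulE.
transitivity (\sum_(i < k.+1) \sum_(j < k) kap j.+1 * twisted_pow G j.+1 i * a (k - i)%N).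
  rewrite exchange_big /=; apply: eq_bigr => j _; rewrite smulE mulr_sumr.
  by apply: eq_bigr => i _; rewrite mulrA.
apply: eq_bigr => i _; rewrite /E mulr_suml.
have ik : (i <= k)%N by rewrite -ltnS.
rewrite (big_ord_widen k (fun j => kap j.+1 * twisted_pow G j.+1 i * a (k - i)%N) ik).
rewrite [RHS]big_mkcond; apply: eq_bigr => j _.
by case: ltnP => // ij; rewrite twisted_pow_lt ?ltnS // mulr0 mul0r.
Qed.

End FiniteCumulants.

Section PolySeries.
Variable R : realType.
Implicit Types (p q : {poly R}) (s : seq R).

(** The series z^-d p(z) in 1/z. *)
Definition pser (d : nat) p : ser R := fun k => if (k <= d)%N then p`_(d - k) else 0.

(** The coefficients P_k of the operator with p = P(d/dz) z^d. *)
Definition ffsym (d : nat) p : ser R :=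
  fun k => (-1) ^+ k * ffcoef d p k / k`!%:R.

Lemma rfall_ffact (d k : nat) : rfall d%:R k = (d ^_ k)%:R :> R.
Proof.
elim: k => [|k IH]; first by rewrite /rfall big_ord0.
rewrite rfallS IH ffactnSr natrM; case: (leqP k d) => [kd|dk].
  by rewrite natrB.
by rewrite ffact_small // !mul0r.
Qed.

Lemma pser_ffsym (d k : nat) p : pser d p k = rfall d%:R k * ffsym d p k.
Proof.
rewrite rfall_ffact /ffsym /ffcoef /pser; case: leqP => [kd|dk].
  rewrite -bin_ffact natrM mulrA [(-1) ^+ k * _]mulrA -signr_odd.
  have b0 : 'C(d, k)%:R != 0 :> R by rewrite pnatr_eq0 -lt0n bin_gt0.
  have f0 : k`!%:R != 0 :> R by rewrite pnatr_eq0 -lt0n fact_gt0.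
  by case: odd; field; rewrite b0 f0.
by rewrite ffact_small // mul0r.
Qed.

Lemma pser_ffconv (d k : nat) p q :
  pser d (ffconv d p q) k = rfall d%:R k * (ffsym d p * ffsym d q) k.
Proof.
rewrite /pser; case: leqP => [kd|dk]; last by rewrite rfall_ffact ffact_small // mul0r.
rewrite /ffconv coef_sum (bigD1 (Ordinal (kd : k < d.+1)%N)) //=.
rewrite coefZ coefXn eqxx mulr1 [X in _ + X]big1 ?addr0; last first.
  move=> i ik; rewrite coefZ coefXn; case: eqP => [e|]; last by rewrite mulr0.
  case/eqP: ik; apply: val_inj => /=; have := ltn_ord i; lia.
rewrite rfall_ffact -bin_ffact natrM smulE !mulr_sumr; apply: eq_bigr => i _.
have ik : (i <= k)%N by rewrite -ltnS.
rewrite -(bin_fact ik) /ffsym !natrM.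
have f0 n : n`!%:R != 0 :> R by rewrite pnatr_eq0 -lt0n fact_gt0.
have -> : (-1) ^+ k = (-1) ^+ i * (-1) ^+ (k - i) :> R by rewrite -exprD subnKC.
by field; rewrite !f0.
Qed.

Lemma pser_XsubC (d : nat) x p : (size p <= d.+1)%N ->
  pser d.+1 (('X - x%:P) * p) = (1 - sC x * sw R) * pser d p.
Proof.
move=> sp; apply/funext => k; rewrite [(1 - _) * _]mulrBl mul1r saddE soppE -mulrA smulCE smulwE.
rewrite /pser mulrBl coefB coefXM coefCM; case: k => [|k].
  by rewrite subn0 /= (nth_default _ sp) mulr0 subn0.
rewrite subSS ltnS; case: (ltnP k d) => kd.
  rewrite ltnW // ifN; first by congr (_`_ _ - _); lia.
  by rewrite subn_eq0 -ltnNge.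
case: (leqP k d) => kd'; last by rewrite mulr0 subr0.
by rewrite (_ : (d - k)%N = 0%N) //; lia.
Qed.

Definition psums s : ser R := fun n => if n is 0 then 0 else \sum_(x <- s) x ^+ n.

Lemma psums_cons x s : (1 - sC x * sw R) * psums (x :: s) =
  sC x * sw R + (1 - sC x * sw R) * psums s.
Proof.
apply/funext => n; rewrite !mulrBl !mul1r !(saddE, soppE) -!mulrA !smulCE !smulwE.
case: n => [|[|n]] /=; rewrite /sw /= ?big_cons; try ring.
by rewrite [x ^+ n.+2]exprS; ring.
Qed.

(** The factors of z^-d p(z) are 1 - x w; the logarithmic derivative is
    additive over them and each one contributes a geometric series in x w. *)
Lemma newton s :
  stheta (pser (size s) (\prod_(x <- s) ('X - x%:P))) =
  - (psums s * pser (size s) (\prod_(x <- s) ('X - x%:P))).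
Proof.
elim: s => [|x s IH] /=.
  rewrite big_nil (_ : psums [::] = 0); last first.
    by apply/funext => -[|n] //=; rewrite big_nil.
  rewrite mul0r oppr0; apply/funext => -[|n]; rewrite /stheta ?mul0r //.
  by rewrite /pser mulr0.
rewrite big_cons pser_XsubC ?size_prod_XsubC // sthetaM IH.
set a := pser _ _.
have -> : stheta (1 - sC x * sw R) = - (sC x * sw R).
  apply/funext => n; rewrite /stheta soppE smulCE saddE soppE smulCE s1E.
  by case: n => [|[|n]]; rewrite /sw /=; ring.
transitivity (- (((1 - sC x * sw R) * psums (x :: s)) * a)); last by ring.
by rewrite psums_cons; ring.
Qed.

Lemma poly_rootsP (d : nat) p : real_rooted d p ->
  size (poly_roots p) = d /\ p = \prod_(x <- poly_roots p) ('X - x%:P).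
Proof.
move=> [s sd ps]; have E : p = \prod_(x <- poly_roots p) ('X - x%:P).
  by rewrite /poly_roots; apply: (@xgetPex _ [::] [set s | p = \prod_(x <- s) ('X - x%:P)]%classic); exists s.
split=> //; have := congr1 (size : {poly R} -> nat) ps.
by rewrite {1}E !size_prod_XsubC sd => -[].
Qed.

Lemma poly_moment_newton (d : nat) p : (0 < d)%N -> real_rooted d p ->
  stheta (pser d p) =
  - (sC d%:R * (((poly_moment d p : ser R) - 1) * pser d p)).
Proof.
move=> d0 /poly_rootsP[sd E]; have := newton (poly_roots p).
rewrite -E sd mulrA => ->; congr (- (_ * _)).
apply/funext => n; rewrite smulCE saddE soppE s1E /poly_moment.
have dn : d%:R != 0 :> R by rewrite pnatr_eq0 -lt0n.
case: n => [|n] /=; last by rewrite subr0 mulVKf.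
rewrite (eq_bigr (fun=> 1)) => [|x _]; last by rewrite expr0.
by rewrite big_const_seq count_predT iter_addr_0 sd mulVf ?subrr ?mulr0.
Qed.

(** The finite free cumulants, when P is the operator of a polynomial of
    degree d: coefficients of - t P'(t) / P(t), scaled so that they converge
    to free cumulants. *)
Definition ffcumulant (d : R) (P : ser R) : ser R :=
  fun j => - (d ^+ j.-1 * (stheta P * (fps_inv P : ser R)) j).

Lemma ffcumulantP (d : R) (P : ser R) k : d != 0 -> P 0%N != 0 ->
  k%:R * P k = - \sum_(j < k) ffcumulant d P j.+1 * d^-1 ^+ j * P (k - j.+1)%N.
Proof.
move=> d0 P0; set c := stheta P * (fps_inv P : ser R).
have : stheta P = c * P by rewrite /c mulrAC -mulrA ser_mulVr // mulr1.
move/(congr1 (fun f : ser R => f k)); rewrite {1}/stheta => ->.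
rewrite smulE big_ord_recl /= {1}/c smul0E {1}/stheta !mul0r add0r -sumrN.
apply: eq_bigr => j _; rewrite /ffcumulant -/c /= mulrAC !mulNr opprK.
by rewrite [d ^+ j * _]mulrC exprVn mulrAC mulfK ?expf_neq0.
Qed.

(** Finite free cumulants linearize the convolution, being a logarithmic
    derivative. *)
Lemma ffcumulantM (d : R) (P Q : ser R) : P 0%N != 0 -> Q 0%N != 0 ->
  ffcumulant d (P * Q) = ffcumulant d P + ffcumulant d Q.
Proof.
move=> P0 Q0; apply/funext => j; rewrite saddE /ffcumulant.
rewrite -opprD -mulrDr -saddE; congr (- (_ * _)); congr ((_ : ser R) j).
have PQ0 : (P * Q) 0%N != 0 by rewrite smul0E mulf_neq0.
apply: (@ser_mulIr _ (P * Q)) => //.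
have EP := ser_mulVr P0; have EQ := ser_mulVr Q0; have EPQ := ser_mulVr PQ0.
set iP : ser R := fps_inv P in EP *; set iQ : ser R := fps_inv Q in EQ *.
set iPQ : ser R := fps_inv (P * Q) in EPQ *.
transitivity (stheta (P * Q) * ((P * Q) * iPQ)); first by ring.
rewrite EPQ mulr1 sthetaM.
transitivity (stheta P * Q * (P * iP) + P * stheta Q * (Q * iQ)).
  by rewrite EP EQ !mulr1.
ring.
Qed.

Lemma ffsym0 (d : nat) p : real_rooted d p -> ffsym d p 0%N = 1.
Proof.
move=> /poly_rootsP[sd E]; rewrite /ffsym /ffcoef subn0 bin0 fact0 !divr1 !mul1r.
have /monicP : p \is monic by rewrite E monic_prod_XsubC.
have sp : size p = d.+1 by rewrite E size_prod_XsubC sd.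
by rewrite /lead_coef sp.
Qed.

Lemma poly_moment_cumulant (d : nat) p (P : ser R) n : (0 < d)%N -> real_rooted d p ->
  P 0%N = 1 -> (forall k, pser d p k = rfall d%:R k * P k) ->
  poly_moment d p n = (n == 0)%:R +
  \sum_(j < n) ffcumulant d%:R P j.+1 *
     twisted_pow d%:R (sw R * (poly_moment d p : ser R)) j.+1 n.
Proof.
move=> d0 pr P0 pP.
have dn : d%:R != 0 :> R by rewrite pnatr_eq0 -lt0n.
apply: (@moment_finite_cumulant R d%:R dn P (ffcumulant d%:R P) (poly_moment d p)) => //.
  by move=> k; apply: ffcumulantP; rewrite // P0 oner_neq0.
have <- : pser d p = fun k => rfall d%:R k * P k by apply/funext.
exact: poly_moment_newton.
Qed.
End PolySeries.

(** * First-order expansions in 1/d *)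

Section Expansions.
Local Open Scope classical_set_scope.
Variable R : realType.

(** a_d = a0 + a1 / d + o(1/d). Such sequences compute like dual numbers with
    1/d in the role of the infinitesimal. *)
Definition expands (a : nat -> R) (a0 a1 : R) := d%:R * (a d - a0) @[d --> \oo] --> a1.

Lemma cvg_invn : (d%:R^-1 : R) @[d --> \oo] --> (0 : R).
Proof.
apply/gtr0_cvgV0; last exact: cvgr_idn.
by near=> d; rewrite ltr0n; near: d; exists 1%N.
Unshelve. all: by end_near. Qed.

Lemma expands_near a b a0 a1 : (\forall d \near \oo, a d = b d) ->
  expands a a0 a1 -> expands b a0 a1.
Proof.
move=> ab; apply: cvg_trans; apply: near_eq_cvg.
by apply: filterS ab => d ->.
Qed.

Lemma expands_cvg a a0 a1 : expands a a0 a1 -> a d @[d --> \oo] --> a0.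
Proof.
move=> H; rewrite -[a0]addr0 -[X in _ + X](mul0r a1).
apply: (@cvg_trans _ ((fun d : nat => a0 + d%:R^-1 * (d%:R * (a d - a0))) @ \oo)).
  apply: near_eq_cvg; near=> d.
  have d0 : d%:R != 0 :> R by rewrite pnatr_eq0 -lt0n; near: d; exists 1%N.
  by rewrite mulKf //; ring.
apply: cvgD; first exact: cvg_cst.
by apply: cvgM => //; exact: cvg_invn.
Unshelve. all: by end_near. Qed.

Lemma expands_uniq a a0 a1 a1' : expands a a0 a1 -> expands a a0 a1' -> a1 = a1'.
Proof. by move=> H H'; apply: (cvg_unique _ H H'). Qed.

Lemma expands_cst c : expands (fun=> c) c 0.
Proof.
rewrite /expands (_ : (fun d => _) = fun=> 0); first exact: cvg_cst.
by apply/funext => d; rewrite subrr mulr0.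
Qed.

Lemma expands_eps : expands (fun d => d%:R^-1) 0 1.
Proof.
apply: (@cvg_trans _ ((fun d : nat => 1 : R) @ \oo)); last exact: cvg_cst.
apply: near_eq_cvg; near=> d.
have d0 : d%:R != 0 :> R by rewrite pnatr_eq0 -lt0n; near: d; exists 1%N.
by rewrite subr0 mulfV.
Unshelve. all: by end_near. Qed.

Lemma expandsD a b a0 a1 b0 b1 : expands a a0 a1 -> expands b b0 b1 ->
  expands (fun d => a d + b d) (a0 + b0) (a1 + b1).
Proof.
move=> Ha Hb; apply: (cvg_trans _ (cvgD Ha Hb)); apply: near_eq_cvg; apply: nearW => d; rewrite !fctE; ring.
Qed.

Lemma expandsM a b a0 a1 b0 b1 : expands a a0 a1 -> expands b b0 b1 ->
  expands (fun d => a d * b d) (a0 * b0) (a0 * b1 + a1 * b0).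
Proof.
move=> Ha Hb; have Hbc := expands_cvg Hb.
apply: (cvg_trans _ (cvgD (cvgM (cvg_cst a0) Hb) (cvgM Ha Hbc))); apply: near_eq_cvg; apply: nearW => d; rewrite !fctE /=; ring.
Qed.

Lemma expandsN a a0 a1 : expands a a0 a1 -> expands (fun d => - a d) (- a0) (- a1).
Proof.
move=> Ha; apply: (cvg_trans _ (cvgN Ha)); apply: near_eq_cvg; apply: nearW => d; rewrite !fctE; ring.
Qed.

Lemma expands_sum n (a : nat -> nat -> R) (a0 a1 : nat -> R) :
  (forall i, (i < n)%N -> expands (a^~ i) (a0 i) (a1 i)) ->
  expands (fun d => \sum_(i < n) a d i) (\sum_(i < n) a0 i) (\sum_(i < n) a1 i).
Proof.
elim: n => [|n IH] H.
  by rewrite !big_ord0 (_ : (fun d => _) = fun=> 0);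
    [exact: expands_cst | apply/funext => d; rewrite big_ord0].
rewrite !big_ord_recr /= (_ : (fun d => _) = fun d => \sum_(i < n) a d i + a d n).
  by apply: expandsD; [apply: IH => i ni; apply: H; exact: ltnW | exact: H].
by apply/funext => d; rewrite big_ord_recr.
Qed.

Lemma expands_div1 a b a0 a1 b1 : expands a a0 a1 -> expands b 1 b1 ->
  expands (fun d => a d / b d) a0 (a1 - a0 * b1).
Proof.
move=> Ha Hb; have Hbc := expands_cvg Hb.
have b0 : \forall d \near \oo, b d != 0.
  by apply: (@cvgr_neq0 _ _ _ _ _ _ _ Hbc (oner_neq0 R)).
have Hv : (b d)^-1 @[d --> \oo] --> (1^-1 : R) by apply: cvgV; rewrite ?oner_neq0.
have -> : a1 - a0 * b1 = (a1 - a0 * b1) * 1^-1 by rewrite invr1 mulr1.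
apply: (cvg_trans _ (cvgM (cvgB Ha (cvgM (cvg_cst a0) Hb)) Hv)); apply: near_eq_cvg; near=> d => /=.
have bd0 : b d != 0 by near: d.
by rewrite !fctE /=; field.
Unshelve. all: by end_near. Qed.

Definition sexpands (A : nat -> ser R) (A0 A1 : ser R) :=
  forall n, expands (fun d => A d n) (A0 n) (A1 n).

Lemma sexpandsD A B A0 A1 B0 B1 : sexpands A A0 A1 -> sexpands B B0 B1 ->
  sexpands (fun d => A d + B d) (A0 + B0) (A1 + B1).
Proof. by move=> HA HB n; apply: expandsD. Qed.

Lemma sexpandsM A B A0 A1 B0 B1 : sexpands A A0 A1 -> sexpands B B0 B1 ->
  sexpands (fun d => A d * B d) (A0 * B0) (A0 * B1 + A1 * B0).
Proof.
move=> HA HB n; rewrite saddE !smulE -big_split /=.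
rewrite (_ : (fun d => _) = fun d => \sum_(i < n.+1) A d i * B d (n - i)%N) //.
exact: (@expands_sum n.+1 (fun d i => A d i * B d (n - i)%N)
  (fun i => A0 i * B0 (n - i)%N)
  (fun i => A0 i * B1 (n - i)%N + A1 i * B0 (n - i)%N)
  (fun i _ => expandsM (HA i) (HB (n - i)%N))).
Qed.

Lemma sexpands_cst (f : ser R) : sexpands (fun=> f) f 0.
Proof. by move=> n; exact: expands_cst. Qed.

Lemma sexpands_eps : sexpands (fun d => sC d%:R^-1) 0 1.
Proof. by case=> [|n]; [exact: expands_eps | exact: expands_cst]. Qed.

Lemma sexpands_D A A0 A1 : sexpands A A0 A1 -> sexpands (fun d => sD (A d)) (sD A0) (sD A1).
Proof.
move=> HA [|n] /=; first exact: expands_cst.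
apply: expandsN; have := expandsM (expands_cst n%:R) (HA n).
by rewrite mul0r addr0.
Qed.

(** Among the words in G and d^-1 D only those with at most one D matter; the
    letter D meets each of the G on its right, hence the binomial
    coefficient. *)
Lemma sexpands_twisted_pow (G : nat -> ser R) G0 G1 j : sexpands G G0 G1 ->
  sexpands (fun d => twisted_pow d%:R (G d) j) (G0 ^+ j)
       (G0 ^+ j.-1 * G1 *+ j + G0 ^+ j.-2 * sD G0 *+ 'C(j, 2)).
Proof.
move=> HG; elim: j => [|j IH].
  by rewrite !mulr0n addr0; exact: sexpands_cst.
have := sexpandsD (sexpandsM HG IH) (sexpandsM sexpands_eps (sexpands_D IH)).
rewrite exprS sDX mul0r addr0 mul0r add0r mul1r; congr (sexpands _ _ _).
rewrite binS bin1 mulrnDr mulrDr.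
case: j {IH} => [|[|j]] /=; first by rewrite !mulr0n !expr0; ring.
  by rewrite ?bin_small // !expr0 ?mulr0n; ring.
rewrite !exprS !mulrnAr; ring.
Qed.

End Expansions.

Section FirstOrder.
Local Open Scope classical_set_scope.
Variable R : realType.

Lemma swX_coef (f : ser R) k n :
  (sw R ^+ k * f) n = if (k <= n)%N then f (n - k)%N else 0.
Proof.
elim: k n => [|k IH] n; first by rewrite expr0 mul1r subn0.
by rewrite exprS -mulrA smulwE; case: n => [|n] //; rewrite IH subSS ltnS.
Qed.

Lemma twisted_pow_ext (d : R) (G G' : ser R) N j : (forall i, (i <= N)%N -> G i = G' i) ->
  forall i, (i <= N)%N -> twisted_pow d G j i = twisted_pow d G' j i.
Proof.
move=> GG'; elim: j => // j IH i iN; rewrite /= !saddE !smulCE !smulE.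
congr (_ + _ * _).
  apply: eq_bigr => k _; rewrite GG' ?IH //; last by apply: leq_trans iN; rewrite -ltnS.
  by apply: leq_trans iN; exact: leq_subr.
by case: i iN => //= i iN; rewrite IH // ltnW.
Qed.

Variables (m kap : nat -> ser R) (m0 phi : ser R).
Hypothesis mE : forall d n, (0 < d)%N -> m d n =
  (n == 0)%:R + \sum_(j < n) kap d j.+1 * twisted_pow d%:R (sw R * m d) j.+1 n.
Hypothesis phi0 : phi 0%N = 1.
Hypothesis m0E : m0 = scomp phi (sw R * m0).

Let m0_0 : m0 0%N = 1.
Proof. by rewrite m0E scomp_eq0 // smulwE. Qed.

Lemma phi_sum n : m0 n =
  (n == 0)%:R + \sum_(j < n) phi j.+1 * ((sw R * m0) ^+ j.+1) n.
Proof. by rewrite {1}m0E /scomp big_ord_recl phi0 mul1r expr0. Qed.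

Lemma sexpands_sw A A0 A1 : sexpands A A0 A1 -> sexpands (fun d => sw R * A d) (sw R * A0) (sw R * A1).
Proof.
move=> HA; have := sexpandsM (sexpands_cst (sw R)) HA.
by rewrite mul0r addr0.
Qed.

Lemma pos_near : \forall d \near \oo, (0 < d)%N.
Proof. by exists 1%N. Qed.

(** The relation between moments and cumulants is triangular: kappa_n is
    multiplied by the coefficient of degree n in B_n, which tends to 1, and
    all other terms involve only cumulants of lower order. *)
Lemma cumulant_expansion m1 : sexpands m m0 m1 ->
  exists2 s : ser R, s 0%N = 0 &
    forall n, expands (fun d => kap d n.+1) (phi n.+1) (s n.+1).
Proof.
move=> Hm.
suff H n : exists x, expands (fun d => kap d n.+1) (phi n.+1) x.
  have [f Hf] := choice H.
  by exists (fun n => if n is k.+1 then f k else 0).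
elim/ltn_ind: n => n IH.
have HB j := @sexpands_twisted_pow R _ _ _ j (sexpands_sw Hm).
have {}IH k : exists x, (k < n)%N -> expands (fun d => kap d k.+1) (phi k.+1) x.
  by case: (ltnP k n) => kn; [have [x Hx] := IH _ kn; exists x | exists 0].
have [f Hf] := choice IH.
have Hs := expands_sum (fun j jn => expandsM (Hf j jn) (HB j.+1 n.+1)).
have Hd := expandsD (Hm n.+1) (expandsN Hs).
have Gn : ((sw R * m0) ^+ n.+1) n.+1 = 1.
  rewrite exprMn swX_coef leqnn subnn.
  by elim: n.+1 => // k IHk; rewrite exprS smul0E IHk m0_0 mulr1.
have := HB n.+1 n.+1; rewrite Gn => Bn.
have := expands_div1 Hd Bn; set y := (X in expands _ _ X) => Hy; exists y.
have -> : phi n.+1 =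
   m0 n.+1 + - \sum_(i < n) phi i.+1 * ((sw R * m0) ^+ i.+1) n.+1.
  rewrite phi_sum big_ord_recr /= Gn; ring.
have B0 : \forall d \near \oo, twisted_pow d%:R (sw R * m d) n.+1 n.+1 != 0.
  exact: (@cvgr_neq0 _ _ _ _ _ _ _ (expands_cvg Bn) (oner_neq0 R)).
apply: expands_near Hy; apply: filterS (filterI pos_near B0) => d [d0 Bd].
by rewrite mE // big_ord_recr /= add0r addrAC subrr add0r mulfK.
Qed.

(** The moment of order n is a polynomial in the cumulants and in the moments
    of lower order, because B_j is built from w m. Truncation of m below n
    makes the induction hypothesis an expansion of a whole series. *)
Lemma moment_expansion (s : ser R) :
  (forall n, expands (fun d => kap d n.+1) (phi n.+1) (s n.+1)) ->
  exists m1, sexpands m m0 m1.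
Proof.
move=> Hk; suff H n : exists x, expands (fun d => m d n) (m0 n) x.
  by have [f Hf] := choice H; exists f.
elim/ltn_ind: n => n IH.
have {}IH k : exists x, (k < n)%N -> expands (fun d => m d k) (m0 k) x.
  by case: (ltnP k n) => kn; [have [x Hx] := IH _ kn; exists x | exists 0].
have [f Hf] := choice IH.
pose tr (g : ser R) : ser R := fun k => if (k < n)%N then g k else 0.
have Ht : sexpands (fun d => tr (m d)) (tr m0) (tr f).
  by move=> k; rewrite /tr; case: ifP => [/Hf //|_]; exact: expands_cst.
have trE g k : (k <= n)%N -> (sw R * tr g) k = (sw R * g) k.
  by rewrite !smulwE; case: k => // k kn; rewrite /tr kn.
have trX g k i : (i <= n)%N -> ((sw R * tr g) ^+ k) i = ((sw R * g) ^+ k) i.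
  elim: k i => // k IHk i kn; rewrite !exprS !smulE; apply: eq_bigr => j _.
  rewrite trE ?IHk //; last by apply: leq_trans kn; rewrite -ltnS.
  by apply: leq_trans kn; exact: leq_subr.
have HB j := @sexpands_twisted_pow R _ _ _ j (sexpands_sw Ht).
have Hs := expands_sum (fun j (_ : (j < n)%N) => expandsM (Hk j) (HB j.+1 n)).
have := expandsD (expands_cst (n == 0)%:R) Hs.
set y := (X in expands _ _ X) => Hy; exists y.
rewrite phi_sum; under eq_bigr do rewrite -trX //.
apply: expands_near Hy; apply: filterS pos_near => d d0.
rewrite mE //; congr (_ + _); apply: eq_bigr => j _; congr (_ * _).
by apply: (@twisted_pow_ext _ _ _ n) => // i iN; exact: trE.
Qed.

Lemma scomp_mul (f v h : ser R) n : v 0%N = 0 -> h 0%N = 0 ->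
  (scomp f v * h) n = \sum_(k < n) f k * (v ^+ k * h) n.
Proof.
move=> v0 h0.
have lt0 k : (n <= k)%N -> (v ^+ k * h) n = 0.
  move=> nk; rewrite smulE big1 // => i _.
  case: (ltnP i k) => ik; first by rewrite spow_lt // mul0r.
  have -> : (n - i = 0)%N by lia.
  by rewrite h0 mulr0.
transitivity (\sum_(k < n.+1) f k * (v ^+ k * h) n); last first.
  by rewrite big_ord_recr /= lt0 // mulr0 addr0.
rewrite smulE; transitivity (\sum_(i < n.+1) \sum_(k < n.+1) f k * (v ^+ k) i * h (n - i)%N).
  by apply: eq_bigr => i _; rewrite (@scomp_widen _ _ _ _ n) ?mulr_suml // -ltnS.
rewrite exchange_big /=; apply: eq_bigr => k _; rewrite smulE mulr_sumr.
by apply: eq_bigr => i _; rewrite mulrA.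
Qed.

(** Half the second derivative. *)
Definition sd2 (f : ser R) : ser R := fun n => f n.+2 *+ 'C(n.+2, 2).

(** The coefficients of 1/d on both sides of the moment-cumulant relation: the
    cumulant varies, G varies inside G^j, or D acts once. The last term
    collects C(j, 2) phi_j G^(j - 2) DG over all j. *)
Lemma first_order_eq (s m1 : ser R) : s 0%N = 0 ->
  (forall n, expands (fun d => kap d n.+1) (phi n.+1) (s n.+1)) ->
  sexpands m m0 m1 ->
  let G := sw R * m0 in
  m1 = scomp s G + scomp (sd phi) G * (sw R * m1) + scomp (sd2 phi) G * sD G.
Proof.
move=> s0 Hk Hm G; apply/funext => n.
have G0 : G 0%N = 0 by rewrite /G smulwE.
have HB j := @sexpands_twisted_pow R _ _ _ j (sexpands_sw Hm).
have Hs := expands_sum (fun j (_ : (j < n)%N) => expandsM (Hk j) (HB j.+1 n)).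
have := expandsD (expands_cst (n == 0)%:R) Hs; rewrite -phi_sum => Hr.
have E : \forall d \near \oo, (n == 0)%:R +
    \sum_(j < n) kap d j.+1 * twisted_pow d%:R (sw R * m d) j.+1 n = m d n.
  by apply: filterS pos_near => d d0; rewrite mE.
have {}Hr := expands_near E Hr.
rewrite (expands_uniq (Hm n) Hr) add0r big_split /= -/G addrC !saddE -addrA.
congr (_ + _).
  by rewrite /scomp big_ord_recl s0 mul0r add0r.
have h0 : (sw R * m1) 0%N = 0 by rewrite smulwE.
rewrite !scomp_mul //.
rewrite (_ : \sum_(k < n) sd2 phi k * (G ^+ k * sD G) n =
             \sum_(j < n) phi j.+1 * (G ^+ j.-1 * sD G *+ 'C(j.+1, 2)) n); last first.
  case: n {Hs Hr E} => [|n]; first by rewrite !big_ord0.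
  rewrite big_ord_recr big_ord_recl /= bin_small // mulr0n s0E mulr0 add0r.
  rewrite [X in _ + X](_ : _ = 0) ?addr0.
    by apply: eq_bigr => j _; rewrite /sd2 smulnE mulrnAl mulrnAr.
  (* the term of highest index vanishes because DG starts in degree 2 *)
  rewrite (_ : G ^+ n * sD G = - (sw R ^+ n.+2 * (m0 ^+ n * stl (stheta G)))).
    by rewrite soppE swX_coef ltnn oppr0 mulr0.
  have -> : sD G = - (sw R * (sw R * stl (stheta G))).
    rewrite sDE {1}[stheta G]stlE (_ : sC _ = 0) ?add0r //.
    by apply/funext => -[|k] //; rewrite /= /stheta mul0r.
  rewrite {1}/G exprMn !exprS; ring.
rewrite -big_split /=; apply: eq_bigr => j _.
by rewrite saddE mulrDr /sd smulnE -mulr_natl; ring.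
Qed.

End FirstOrder.

(** * Subordination and the reciprocal Cauchy transform *)

Section Subordination.
Variable R : realType.
Local Notation S := (ser R).
Local Notation w := (sw R).

Lemma sD_sd (f : S) : sD f = - (w ^+ 2 * sd f).
Proof.
by apply/funext => -[|[|n]]; rewrite soppE swX_coef /= ?mul0r ?oppr0 // /sd subn2.
Qed.

Lemma scompX (f v : S) k : v 0%N = 0 -> scomp (f ^+ k) v = scomp f v ^+ k.
Proof. by move=> v0; elim: k => [|k IH]; rewrite ?scomp1 // !exprS scompM // IH. Qed.

Lemma omega_over_zE (c : S) : omega_over_z c = 1 + w * c :> S.
Proof.
apply/funext => -[|n]; rewrite saddE s1E smulwE /=; first by rewrite addr0.
by rewrite add0r.
Qed.

Lemma omega_invE (c : S) : (omega_inv c : S) * (1 + w * c) = w.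
Proof.
rewrite -omega_over_zE (_ : omega_inv c = w * (fps_inv (omega_over_z c) : S)).
  by rewrite -mulrA [X in _ * X]mulrC ser_mulVr ?mulr1 //= oner_neq0.
by rewrite /omega_inv fps_shiftE.
Qed.

Lemma sD_omega_inv (c : S) :
  sD (omega_inv c) = - ((omega_inv c : S) ^+ 2 * (omega_deriv c : S)).
Proof.
set v : S := omega_inv c; have Ev : v * (1 + w * c) = w by exact: omega_invE.
have -> : (omega_deriv c : S) = 1 + sD c by [].
apply: (@ser_mulIr _ (1 + w * c)).
  by rewrite saddE s1E smulwE addr0 oner_neq0.
have := congr1 (@sD R) Ev; rewrite sDM sDD sD1 sDM sDw => H.
transitivity (- w ^+ 2 - v * (0 + (- w ^+ 2 * c + w * sD c))).
  rewrite -[X in _ = X - _]H; ring.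
transitivity (- (w * (v * (1 + w * c))) - v * (0 + (- w ^+ 2 * c + w * sD c))).
  by rewrite Ev expr2.
transitivity (- (v * (1 + sD c) * (v * (1 + w * c)))); last by ring.
rewrite [in RHS]Ev; ring.
Qed.

(** The chain rule; [omega_inv] encodes 1 / omega, so substituting it in a
    series in 1/z is composition with omega. *)
Lemma sD_subst (f c : S) :
  sD (scomp f (omega_inv c)) = scomp (sD f) (omega_inv c) * (omega_deriv c : S).
Proof.
rewrite sD_comp // sD_omega_inv sD_sd scompN scompM // scompX // scompw //; ring.
Qed.

Section Transform.
Variables (m0 phi : S).
Hypothesis m00 : m0 0%N = 1.
Hypothesis m0E : m0 = scomp phi (w * m0).
Let G := w * m0.
Let G0 : G 0%N = 0. Proof. by rewrite /G smulwE. Qed.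
Let phi1 : S := scomp (sd phi) G.

(** G = w m0 is cancellable, since m0 starts with 1. *)
Lemma cauchy_mulIr (f g : S) : f * G = g * G -> f = g.
Proof. by apply: ser_mulwIr; rewrite m00 oner_neq0. Qed.

(** With F = 1 / G the reciprocal Cauchy transform, this is 1 / F':
    differentiating m0 = phi(G) gives (1 - w phi'(G)) DG = - w G, see
    [qser_deriv]. *)
Definition qser : S := (1 - w * phi1) * m0.

Lemma qser0 : qser 0%N = 1.
Proof. by rewrite /qser smul0E m00 mulr1 saddE soppE s1E smulwE subr0. Qed.

Let sDm0 : sD m0 = phi1 * sD G.
Proof. by rewrite {1}m0E sD_comp. Qed.

Let delta : (1 - w * phi1) * sD G = - (w * G).
Proof.
have : sD G = - w ^+ 2 * m0 + w * (phi1 * sD G) by rewrite -sDm0 /G sDM sDw.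
move=> H; rewrite mulrBl mul1r {1}H /G; ring.
Qed.

Lemma qser_deriv : qser * sD G = - G ^+ 2.
Proof. by rewrite /qser mulrAC delta /G; ring. Qed.

(** Differentiating q brings out phi'' / 2, the coefficient of DG in
    [first_order_eq]. *)
Lemma sD_qser : sD qser = - (G * scomp (sd2 phi) G * sD G) *+ 2.
Proof.
have E : sD phi1 = scomp (sd2 phi) G * sD G *+ 2.
  rewrite /phi1 sD_comp // -mulrnAl -scompMn; congr (scomp _ _ * _).
  apply/funext => n; rewrite smulnE /sd /sd2 -mulrnA -[RHS]mulr_natl mulrA -natrM.
  by rewrite -[('C(_, _) * _)%N]/('C(n.+2, 2) * 2`!)%N bin_ffact ffactnS ffactn1 mulnC.
have D1 : sD (1 - w * phi1) = w ^+ 2 * phi1 - w * (scomp (sd2 phi) G * sD G *+ 2).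
  by rewrite sDD sD1 sDN sDM sDw E; ring.
rewrite /qser sDM D1 sDm0 mulrCA delta /G; ring.
Qed.

(** m1 enters its own equation through phi'(G) w m1 only; the factor 1 - w
    phi'(G) that this produces cancels against DG. *)
Lemma transform_solve (x A : S) : x = A + phi1 * (w * x) -> w * x * G = - (A * sD G).
Proof.
move=> H; apply: (@ser_mulIr _ (1 - w * phi1)).
  by rewrite saddE soppE s1E smulwE subr0 oner_neq0.
have Hx : (1 - w * phi1) * x = A by rewrite mulrBl mul1r {1}H; ring.
transitivity (w * G * ((1 - w * phi1) * x)); first by ring.
transitivity (- (A * ((1 - w * phi1) * sD G))); last by ring.
rewrite Hx delta; ring.
Qed.

(** As [transform_solve], with the additional term of [first_order_eq], which
    by [sD_qser] is a multiple of Dq. *)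
Lemma finite_solve (x A : S) :
  x = A + phi1 * (w * x) + scomp (sd2 phi) G * sD G ->
  (w * x * G * qser) *+ 2 = - (A * sD G * qser) *+ 2 - G * sD qser.
Proof.
rewrite addrAC => /transform_solve ->; rewrite sD_qser.
transitivity (- (A * sD G * qser) *+ 2 -
   (scomp (sd2 phi) G * sD G * (qser * sD G)) *+ 2); first by ring.
rewrite qser_deriv; ring.
Qed.

End Transform.

Section Final.
Variables (m0 phi mg phig c : S).
Hypothesis mg0 : mg 0%N = 1.
Hypothesis m0E : m0 = scomp phi (w * m0).
Hypothesis mgE : mg = scomp phig (w * mg).
Hypothesis sub : w * mg = scomp (w * m0) (omega_inv c).
Let v : S := omega_inv c.
Let W : S := omega_deriv c.

(** F_gam = F_mu o omega gives F_gam' = (F_mu' o omega) omega'; this is the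
    same relation for the reciprocals. *)
Lemma qser_subst : scomp (qser m0 phi) v = qser mg phig * W.
Proof.
have D : sD (w * mg) = scomp (sD (w * m0)) v * W by rewrite sub sD_subst.
have := congr1 (fun f => scomp f v) (qser_deriv m0E).
rewrite scompM // scompN scompX // -sub => H.
apply: (@cauchy_mulIr mg) => //; apply: (@cauchy_mulIr mg) => //.
have q := qser_deriv mgE.
transitivity (- (scomp (qser m0 phi) v * (- (w * mg) ^+ 2))); first by ring.
rewrite -q D.
transitivity (- (qser mg phig * W * (scomp (qser m0 phi) v * scomp (sD (w * m0)) v))).
  by ring.
rewrite H; ring.
Qed.

(** The series x is an infinitesimal moment series, described by the
    infinitesimal free cumulants in [A] and by the first-order terms of the
    finite free cumulants in [B]. Comparing both descriptions, 2 (A - B) DG q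
    = G Dq for the transform of mu; then omega is substituted, and q o omega =
    q_gam omega' makes omega'' appear. *)
Lemma subst_relation (x A B : S) :
  x = A + scomp (sd phi) (w * m0) * (w * x) ->
  x = B + scomp (sd phi) (w * m0) * (w * x) + scomp (sd2 phi) (w * m0) * sD (w * m0) ->
  scomp A v * sD (w * mg) *+ 2 =
  scomp B v * sD (w * mg) *+ 2 + w * mg *
    (sD (qser mg phig) * (fps_inv (qser mg phig) : S) + sD W * (fps_inv W : S)).
Proof.
move=> /(transform_solve m0E) HA /(finite_solve m0E) HB.
rewrite HA in HB; set G := w * m0 in HA HB; set Gg := w * mg.
set q := qser m0 phi in HB; set qg := qser mg phig.
have H : (A * sD G * q) *+ 2 = (B * sD G * q) *+ 2 + G * sD q.
  apply: oppr_inj; transitivity ((- (A * sD G) * q) *+ 2); [ring | rewrite HB; ring].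
have qg0 : qg 0%N != 0 by rewrite /qg qser0 ?oner_neq0.
have W0 : W 0%N != 0 by rewrite (_ : W 0%N = 1) ?oner_neq0 //; exact: addr0.
have Eq := ser_mulVr qg0; have EW := ser_mulVr W0.
set iq : S := fps_inv qg in Eq *; set iW : S := fps_inv W in EW *.
have Qs : scomp q v = qg * W by exact: qser_subst.
have Gs : scomp G v = Gg by rewrite -sub.
have DG : sD Gg = scomp (sD G) v * W by rewrite -Gs sD_subst.
have Dq : sD (qg * W) = scomp (sD q) v * W by rewrite -Qs sD_subst.
clearbody q G Gg; have {}H : (scomp A v * sD Gg * (qg * W)) *+ 2 =
    (scomp B v * sD Gg * (qg * W)) *+ 2 + Gg * (sD qg * W + qg * sD W).
  have := congr1 (fun f => scomp f v * W) H.
  rewrite /= scompMn [scomp (_ + G * _) _]scompD scompMn !scompM // Qs Gs => {}H.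
  rewrite -sDM DG Dq.
  transitivity ((scomp A v * scomp (sD G) v * (qg * W)) *+ 2 * W); first by ring.
  rewrite H; ring.
transitivity ((scomp A v * sD Gg * (qg * W)) *+ 2 * (iq * iW)).
  transitivity (scomp A v * sD Gg * ((qg * iq) * (W * iW)) *+ 2); last by ring.
  by rewrite Eq EW !mulr1.
rewrite H; transitivity ((scomp B v * sD Gg * ((qg * iq) * (W * iW))) *+ 2 +
  Gg * (sD qg * iq * (W * iW) + sD W * iW * (qg * iq))); first by ring.
by rewrite Eq EW !mulr1.
Qed.
End Final.

(** In terms of F = 1 / G this is - F'' / F', twice the generating series of
    the annular coefficients ([annular_series_pairs] and
    [annular_coef_pairs]). *)
Definition hser (m0 phi : S) : S :=
  sD (qser m0 phi) * (fps_inv (qser m0 phi) : S).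

Lemma ser_double_inj (f g : S) : f *+ 2 = g *+ 2 -> f = g.
Proof.
move=> H; apply/funext => n; have := congr1 (fun h : S => h n) H.
by rewrite !smulnE => {}H; lra.
Qed.

Lemma fps_div_double (a b : S) : b 0%N != 0 ->
  (fps_div a (b *+ 2) : S) *+ 2 = a * (fps_inv b : S).
Proof.
move=> b0; have b20 : (b *+ 2) 0%N != 0 by rewrite smulnE mulrn_eq0.
apply: (@ser_mulIr _ b) => //; rewrite /fps_div fps_mulE.
have E2 := ser_mulVr b20; have E := ser_mulVr b0.
set i2 : S := fps_inv (b *+ 2) in E2 *; set i : S := fps_inv b in E *.
transitivity (a * (b *+ 2 * i2)); first by ring.
rewrite E2; transitivity (a * (b * i)); last by ring.
by rewrite E.
Qed.

(** Cumulants add in the variable G, and after substitution both convolved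
    distributions have the same G = G_gam. The relations of [subst_relation]
    for mu and nu are added; the sums A1 + A2 and B1 + B2 then belong to gam,
    where they are converted back into xg and y. *)
Lemma convolution_identity (m1 phi1 m2 phi2 mg phig c1 c2 x1 x2 xg y A1 A2 B1 B2 : S) :
  mg 0%N = 1 ->
  m1 = scomp phi1 (w * m1) -> m2 = scomp phi2 (w * m2) -> mg = scomp phig (w * mg) ->
  w * mg = scomp (w * m1) (omega_inv c1) ->
  w * mg = scomp (w * m2) (omega_inv c2) ->
  x1 = scomp A1 (w * m1) + scomp (sd phi1) (w * m1) * (w * x1) ->
  x2 = scomp A2 (w * m2) + scomp (sd phi2) (w * m2) * (w * x2) ->
  xg = scomp (A1 + A2) (w * mg) + scomp (sd phig) (w * mg) * (w * xg) ->
  x1 = scomp B1 (w * m1) + scomp (sd phi1) (w * m1) * (w * x1)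
     + scomp (sd2 phi1) (w * m1) * sD (w * m1) ->
  x2 = scomp B2 (w * m2) + scomp (sd phi2) (w * m2) * (w * x2)
     + scomp (sd2 phi2) (w * m2) * sD (w * m2) ->
  y = scomp (B1 + B2) (w * mg) + scomp (sd phig) (w * mg) * (w * y)
     + scomp (sd2 phig) (w * mg) * sD (w * mg) ->
  (w * y) *+ 2 = (w * xg) *+ 2 + hser mg phig
    + (omega_deriv2 c1 : S) * (fps_inv (omega_deriv c1) : S)
    + (omega_deriv2 c2 : S) * (fps_inv (omega_deriv c2) : S).
Proof.
move=> mg0 E1 E2 Eg s1 s2 I1 I2 Ig F1 F2 Fg.
have R1 := subst_relation mg0 E1 Eg s1 I1 F1.
have R2 := subst_relation mg0 E2 Eg s2 I2 F2.
have v0 (a : S) : (w * a) 0%N = 0 by rewrite smulwE.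
move: R1 R2; rewrite !scompA // -s1 -s2 => R1 R2.
have := transform_solve Eg Ig; have := finite_solve Eg Fg.
have qg0 : qser mg phig 0%N != 0 by rewrite qser0 ?oner_neq0.
have Eq := ser_mulVr qg0; rewrite /hser.
rewrite -[omega_deriv2 c1]/(sD (omega_deriv c1)) -[omega_deriv2 c2]/(sD (omega_deriv c2)).
set iq : S := fps_inv (qser mg phig) in Eq R1 R2 *; set q := qser mg phig in Eq R1 R2 *.
set W1 := sD (omega_deriv c1) * _ in R1 *; set W2 := sD (omega_deriv c2) * _ in R2 *.
set G := w * mg in R1 R2 *; rewrite !scompD => HF HI.
apply: (@cauchy_mulIr mg) => //; rewrite -/G.
transitivity ((w * y * G * q) *+ 2 * iq).
  by transitivity ((w * y * G * (q * iq)) *+ 2); [rewrite Eq mulr1; ring | ring].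
rewrite HF.
transitivity (- ((scomp B1 G * sD G) *+ 2 + (scomp B2 G * sD G) *+ 2) * (q * iq) - G * (sD q * iq));
  first by ring.
rewrite Eq mulr1.
transitivity ((w * xg * G) *+ 2 + G * (sD q * iq) + G * W1 + G * W2); last by ring.
rewrite HI.
transitivity (- (scomp A1 G * sD G *+ 2 + scomp A2 G * sD G *+ 2) + G * (sD q * iq) + G * W1 + G * W2);
  last by ring.
by rewrite R1 R2; ring.
Qed.
End Subordination.

(** * Sums over non-crossing partitions *)

Section NonCrossing.
Variables (K : comNzRingType) (u : nat -> K).

Section Labels.
Variable N : nat.
Implicit Types (f g : {ffun 'I_N -> 'I_N}) (a b i : nat) (x y z t r : 'I_N).

Definition in_range a b x := (a <= x)%N && (x < b)%N.

(** Non-crossing partitions of the interval [a, b[, encoded by the map sending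
    each point to the maximum of its block, and each point outside the
    interval to itself. With maxima instead of minima, removing the first
    point of the interval from a non-singleton block does not change the other
    labels. *)
Definition nc_labelling a b f : Prop :=
  [/\ forall x, ~~ in_range a b x -> f x = x,
      forall x, in_range a b x -> (x <= f x)%N /\ (f x < b)%N,
      forall x, f (f x) = f x
    & forall x y z t, in_range a b x -> in_range a b t -> (x < y)%N -> (y < z)%N -> (z < t)%N ->
        f x = f z -> f y = f t -> f x = f y].

Definition fiber f r := [set x | f x == r]%SET.

Definition nc_sum a b : K :=
  \sum_(f | `[< nc_labelling a b f >]) \prod_(r | in_range a b r && (f r == r)) u #|fiber f r|.

(** The block of the first point a counts with j additional points. This
    remembers the points of the first block that a recursion along it has
    passed. *)
Definition nc_shift (j : nat) (a : 'I_N) b : K :=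
  \sum_(f | `[< nc_labelling a b f >])
    \prod_(r | in_range a b r && (f r == r)) u (#|fiber f r| + j * (r == f a))%N.

Lemma nc_sum_S (a : 'I_N) b : nc_sum a b = nc_shift 0 a b.
Proof. by apply: eq_bigr => f _; apply: eq_bigr => r _; rewrite mul0n addn0. Qed.

Lemma nc_sum0 a : nc_sum a a = 1.
Proof.
rewrite /nc_sum (big_pred1 [ffun x : 'I_N => x]) => [|f].
  by rewrite big_pred0 // => r; rewrite /in_range; case: leqP => //=; case: ltnP => //; lia.
apply/asboolP/eqP => [[c1 _ _ _]|->].
  by apply/ffunP => x; rewrite ffunE c1 // /in_range; lia.
by split=> [x _|x|x|x y z t]; rewrite ?ffunE // /in_range; lia.
Qed.

Lemma nc_labelling_fix (a : 'I_N) b f : (a < b)%N ->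
  (nc_labelling a b f /\ f a = a) <-> nc_labelling a.+1 b f.
Proof.
move=> ab; split=> [[[c1 c2 c3 c4] fa]|[c1 c2 c3 c4]].
  split=> [x xr|x xr||x y z t xr tr] //.
  - case: (eqVneq x a) => [->//|xa]; apply: c1; move: xr xa.
    by rewrite /in_range -(inj_eq val_inj) /=; lia.
  - by apply: c2; move: xr; rewrite /in_range; lia.
  - by apply: c4; move: xr tr; rewrite /in_range; lia.
have fa : f a = a by apply: c1; rewrite /in_range; lia.
split=> //; split=> [x xr|x xr||x y z t xr tr xy yz zt] //.
- by apply: c1; move: xr; rewrite /in_range; lia.
- case: (eqVneq x a) => [->|xa]; first by rewrite fa leqnn.
  by apply: c2; move: xr xa; rewrite /in_range -(inj_eq val_inj) /=; lia.
case: (eqVneq x a) => [xa|xa].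
  subst x; rewrite fa => /(congr1 val) /= az.
  have /c2 : in_range a.+1 b z by move: xr tr; rewrite /in_range; lia.
  by move=> [zf _]; lia.
by move: xr tr xa; rewrite /in_range -(inj_eq val_inj) /= => xr tr xa; apply: (c4 x y z t) => //;
  rewrite /in_range; lia.
Qed.

Lemma nc_shift_single j (a : 'I_N) b : (a < b)%N ->
  \sum_(f | `[< nc_labelling a b f >] && (f a == a))
    \prod_(r | in_range a b r && (f r == r)) u (#|fiber f r| + j * (r == f a))%N
  = u j.+1 * nc_sum a.+1 b.
Proof.
move=> ab; rewrite /nc_sum mulr_sumr; apply: eq_big => [f|f].
  apply/andP/asboolP => [[/asboolP nf /eqP fa]|/(nc_labelling_fix f ab)[nf fa]].
    by apply/(nc_labelling_fix f ab).
  by split; [exact/asboolP | exact/eqP].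
move=> /andP[/asboolP nf /eqP fa].
have [c1 c2 _ _] : nc_labelling a.+1 b f by apply/(nc_labelling_fix f ab).
rewrite (bigD1 a) /=; last by rewrite /in_range leqnn ab fa eqxx.
rewrite fa eqxx muln1; congr (u _ * _).
  rewrite (_ : fiber f a = [set a]%SET) ?cards1 ?add1n //.
  apply/setP => x; rewrite !inE; apply/eqP/eqP => [fx|->//].
  have := c2 x; rewrite fx; case: (boolP (in_range a.+1 b x)) => [|/c1]; last by rewrite fx.
  by move=> xr /(_ isT); move: xr; rewrite /in_range; lia.
apply: eq_big => r; last first.
  by move=> /andP[_ /negPf ra]; rewrite ra muln0 addn0.
by rewrite andbAC; congr (_ && _); rewrite /in_range -(inj_eq val_inj) /=; lia.
Qed.

Definition next_in_block f (a : 'I_N) b (i : 'I_N) : Prop :=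
  [/\ (a < i)%N, (i < b)%N, f i = f a & forall x, (a < x)%N -> (x < i)%N -> f x <> f a].

(** If i follows a in the block of a, the points strictly between them form
    their own non-crossing partition, and removing a leaves a non-crossing
    partition of [i, b[ whose first block has lost one point. *)
Lemma nc_shift_next j (a i : 'I_N) b : (a < i)%N -> (i < b)%N ->
  \sum_(f | `[< nc_labelling a b f >] && `[< next_in_block f a b i >])
    \prod_(r | in_range a b r && (f r == r)) u (#|fiber f r| + j * (r == f a))%N
  = nc_sum a.+1 i * nc_shift j.+1 i b.
Proof.
move=> ai ib.
(* [h] glues the labellings of the two intervals, giving a the label of i;
   [h'] restricts a labelling to the two intervals. *)
pose h (gg : {ffun 'I_N -> 'I_N} * {ffun 'I_N -> 'I_N}) : {ffun 'I_N -> 'I_N} :=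
  [ffun x : 'I_N => if x == a then gg.2 i else if (x < i)%N then gg.1 x else gg.2 x].
pose h' f : {ffun 'I_N -> 'I_N} * {ffun 'I_N -> 'I_N} :=
  ([ffun x : 'I_N => if in_range a.+1 i x then f x else x],
   [ffun x : 'I_N => if (i <= x)%N then f x else x]).
rewrite (reindex_onto h h') /=; last first.
  move=> f /andP[/asboolP[c1 _ _ _] /asboolP[_ _ fi _]].
  apply/ffunP => x; rewrite /h /h' !ffunE leqnn /=.
  case: eqVneq => [->//|xa]; case: ltnP => xi.
    rewrite /in_range xi andbT; case: ltnP => // xa'.
    by rewrite c1 // /in_range; move: xa; rewrite -(inj_eq val_inj) /=; lia.
  by [].
rewrite /nc_sum /nc_shift mulr_suml; under [RHS]eq_bigr do rewrite mulr_sumr.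
rewrite pair_big_dep /=.
(* Gluing is a bijection onto the labellings in which i follows a. *)
have Hcond gg : `[< nc_labelling a b (h gg) >] && `[< next_in_block (h gg) a b i >] && (h' (h gg) == gg)
   = `[< nc_labelling a.+1 i gg.1 >] && `[< nc_labelling i b gg.2 >].
  case: gg => g g' /=; set f := h _.
  have fa : f a = g' i by rewrite ffunE eqxx.
  have fl x : (a < x)%N -> (x < i)%N -> f x = g x.
    by move=> ax xi; rewrite ffunE /= xi ifN // -(inj_eq val_inj) /=; lia.
  have fr x : (i <= x)%N -> f x = g' x.
    by move=> ix; rewrite ffunE /= ltnNge ix /= ifN // -(inj_eq val_inj) /=; lia.
  apply/idP/idP.
    move=> /andP[/andP[/asboolP[c1 c2 c3 c4] /asboolP[_ _ fi nx]] /eqP[Eg Eg']].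
    have go x : ~~ in_range a.+1 i x -> g x = x.
      by move=> xr; rewrite -Eg ffunE (negPf xr).
    have go' x : (x < i)%N -> g' x = x.
      by move=> xi; rewrite -Eg' ffunE leqNgt xi.
    have c2l x : in_range a.+1 i x -> (x <= f x)%N /\ (f x < i)%N.
      move=> /andP[ax xi]; have [] := c2 x; first by rewrite /in_range; lia.
      move=> xf fb; split=> //; rewrite ltnNge leq_eqVlt; apply/negP => /orP[/eqP e|il].
        by apply: (nx x) => //; rewrite -fi; have := c3 x; rewrite (val_inj e : i = f x) => ->.
      apply: (nx x) => //; apply/esym; apply: (c4 a x i (f x)) => //; rewrite /in_range; lia.
    apply/andP; split; apply/asboolP; split=> //.
    - by move=> x xr; rewrite -fl; [exact: c2l | case/andP: xr | case/andP: xr].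
    - move=> x; case: (boolP (in_range a.+1 i x)) => [xr|xr]; last by rewrite !(go x xr).
      have /andP[ax xi] := xr; have [xf fi'] := c2l _ xr.
      rewrite -(fl x) // -fl ?c3 //; lia.
    - move=> x y z t /andP[ax xi] /andP[at_ ti] xy yz zt; rewrite -!fl; try lia.
      by apply: c4; rewrite /in_range; lia.
    - by move=> x xr; rewrite -Eg' ffunE; case: leqP => // ix; apply: c1; move: xr; rewrite /in_range; lia.
    - move=> x /andP[ix xb]; rewrite -fr //; apply: c2; rewrite /in_range; lia.
    - move=> x; case: (ltnP x i) => xi; first by rewrite !go'.
      have xf : (x <= f x)%N.
        case: (boolP (in_range a b x)) => [/c2[]//|xr]; by rewrite c1.
      rewrite -(fr x) // -fr ?c3 //; lia.
    - move=> x y z t /andP[ix xb] /andP[it tb] xy yz zt; rewrite -!fr; try lia.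
      by apply: c4; rewrite /in_range; lia.
  move=> /andP[/asboolP[c1 c2 c3 c4] /asboolP[d1 d2 d3 d4]].
  have gl x : (a < x)%N -> (x < i)%N -> (x <= g x)%N /\ (g x < i)%N.
    by move=> ax xi; apply: c2; rewrite /in_range; lia.
  have gr x : (i <= x)%N -> (i <= g' x)%N.
    move=> ix; case: (boolP (in_range i b x)) => [/d2[]|/d1->//]; lia.
  have fo x : ~~ in_range a b x -> f x = x.
    move=> xr; rewrite ffunE ifN; last by rewrite -(inj_eq val_inj) /=; move: xr; rewrite /in_range; lia.
    by case: ltnP => xi /=; [apply: c1 | apply: d1]; move: xr; rewrite /in_range; lia.
  have [ig' g'b] : (i <= g' i)%N /\ (g' i < b)%N by apply: d2; rewrite /in_range; lia.
  apply/andP; split; last first.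
    apply/eqP; congr pair; apply/ffunP => x; rewrite !ffunE.
      case: ifP => [/andP[ax xi]|/negbT/c1->//].
      by rewrite /= xi ifN // -(inj_eq val_inj) /=; lia.
    case: leqP => [ix|xi]; last by rewrite d1 // /in_range; lia.
    by rewrite /= ifN ?ifN // -?(inj_eq val_inj) /=; lia.
  apply/andP; split; apply/asboolP; split=> //.
  - move=> x /andP[ax xb]; case: (ltnP x i) => xi; last first.
      by rewrite fr //; apply: d2; rewrite /in_range; lia.
    case: (ltnP a x) => ax'; first by rewrite fl //; have := gl _ ax' xi; lia.
    have -> : x = a by apply: val_inj => /=; lia.
    by rewrite fa; lia.
  - move=> x; case: (boolP (in_range a b x)) => [/andP[ax xb]|xr]; last by rewrite !fo.
    case: (ltnP x i) => xi; last by rewrite (fr x) // fr ?gr // d3.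
    case: (ltnP a x) => ax'; first by rewrite (fl x) //; have [? ?] := gl _ ax' xi; rewrite fl ?c3 //; lia.
    have -> : x = a by apply: val_inj => /=; lia.
    by rewrite fa fr ?d3.
  - move=> x y z t /andP[ax xb] /andP[_ tb] xy yz zt fxz fyt.
    case: (ltnP y i) => yi.
      rewrite (fl y) in fyt *; try lia.
      have [_ gyi] := gl y ltac:(lia) yi.
      have ti : (t < i)%N.
        by rewrite ltnNge; apply/negP => it; move: fyt; rewrite fr // => e; have := gr _ it; rewrite -e; lia.
      rewrite (fl t) // in fyt; last by lia.
      rewrite (fl z) in fxz; try lia; have [_ gzi] := gl z ltac:(lia) ltac:(lia).
      case: (ltnP a x) => ax'.
        by rewrite (fl x) // in fxz *; try lia; apply: (c4 x y z t) => //; rewrite /in_range; lia.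
      have xa : x = a by apply: val_inj => /=; lia.
      by move: fxz; rewrite xa fa => e; move: ig'; rewrite e; lia.
    rewrite (fr y) // (fr t) // in fyt *; last by lia.
    rewrite (fr z) // in fxz; last by lia.
    have giz : (i <= g' z)%N by apply: gr; lia.
    case: (ltnP x i) => xi; last first.
      by rewrite (fr x) // in fxz *; apply: (d4 x y z t) => //; rewrite /in_range; lia.
    case: (ltnP a x) => ax'.
      by move: fxz; rewrite fl // => e; have := gl _ ax' xi; rewrite e; lia.
    have xa : x = a by apply: val_inj => /=; lia.
    rewrite xa fa in fxz *; case: (eqVneq i y) => [->//|iy].
    apply: (d4 i y z t) => //; rewrite /in_range ?leqnn; try lia.
    by move: iy; rewrite -(inj_eq val_inj) /=; lia.
  - by rewrite fr // fa.
  move=> x ax xi; rewrite fl // fa => e; have := gl _ ax xi; rewrite e; lia.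
apply: eq_big => [gg|gg]; first by rewrite Hcond.
rewrite Hcond; case: gg => g g' /= /andP[/asboolP[c1 c2 c3 c4] /asboolP[d1 d2 d3 d4]].
set f := h _.
have fa : f a = g' i by rewrite ffunE eqxx.
have fl x : (a < x)%N -> (x < i)%N -> f x = g x.
  by move=> ax xi; rewrite ffunE /= xi ifN // -(inj_eq val_inj) /=; lia.
have fr x : (i <= x)%N -> f x = g' x.
  by move=> ix; rewrite ffunE /= ltnNge ix /= ifN // -(inj_eq val_inj) /=; lia.
have gl x : (a < x)%N -> (x < i)%N -> (x <= g x)%N /\ (g x < i)%N.
  by move=> ax xi; apply: c2; rewrite /in_range; lia.
have gr x : (i <= x)%N -> (i <= g' x)%N.
  move=> ix; case: (boolP (in_range i b x)) => [/d2[]|/d1->//]; lia.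
have fo x : ~~ in_range a b x -> f x = x.
  move=> xr; rewrite ffunE ifN; last by rewrite -(inj_eq val_inj) /=; move: xr; rewrite /in_range; lia.
  by case: ltnP => xi /=; [apply: c1 | apply: d1]; move: xr; rewrite /in_range; lia.
have [ig' g'b] : (i <= g' i)%N /\ (g' i < b)%N by apply: d2; rewrite /in_range; lia.
(* Blocks below i are those of the first labelling; the others are those of
   the second one, the block of i having gained the point a. *)
rewrite (bigID (fun r : 'I_N => (r < i)%N)) /=; congr (_ * _); apply: eq_big => r.
- rewrite /in_range; case: (ltnP r i) => ri; rewrite ?andbF ?andbT //.
  case: (ltnP a r) => ar; first by rewrite fl // (ltn_trans ri ib) ltnW.
  rewrite /=; apply/negbTE/negP => /andP[/andP[ar' _] /eqP].
  have -> : r = a by apply: val_inj => /=; lia.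
  by rewrite fa => e; move: ig'; rewrite e; lia.
- move=> /andP[/andP[/andP[ar rb] /eqP fr'] ri].
  have ar' : (a < r)%N.
    rewrite ltnNge; apply/negP => ra; move: fr'.
    have -> : r = a by apply: val_inj => /=; lia.
    by rewrite fa => e; move: ig'; rewrite e; lia.
  have -> : (r == f a) = false.
    by apply/negbTE; rewrite fa -(inj_eq val_inj) /=; lia.
  rewrite muln0 addn0; congr (u #|pred_of_set _|); apply/setP => x; rewrite !inE.
  case: (ltnP x i) => xi; last first.
    rewrite fr // c1; last by rewrite /in_range; lia.
    have := gr _ xi; rewrite -!(inj_eq val_inj) /=; lia.
  case: (ltnP a x) => ax; first by rewrite fl.
  rewrite c1; last by rewrite /in_range; lia.
  case: (eqVneq x a) => [->|xa].
    by rewrite fa -!(inj_eq val_inj) /=; lia.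
  rewrite fo //; move: xa; rewrite -(inj_eq val_inj) /in_range /=; lia.
- rewrite /in_range -leqNgt; case: (leqP i r) => ir; rewrite ?andbF ?andbT //=.
  by rewrite fr // (leq_trans (ltnW ai) ir).
move=> /andP[/andP[/andP[ar rb] /eqP fr']]; rewrite -leqNgt => ir.
rewrite fa mulSn addnA; congr (u (_ + _)%N); rewrite addnC.
rewrite (cardsD1 a) inE fa [r == _]eq_sym; congr (_ + _)%N.
rewrite (cardsD1 a (fiber g' r)) inE (d1 a); last by rewrite /in_range; lia.
have -> : (a == r) = false by apply/negbTE; rewrite -(inj_eq val_inj) /=; lia.
rewrite add0n; congr #|pred_of_set _|; apply/setP => x; rewrite !inE.
case: eqVneq => //= xa; case: (ltnP x i) => xi; last by rewrite fr.
rewrite d1; last by rewrite /in_range; lia.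
have := fl x; have := gl x; have := fo x; move: xa; rewrite -!(inj_eq val_inj) /=.
case: (ltnP a x) => ax.
  by move=> _ _ /(_ isT xi)[_ gx] /(_ isT xi) ->; lia.
by move=> xa ->; rewrite /in_range; lia.
Qed.


Lemma next_in_block_uniq f (a : 'I_N) b (i i' : 'I_N) : next_in_block f a b i -> next_in_block f a b i' -> i = i'.
Proof.
move=> [ai _ fi nx] [ai' _ fi' nx'].
case: (ltngtP i i') => [lt|lt|/val_inj //].
  by case: (nx' i).
by case: (nx i').
Qed.

(** Either a is alone in its block, or its block has a next point i. *)
Lemma nc_shift_rec j (a : 'I_N) b : (a < b)%N ->
  nc_shift j a b = u j.+1 * nc_sum a.+1 b +
    \sum_(i : 'I_N | (a < i)%N && (i < b)%N) nc_sum a.+1 i * nc_shift j.+1 i b.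
Proof.
move=> ab; rewrite /nc_shift (bigID (fun f : {ffun 'I_N -> 'I_N} => f a == a)) /=.
rewrite -/(nc_shift _ _ _) nc_shift_single //; congr (_ + _).
pose p f : 'I_N := [arg min_(i < f a | (a < i)%N && (f i == f a)) (i : nat)].
have pP f : nc_labelling a b f -> f a != a -> next_in_block f a b (p f).
  move=> [c1 c2 c3 c4] fa; have [af fb] : (a <= f a)%N /\ (f a < b)%N.
    by apply: c2; rewrite /in_range leqnn ab.
  have fa0 : (a < f a)%N && (f (f a) == f a).
    by rewrite c3 eqxx andbT ltn_neqAle af eq_sym andbT.
  rewrite /p; case: arg_minnP => // i /andP[ai /eqP fi] mini.
  split=> //; first exact: leq_ltn_trans (mini _ fa0) fb.
  move=> x ax xi /eqP fx; have := mini x; rewrite ax fx => /(_ isT); lia.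
rewrite (partition_big p (fun i : 'I_N => (a < i)%N && (i < b)%N)); last first.
  by move=> f /andP[/asboolP nf fa]; have [-> -> _ _] := pP f nf fa.
apply: eq_bigr => i /andP[ai ib]; rewrite -nc_shift_next //; apply: eq_bigl => f.
apply/andP/andP => [[/andP[nf fa] /eqP <-]|[nf /asboolP [_ _ fi nx]]].
  by split=> //; apply/asboolP; apply: pP => //; exact/asboolP.
have [c1 c2 c3 c4] := asboolW nf.
have fa : f a != a.
  apply/eqP => e; have [] := c2 i; first by rewrite /in_range; lia.
  by rewrite fi e; lia.
rewrite nf fa; split=> //; apply/eqP.
by apply: (@next_in_block_uniq f a b) => //; exact: pP (asboolW nf) fa.
Qed.
End Labels.

(** The unique solution of m = phi(w m): the right-hand side in degree n
    depends on m below n. *)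
Definition momser (phi : ser K) : ser K :=
  srec (fun m n => scomp phi (sw K * (m : ser K)) n).

Lemma spow_ext (f g : ser K) N k : (forall i, (i <= N)%N -> f i = g i) ->
  forall i, (i <= N)%N -> (f ^+ k) i = (g ^+ k) i.
Proof.
move=> fg; elim: k => // k IH i iN; rewrite !exprS !smulE.
apply: eq_bigr => j _; rewrite fg ?IH //; first by apply: leq_trans iN; exact: leq_subr.
by apply: leq_trans iN; rewrite -ltnS.
Qed.

Lemma momserE phi : momser phi = scomp phi (sw K * momser phi).
Proof.
apply/funext => n; rewrite {1}/momser srecE // => f g fg.
apply: eq_bigr => k _; congr (_ * _); apply: (@spow_ext _ _ n) => // i iN.
by rewrite !smulwE; case: i iN => // i iN; apply: fg.
Qed.

Lemma momser_uniq phi (m : ser K) : m = scomp phi (sw K * m) -> m = momser phi.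
Proof.
move=> mE; apply/funext => n; elim/ltn_ind: n => n IH.
rewrite mE momserE; apply: eq_bigr => k _; congr (_ * _).
apply: (@spow_ext _ _ n) => // i iN.
by rewrite !smulwE; case: i iN => // i iN; apply: IH.
Qed.

Section Solve.
Variable phi : ser K.
Hypothesis phi0 : phi 0%N = 1.
Hypothesis phiu : forall k, phi k.+1 = u k.+1.
Let m := momser phi.
Let G := sw K * m.
Let G0 : G 0%N = 0. Proof. by rewrite /G smulwE. Qed.
(* [alpha j] = sum_k u_(j + k + 1) G^(k + 1): the first block has j + k + 1
   points counting the shift, and each of its k + 1 proper points is followed
   by an interval that carries a non-crossing partition. *)
Let alpha (j : nat) : ser K := G * scomp (iter j.+1 (@stl K) phi) G.

Let alphaE j : alpha j = sC (u j.+1) * G + G * alpha j.+1.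
Proof.
rewrite /alpha [scomp _ G]scomp_rec // -iterS.
have -> : iter j.+1 (@stl K) phi 0%N = u j.+1.
  have H k i : iter k (@stl K) phi i = phi (k + i)%N.
    by elim: k i => // k IH i; rewrite iterS /stl IH addnS.
  by rewrite H addn0 phiu.
ring.
Qed.

Let m_alpha n : m n.+1 = alpha 0 n.+1.
Proof. by rewrite {1}/m momserE -/m scomp_rec // saddE add0r. Qed.

(** [nc_shift_rec] and the equation alpha_j = u_(j + 1) G + G alpha_(j + 1)
    are the same recursion on the length of the interval. *)
Lemma nc_solve N n :
  (forall a b, (a <= b)%N -> (b <= N)%N -> (b - a)%N = n -> nc_sum N a b = m n) /\
  (forall j (a : 'I_N) b, (a < b)%N -> (b <= N)%N -> (b - a)%N = n -> nc_shift j a b = alpha j n).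
Proof.
elim/ltn_ind: n => n IH.
have HS j (a : 'I_N) b : (a < b)%N -> (b <= N)%N -> (b - a)%N = n -> nc_shift j a b = alpha j n.
  move=> ab bN ban; rewrite nc_shift_rec // alphaE saddE smulCE /G smulwE -ban.
  case E: (b - a)%N => [|k]; first by lia.
  have [H _] := IH k ltac:(lia); rewrite H ?[X in m X]/(k) //; try lia.
  congr (_ + _); rewrite -/G smulE.
  rewrite -(big_mkord predT (fun i => G i * alpha j.+1 (k.+1 - i)%N)).
  rewrite big_ltn // G0 mul0r add0r big_nat_recr //= subnn /alpha smul0E G0 mul0r mulr0 addr0.
  transitivity (\sum_(a.+1 <= i < b) G (i - a)%N * alpha j.+1 (b - i)%N).
    rewrite (big_nat_widen _ _ _ _ _ bN) (big_nat_widenl _ 0) // big_mkord.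
    apply: eq_big => [i|i /andP[ai ib]]; first by rewrite andbC.
    rewrite /G smulwE; case E' : (i - a)%N => [|l]; first by lia.
    have [-> //] := IH l ltac:(lia); try lia.
    by have [_ ->] := IH (b - i)%N ltac:(lia).
  rewrite -{1}[a.+1]add1n big_addn E; apply: eq_big_nat => i /andP[i0 ik].
  by rewrite addnK; congr (_ * alpha _ _); lia.
split=> // a b; rewrite leq_eqVlt => /predU1P[->|ab] bN ban.
  by rewrite -ban subnn nc_sum0 /m momserE scomp_eq0.
have aN : (a < N)%N by lia.
rewrite -[a]/(nat_of_ord (Ordinal aN)) nc_sum_S HS //.
by case: n {IH HS} ban => [|n] ban; [lia | rewrite m_alpha].
Qed.

End Solve.

End NonCrossing.

Section Partitions.
Variables (K : comNzRingType) (u : nat -> K) (n : nat).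
Implicit Types (f : {ffun 'I_n -> 'I_n}) (P : {set {set 'I_n}}) (V W : {set 'I_n}).

Definition fibers f : {set {set 'I_n}} := [set fiber f (f x) | x : 'I_n]%SET.

Definition label P : {ffun 'I_n -> 'I_n} :=
  [ffun x => [arg max_(y > x in finset.pblock P x) (y : nat)]].

Lemma fibersP f : finset.partition (fibers f) [set: 'I_n].
Proof.
apply/and3P; split.
- apply/eqP/setP => x; rewrite inE; apply/bigcupP; exists (fiber f (f x)).
    exact: imset_f.
  by rewrite inE.
- apply/finset.trivIsetP => _ _ /imsetP[x _ ->] /imsetP[y _ ->] xy.
  rewrite -finset.setI_eq0; apply/eqP/setP => z; rewrite !inE.
  by apply/negP => /andP[/eqP zx /eqP zy]; move: xy; rewrite -zx zy eqxx.
- by apply/negP => /imsetP[x _ /setP/(_ x)]; rewrite !inE eqxx.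
Qed.

Lemma pblock_fibers f x : finset.pblock (fibers f) x = fiber f (f x).
Proof.
have /and3P[_ tP _] := fibersP f.
by apply: finset.def_pblock => //; [exact: imset_f | rewrite inE].
Qed.

Lemma labelP P x : finset.partition P [set: 'I_n] ->
  label P x \in finset.pblock P x /\
  forall y, y \in finset.pblock P x -> (y <= label P x)%N.
Proof.
move=> /and3P[/eqP cP _ _]; rewrite ffunE.
by case: arg_maxnP; rewrite ?finset.mem_pblock ?cP ?inE.
Qed.

Lemma label_fiber P x : finset.partition P [set: 'I_n] ->
  fiber (label P) (label P x) = finset.pblock P x.
Proof.
move=> pP; have /and3P[/eqP cP tP _] := pP.
have E y : finset.pblock P (label P y) = finset.pblock P y.
  by have [/(finset.same_pblock tP)] := labelP y pP.
apply/setP => y; rewrite inE; apply/eqP/idP => [e|yx].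
  by rewrite -E -e E finset.mem_pblock cP inE.
have e := finset.same_pblock tP yx.
have [lx mx] := labelP x pP; have [ly my] := labelP y pP.
rewrite -e in lx mx; apply: val_inj; apply/eqP.
by rewrite eqn_leq my ?mx.
Qed.

Lemma fibersK P : finset.partition P [set: 'I_n] -> fibers (label P) = P.
Proof.
move=> pP; have /and3P[/eqP cP tP P0] := pP.
apply/setP => V; apply/imsetP/idP => [[x _ ->]|VP].
  by rewrite label_fiber // finset.pblock_mem // cP inE.
have /set0Pn[x xV] : V != finset.set0 by apply: contraNneq P0 => <-.
by exists x => //; rewrite label_fiber // (finset.def_pblock tP VP xV).
Qed.

(** Partitions into blocks correspond to labellings by maxima, and crossings
    to crossings. *)
Lemma NC_label f : (fibers f \in NC n) && (label (fibers f) == f) = `[< nc_labelling 0 n f >].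
Proof.
apply/andP/asboolP => [[]|[c1 c2 c3 c4]].
  rewrite inE => /andP[pP /forall_inP ncP] /eqP lf.
  have L x : f x \in fiber f (f x) /\ forall y, y \in fiber f (f x) -> (y <= f x)%N.
    by have := labelP x pP; rewrite lf pblock_fibers.
  split=> [x|x _|x|x y z t _ _ xy yz zt fxz fyt].
  - by rewrite /in_range /= ltn_ord.
  - by have [_ ->] := L x; rewrite ?inE // ltn_ord.
  - by have [] := L x; rewrite inE => /eqP.
  apply/eqP; apply: contraT => fxy.
  have fV v : fiber f (f v) \in fibers f by exact: imset_f.
  have /forall_inP/(_ _ (fV y)) := ncP _ (fV x).
  have -> : fiber f (f x) != fiber f (f y).
    by apply: contra fxy => /eqP/setP/(_ x); rewrite !inE eqxx => /esym.
  move=> /negP[]; apply/existsP; exists x; apply/existsP; exists y.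
  apply/existsP; exists z; apply/existsP; exists t.
  by rewrite xy yz zt !inE -fxz -fyt !eqxx.
split.
  rewrite inE fibersP; apply/forall_inP => _ /imsetP[v _ ->].
  apply/forall_inP => _ /imsetP[v' _ ->]; apply/implyP => VW; apply/negP.
  move=> /existsP[x /existsP[y /existsP[z /existsP[t]]]].
  rewrite !inE => /and5P[xy yz zt /eqP fx /and3P[/eqP fy /eqP fz /eqP ft]].
  case/eqP: VW; rewrite -fx -fy (c4 x y z t) //; rewrite /in_range ?ltn_ord //.
    by rewrite fx fz.
  by rewrite fy ft.
apply/eqP/ffunP => x; have [lx mx] := labelP x (fibersP f).
rewrite pblock_fibers in lx mx; apply: val_inj; apply/eqP; rewrite eqn_leq.
rewrite mx ?inE ?c3 // andbT; move: lx; rewrite inE => /eqP <-.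
by have [] := c2 (label (fibers f) x); rewrite // /in_range ltn_ord.
Qed.

Lemma NC_nc_sum : \sum_(P in NC n) \prod_(V in P) u #|V| = nc_sum u n 0 n.
Proof.
rewrite (reindex_onto fibers label) /=; last first.
  by move=> P; rewrite inE => /andP[/fibersK].
apply: eq_big => [f|f]; rewrite NC_label // => /asboolP[c1 c2 c3 c4].
have -> : fibers f = [set fiber f r | r in [set r | f r == r]]%SET.
  apply/setP => V; apply/imsetP/imsetP => [[x _ ->]|[r]].
    by exists (f x); rewrite // inE c3.
  by rewrite inE => /eqP fr ->; exists r; rewrite // fr.
rewrite big_imset /=; last first.
  move=> r r'; rewrite !inE => /eqP fr /eqP fr' /setP/(_ r).
  by rewrite !inE fr eqxx => /esym/eqP.
by apply: eq_bigl => r; rewrite inE /in_range ltn_ord.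
Qed.
End Partitions.

(** The moment-cumulant formula in functional form, over any commutative ring
    so that it can be applied to deformed cumulants. *)
Lemma NC_momser (K : comNzRingType) (u : nat -> K) (phi : ser K) n :
  phi 0%N = 1 -> (forall k, phi k.+1 = u k.+1) ->
  \sum_(P in NC n) \prod_(V in P) u #|V| = momser phi n.
Proof.
move=> phi0 phiu; rewrite NC_nc_sum.
by have [-> //] := @nc_solve K u phi phi0 phiu n n; rewrite subn0.
Qed.

(** * Free and infinitesimal free cumulants as power series *)

Section RTransform.
Variable R : realType.
Local Notation w := (sw R).

Definition cumser (m : nat -> R) : ser R :=
  fun k => if k is k'.+1 then free_cumulant m k else 1.

Lemma moment_cumulant_series (m : nat -> R) : m 0%N = 1 ->
  m = scomp (cumser m) (w * (m : ser R)) :> ser R.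
Proof.
move=> m0; suff {1 3}-> : m = momser (cumser m) by exact: momserE.
apply/funext => -[|n]; first by rewrite momserE scomp_eq0 // smulwE.
by rewrite free_cumulantP // -(@NC_momser R (free_cumulant m)).
Qed.

Definition infcumser (m m1 : nat -> R) : ser R :=
  fun k => if k is k'.+1 then inf_free_cumulant m m1 k else 0.

Lemma coef0_smul (f g : ser {poly R}) n :
  ((f * g) n)`_0 = (((fun k => (f k)`_0) : ser R) * ((fun k => (g k)`_0) : ser R)) n.
Proof. by rewrite !smulE coef_sum; apply: eq_bigr => i _; rewrite coef0M. Qed.

Lemma coef1_smul (f g : ser {poly R}) n :
  ((f * g) n)`_1 = (((fun k => (f k)`_0) : ser R) * ((fun k => (g k)`_1) : ser R) +
     ((fun k => (f k)`_1) : ser R) * ((fun k => (g k)`_0) : ser R)) n.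
Proof.
rewrite saddE !smulE coef_sum -big_split; apply: eq_bigr => i _.
by rewrite coefM !big_ord_recl big_ord0 /= addr0 subn0.
Qed.

(** Differentiating a product over the blocks of a partition singles out one
    block at a time, so the defining formula of infinitesimal free cumulants
    is the derivative of the moment-cumulant formula in the direction r'. It
    is computed by taking weights r + r' X in polynomials and comparing
    coefficients of X. *)
Lemma inf_moment_cumulant_series (m m1 : nat -> R) : m 0%N = 1 -> m1 0%N = 0 ->
  m1 = scomp (infcumser m m1) (w * (m : ser R)) +
       scomp (sd (cumser m)) (w * (m : ser R)) * (w * (m1 : ser R)) :> ser R.
Proof.
move=> m00 m10.
pose r := free_cumulant m; pose r1 := inf_free_cumulant m m1.
pose u k : {poly R} := (r k)%:P + r1 k *: 'X.
pose phi : ser {poly R} := fun k => if k is k'.+1 then u k else 1.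
have u0 k : (u k)`_0 = r k by rewrite /u coefD coefC coefZ coefX mulr0 addr0.
have u1 k : (u k)`_1 = r1 k by rewrite /u coefD coefC coefZ coefX mulr1 add0r.
have M n := @NC_momser _ u phi n erefl (fun=> erefl).
have C0 (I : Type) (s : seq I) (F : I -> {poly R}) : (\prod_(i <- s) F i)`_0 = \prod_(i <- s) (F i)`_0.
  elim: s => [|i s IH]; first by rewrite !big_nil coef1.
  by rewrite !big_cons coef0M IH.
have M0 n : (momser phi n)`_0 = m n.
  case: n => [|n].
    by rewrite momserE scomp_eq0 ?smulwE //= coef1.
  rewrite -M coef_sum free_cumulantP //; apply: eq_bigr => P _.
  by rewrite /part_prod -big_enum /= C0 big_enum; apply: eq_bigr => V _; rewrite u0.
(* the Leibniz rule for the coefficient of X *)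
have C1 (I : eqType) (s : seq I) (F : I -> {poly R}) : uniq s -> (\prod_(i <- s) F i)`_1 =
   \sum_(i <- s) (F i)`_1 * \prod_(j <- s | j != i) (F j)`_0.
  elim: s => [|i s IH]; first by rewrite !big_nil coef1.
  move=> /= /andP[iNs us]; rewrite !big_cons coefM !big_ord_recl big_ord0 /= addr0 subn0 eqxx /=.
  rewrite C0 addrC IH //; congr (_ * _ + _).
    rewrite [LHS]big_seq [RHS]big_seq_cond; apply: eq_bigl => j.
    by case: eqP => [->|_]; rewrite ?(negPf iNs) ?andbT.
  rewrite big_distrr /= [LHS]big_seq [RHS]big_seq; apply: eq_bigr => j js.
  rewrite big_cons ifT; last by apply: contraNneq iNs => ->.
  by rewrite mulrCA.
have M1 n : (momser phi n)`_1 = m1 n.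
  case: n => [|n].
    by rewrite momserE scomp_eq0 ?smulwE //= coef1 m10.
  rewrite -M coef_sum (@inf_free_cumulantP R m m1) //; apply: eq_bigr => P _.
  rewrite -big_enum C1 ?enum_uniq // big_enum; apply: eq_bigr => V VP.
  rewrite u1 /part_prodD; congr (_ * _).
  by rewrite big_enum_cond /=; apply: eq_bigr => W _; rewrite u0.
have G0 k : ((sw {poly R} * momser phi) k)`_0 = (w * (m : ser R)) k.
  by rewrite !smulwE; case: k => [|k]; rewrite ?coef0.
have G1 k : ((sw {poly R} * momser phi) k)`_1 = (w * (m1 : ser R)) k.
  by rewrite !smulwE; case: k => [|k]; rewrite ?coef0.
set Gt := sw {poly R} * momser phi in G0 G1; set G := w * _ in G0 *.
set g1 := w * _ in G1 *.
have X0 k n : ((Gt ^+ k) n)`_0 = (G ^+ k) n.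
  elim: k n => [|k IH] n; first by rewrite !expr0 !s1E; case: eqP; rewrite ?coef1 ?coef0.
  by rewrite !exprS coef0_smul; apply: eq_bigr => i _; rewrite /= G0 IH.
have X1 k n : ((Gt ^+ k) n)`_1 = (G ^+ k.-1 * g1 *+ k) n.
  elim: k n => [|k IH] n; first by rewrite expr0 s1E mulr0n; case: eqP; rewrite ?coef1 ?coef0.
  rewrite exprS coef1_smul.
  have -> : (fun k => (Gt k)`_0) = G by apply/funext => i; rewrite G0.
  have -> : (fun k => (Gt k)`_1) = g1 by apply/funext => i; rewrite G1.
  have -> : (fun i => ((Gt ^+ k) i)`_0) = G ^+ k by apply/funext => i; rewrite X0.
  have -> : (fun i => ((Gt ^+ k) i)`_1) = G ^+ k.-1 * g1 *+ k by apply/funext => i; rewrite IH.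
  congr ((_ : ser R) n); rewrite mulrS addrC [g1 * _]mulrC; congr (_ + _).
  case: k {IH} => [|k] /=; first by rewrite !mulr0n mulr0.
  by rewrite mulrnAr mulrA -exprS.
apply/funext => n; rewrite -M1 momserE -/Gt saddE.
have Gz : G 0%N = 0 by rewrite /G smulwE.
have gz : g1 0%N = 0 by rewrite /g1 smulwE.
rewrite scomp_mul // /scomp coef_sum big_ord_recl /= expr0.
rewrite [X in X + _ = _](_ : _ = 0); last first.
  by rewrite mul1r s1E; case: eqP; rewrite ?coef1 ?coef0.
rewrite add0r big_ord_recl mul0r add0r -big_split; apply: eq_bigr => k _.
rewrite coefM !big_ord_recl big_ord0 /= addr0 subn0 u0 u1 X0 X1 /= addrC; congr (_ + _).
by rewrite smulnE /sd /= mulrnAr -mulr_natl mulrA.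
Qed.
End RTransform.

(** * Genus of a pair of permutations *)

Section Genus.
Variable T : finType.
Implicit Types (s t : {perm T}) (C D A B : {set T}).

Lemma porbit_invariant (I : Type) (f : T -> I) s x y :
  (forall z, f (s z) = f z) -> y \in porbit s x -> f y = f x.
Proof.
move=> fs /porbitP[i ->]; elim: i => [|i IH]; first by rewrite expg0 perm1.
by rewrite expgSr permM fs IH.
Qed.

(** Euler's inequality for a pair of permutations, with f constant on the
    orbits of their joint action. Induction on alpha, starting from the
    identity: alpha is a transposition times alpha' with one more cycle than
    alpha, and the number of cycles of the product changes by one. If the
    labels for alpha' distinguish the transposed points, these lie on
    different cycles of alpha' beta, so the product loses a cycle, which
    compensates the merging of two labels. *)
Lemma genus_labels (alpha beta : {perm T}) : exists f : T -> {set T},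
  [/\ forall x, f (alpha x) = f x, forall x, f (beta x) = f x &
    (#|porbits (alpha * beta)%g| + #|porbits alpha| + #|porbits beta|
      <= #|T| + (#|f @: [set: T]|).*2)%N].
Proof.
have porb_le s : (#|porbits s| <= #|T|)%N by rewrite /porbits leq_imset_card.
have [k] := ubnP (#|T| - #|porbits alpha|)%N.
elim: k alpha => // k IH alpha; rewrite ltnS => lek.
case: (pickP (fun x => alpha x != x)) => [x ax|al1]; last first.
  have -> : alpha = 1%g by apply/permP => x; rewrite perm1; apply/eqP/negPn; rewrite al1.
  exists (porbit beta); split=> [x|x|]; first by rewrite perm1.
    by have := porbit_perm beta 1 x; rewrite expg1.
  rewrite mul1g -/(porbits beta).
  rewrite (_ : porbit beta @: [set: T] = porbits beta); last first.
    by apply/setP => V; apply/imsetP/imsetP => -[z _ ->]; exists z; rewrite ?inE.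
  have := porb_le 1%g; lia.
pose tau := tperm x (alpha x); pose alpha' := (tau * alpha)%g.
have alE : alpha = (tau * alpha')%g by rewrite /alpha' mulgA tperm2 mul1g.
have cal : #|porbits alpha'| = #|porbits alpha|.+1.
  have := porbits_mul_tperm alpha x (alpha x); rewrite -/tau -/alpha' eq_sym ax.
  have -> : (x \notin porbit alpha (alpha x)) = false.
    by rewrite porbit_sym; have := mem_porbit alpha 1 x; rewrite expg1 => ->.
  by rewrite /= addn0 addn1.
have [|f [fa fb le]] := IH alpha'.
  have := porb_le alpha'; lia.
have psiE : (alpha * beta = tau * (alpha' * beta))%g by rewrite alE -mulgA.
have cpsi := porbits_mul_tperm (alpha' * beta)%g x (alpha x).
rewrite /= -/tau -psiE eq_sym ax in cpsi.
rewrite /= in cpsi.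
have fab z : f ((alpha' * beta)%g z) = f z by rewrite permM fb fa.
case: (eqVneq (f x) (f (alpha x))) => [fx|fx].
  have ftau z : f (tau z) = f z.
    by rewrite /tau; case: tpermP => [->|->|].
  exists f; split=> // [z|]; first by rewrite alE permM fa ftau.
  have le1 : (#|porbits (alpha * beta)%g| <= #|porbits (alpha' * beta)%g| + 1)%N.
    by rewrite -cpsi leq_addr.
  rewrite cal in le; apply: leq_trans le; rewrite leq_add2r addnS -addSn leq_add2r.
  by rewrite -addn1.
(* the labels of the two transposed points are merged *)
pose f' z := if f z == f (alpha x) then f x else f z.
have f'tau z : f' (tau z) = f' z.
  rewrite /f' /tau; case: tpermP => [->|->|//]; by rewrite eqxx (negPf fx).
exists f'; split=> [z|z|].
- have f'a y : f' (alpha' y) = f' y by rewrite /f' fa.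
  by rewrite alE permM f'a f'tau.
- by rewrite /f' fb.
have xn : x \notin porbit (alpha' * beta)%g (alpha x).
  by apply: contraNN fx => /(porbit_invariant fab) ->.
rewrite xn addn1 -[(_.*2)%N]/2%N addn2 in cpsi; case: cpsi => cpsi.
have : (#|f @: [set: T]| <= #|f (alpha x) |: (f' @: [set: T])|)%N.
  apply/subset_leq_card/fintype.subsetP => _ /imsetP[z _ ->]; rewrite !inE.
  case: (eqVneq (f z) (f (alpha x))) => //= fz; apply/imsetP; exists z => //.
  by rewrite /f' (negPf fz).
rewrite cardsU1 => le2; have {}le2 := leq_trans le2 (leq_add (leq_b1 _) (leqnn _)).
rewrite cal -cpsi in le; move: le le2.
move: #|porbits _| #|porbits alpha| #|porbits beta| #|_ @: _| #|f' @: _| #|T|.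
lia.
Qed.

Definition stab (alpha beta : {perm T}) C :=
  [forall x in C, (alpha x \in C) && (beta x \in C)].

Lemma stabP (alpha beta : {perm T}) C : reflect
  (forall x, x \in C -> alpha x \in C /\ beta x \in C) (stab alpha beta C).
Proof.
by apply: (iffP forall_inP) => H x /H => [/andP|[-> ->]].
Qed.

(** If A is non-empty, it is an orbit of the group generated by alpha and
    beta. *)
Definition conn (alpha beta : {perm T}) A := stab alpha beta A &&
  [forall C : {set T}, (C \subset A) && (C != finset.set0) && stab alpha beta C ==> (C == A)].

Lemma connP (alpha beta : {perm T}) A : reflect
  (stab alpha beta A /\ forall C : {set T}, C \subset A -> C != finset.set0 ->
     stab alpha beta C -> C = A) (conn alpha beta A).
Proof.
apply: (iffP andP) => -[sA H]; split=> //.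
  by move=> C CA C0 sC; apply/eqP; move/forallP: H => /(_ C)/implyP; apply; rewrite CA C0.
by apply/forallP => C; apply/implyP => /andP[/andP[CA C0] sC]; apply/eqP/H.
Qed.

(** For a transitive pair the labels of [genus_labels] take a single value. *)
Lemma genus_bound (alpha beta : {perm T}) : conn alpha beta [set: T] ->
  (#|porbits (alpha * beta)%g| + #|porbits alpha| + #|porbits beta| <= #|T| + 2)%N.
Proof.
move=> /connP[_ H]; have [f [fa fb le]] := genus_labels alpha beta.
apply: leq_trans le _; rewrite leq_add2l -muln2 -[2%N]/(1 * 2)%N leq_mul2r /=.
case: (pickP T) => [x0 _|T0]; last first.
  by apply: leq_trans (leq_imset_card _ _) _; rewrite cardsT eq_card0.
have sC : stab alpha beta [set x | f x == f x0]%SET.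
  by apply/stabP => x; rewrite !inE fa fb.
have C0 : [set x | f x == f x0]%SET != finset.set0.
  by apply/set0Pn; exists x0; rewrite inE.
have /setP CT := H _ (finset.subsetT _) C0 sC.
rewrite (_ : f @: _ = [set f x0]%SET) ?cards1 //.
apply/setP => V; rewrite inE; apply/imsetP/eqP => [[x _ ->]|->]; last by exists x0.
by have := CT x; rewrite !inE => /eqP.
Qed.

Lemma porbits_gt0 s (x : T) : (0 < #|porbits s|)%N.
Proof. by apply/card_gt0P; exists (porbit s x); exact: imset_f. Qed.

End Genus.

(** * The exponential formula for pairs of permutations *)

Section ExpFormula.
Variables (T : finType) (R : comNzRingType).
Implicit Types (s t alpha beta : {perm T}) (A B C D : {set T}) (u v : nat -> R).

Lemma porbit_agree s t A x : (forall y, y \in A -> s y = t y /\ s y \in A) ->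
  x \in A -> porbit s x = porbit t x.
Proof.
move=> H xA; have E i : (s ^+ i)%g x = (t ^+ i)%g x /\ (s ^+ i)%g x \in A.
  elim: i => [|i [IH IHA]]; first by rewrite !expg0 perm1.
  by rewrite !expgSr !permM -IH; apply: H.
apply/setP => y; apply/porbitP/porbitP => -[i ->]; exists i; first by have [] := E i.
by have [-> _] := E i.
Qed.

Lemma porbit_sub s A x : (forall y, y \in A -> s y \in A) -> x \in A -> porbit s x \subset A.
Proof.
move=> H xA; apply/fintype.subsetP => y /porbitP[i ->].
elim: i => [|i IH]; first by rewrite expg0 perm1.
by rewrite expgSr permM; apply: H.
Qed.

(** The product of the weights of the cycles inside B; for a permutation
    supported in B, all other cycles are fixed points and must not be
    counted. *)
Definition cycle_weight u B s : R := \prod_(c in porbits s | c \subset B) u #|c|.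

Definition perm_sum u B : R := \sum_(s | perm_on B s) cycle_weight u B s.

Lemma perm_on_notin A s x : perm_on A s -> x \notin A -> s x = x.
Proof. by move=> /out_perm; apply. Qed.

Lemma perm_on_in A s x : perm_on A s -> x \in A -> s x \in A.
Proof. by move=> /perm_closed ->. Qed.

Definition stable1 s A := [forall x in A, s x \in A].

Lemma stable1_normal s A : stable1 s A -> s \in 'N(A | 'P)%g.
Proof.
move=> /forall_inP sA; apply/astabsP => x; rewrite /= apermE; apply/idP/idP; last exact: sA.
have E : s @: A = A.
  apply/eqP; rewrite eqEcard card_imset ?leqnn ?andbT; last exact: perm_inj.
  by apply/fintype.subsetP => _ /imsetP[y yA ->]; exact: sA.
by rewrite -{1}E => /imsetP[y yA /perm_inj ->].
Qed.

Lemma split_perm B A (G : {perm T} -> R) : A \subset B ->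
  \sum_(s | perm_on B s && stable1 s A) G s =
  \sum_(s | perm_on A s) \sum_(t | perm_on (B :\: A) t) G (s * t)%g.
Proof.
move=> AB; rewrite pair_big_dep /=.
rewrite (reindex_onto (fun st : {perm T} * {perm T} => (st.1 * st.2)%g)
   (fun s => (restr_perm A s, restr_perm (B :\: A) s))) /=; last first.
  move=> s /andP[sB sA]; apply/permP => x; rewrite permM.
  have nA := stable1_normal sA.
  have nBA : s \in 'N(B :\: A | 'P)%g.
    apply: stable1_normal; apply/forall_inP => y; rewrite !inE => /andP[yA yB].
    rewrite (perm_on_in sB yB) andbT.
    by move: nA => /astabsP/(_ y); rewrite /= apermE => ->.
  case: (boolP (x \in A)) => xA.
    rewrite (restr_permE nA xA); apply: perm_on_notin (restr_perm_on _ _) _.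
    by rewrite !inE (forall_inP sA).
  rewrite (perm_on_notin (restr_perm_on A s) xA).
  case: (boolP (x \in B)) => xB; first by rewrite restr_permE // inE xA.
  rewrite (perm_on_notin (restr_perm_on _ _)) ?inE ?(negPf xB) ?andbF //.
  by rewrite (perm_on_notin sB).
apply: eq_bigl => -[s t] /=; apply/andP/andP => [[/andP[stB stA] /eqP[E1 E2]]|[sA tB]].
  by split; [rewrite -E1 restr_perm_on | rewrite -E2 restr_perm_on].
have sEl x : x \in A -> (s * t)%g x = s x.
  move=> xA; rewrite permM (perm_on_notin tB) // !inE.
  by rewrite (perm_on_in sA).
have sEr x : x \notin A -> (s * t)%g x = t x by move=> xA; rewrite permM (perm_on_notin sA).
have stA : stable1 (s * t)%g A.
  by apply/forall_inP => x xA; rewrite sEl // (perm_on_in sA).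
have stBA : stable1 (s * t)%g (B :\: A).
  apply/forall_inP => x xA; rewrite sEr; last by move: xA; rewrite inE => /andP[].
  by rewrite (perm_on_in tB).
rewrite stA; split.
  rewrite andbT; apply/fintype.subsetP => x; rewrite inE; apply: contraNT => xB.
  rewrite permM (perm_on_notin sA); last by apply: contra xB => /(fintype.subsetP AB).
  by rewrite (perm_on_notin tB) // inE (negPf xB) andbF.
apply/eqP; congr pair; apply/permP => x.
  case: (boolP (x \in A)) => xA; first by rewrite (restr_permE (stable1_normal stA)) // sEl.
  by rewrite (perm_on_notin (restr_perm_on _ _)) // (perm_on_notin sA).
case: (boolP (x \in B :\: A)) => xA.
  rewrite (restr_permE (stable1_normal stBA)) // sEr //.
  by move: xA; rewrite inE => /andP[].
by rewrite (perm_on_notin (restr_perm_on _ _)) // (perm_on_notin tB).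
Qed.

Lemma cycle_weight_split u A B s t : A \subset B -> perm_on A s -> perm_on (B :\: A) t ->
  cycle_weight u B (s * t)%g = cycle_weight u A s * cycle_weight u (B :\: A) t.
Proof.
move=> AB sA tB.
have sEl x : x \in A -> (s * t)%g x = s x.
  move=> xA; rewrite permM (perm_on_notin tB) // !inE.
  by rewrite (perm_on_in sA).
have sEr x : x \notin A -> (s * t)%g x = t x by move=> xA; rewrite permM (perm_on_notin sA).
have pl x : x \in A -> porbit (s * t)%g x = porbit s x.
  by apply: (@porbit_agree _ _ A) => y yA; rewrite sEl // (perm_on_in sA).
have pr x : x \in B :\: A -> porbit (s * t)%g x = porbit t x.
  apply: (@porbit_agree _ _ (B :\: A)) => y yA; rewrite sEr ?(perm_on_in tB) //.
  by move: yA; rewrite inE => /andP[].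
have sl x : x \in A -> porbit s x \subset A.
  by apply: porbit_sub => y; apply: perm_on_in.
have sr x : x \in B :\: A -> porbit t x \subset B :\: A.
  by apply: porbit_sub => y; apply: perm_on_in.
rewrite /cycle_weight (bigID (fun c : {set T} => c \subset A)) /=; congr (_ * _); apply: eq_bigl => c.
  apply/andP/andP => [[/andP[/imsetP[x _ ->] _] cA]|[/imsetP[x _ ->] cA]].
    have xA : x \in A by apply: (fintype.subsetP cA); exact: porbit_id.
    by rewrite cA pl // imset_f.
  have xA : x \in A by apply: (fintype.subsetP cA); exact: porbit_id.
  by rewrite cA (fintype.subset_trans cA AB) -pl // imset_f.
apply/andP/andP => [[/andP[/imsetP[x _ ->] cB] cA]|[/imsetP[x _ ->] cA]].
  have xB : x \in B by apply: (fintype.subsetP cB); exact: porbit_id.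
  have xA : x \notin A by apply: contra cA => xA; rewrite pl // sl.
  have xBA : x \in B :\: A by rewrite inE xA.
  by rewrite pr // sr // imset_f.
have xBA : x \in B :\: A by apply: (fintype.subsetP cA); exact: porbit_id.
have xA : x \notin A by move: xBA; rewrite inE => /andP[].
rewrite -pr // imset_f //; split; last first.
  apply/negP => /fintype.subsetP/(_ x); rewrite porbit_id => /(_ isT); exact/negP.
by rewrite pr //= (fintype.subset_trans cA) // finset.subsetDl.
Qed.

Definition conn_sum u v A : R :=
  \sum_(s | perm_on A s) \sum_(t | perm_on A t) (conn s t A)%:R * (cycle_weight u A s * cycle_weight v A t).

Definition component (x : T) s t : {set T} := (\bigcap_(C : {set T} | (x \in C) && stab s t C) C)%SET.

Lemma component_in x s t : x \in component x s t.
Proof. by apply/bigcapP => C /andP[]. Qed.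

Lemma component_min x s t C : x \in C -> stab s t C -> component x s t \subset C.
Proof. by move=> xC sC; apply: finset.bigcap_inf; rewrite xC. Qed.

Lemma component_stab x s t : stab s t (component x s t).
Proof.
apply/stabP => y /bigcapP H; split; apply/bigcapP => C /[dup] HC /andP[_ /stabP sC];
  by have [] := sC y (H _ HC).
Qed.

Lemma stabD s t C D : stab s t C -> stab s t D -> stab s t (D :\: C).
Proof.
move=> /stabP sC /stabP sD.
have H (r : {perm T}) : (forall x, x \in C -> r x \in C) -> forall x, x \notin C -> r x \notin C.
  move=> rC x; apply: contra.
  have /stable1_normal/astabsP/(_ x) : stable1 r C by apply/forall_inP.
  by rewrite /= apermE => ->.
apply/stabP => x; rewrite !inE => /andP[xC xD]; have [-> ->] := sD x xD.
by rewrite !andbT; split; apply: H xC => y /sC[].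
Qed.

Lemma component_conn x s t : conn s t (component x s t).
Proof.
apply/connP; split=> [|C CA C0 sC]; first exact: component_stab.
apply/eqP; rewrite finset.eqEsubset CA /=; case: (boolP (x \in C)) => xC; first exact: component_min.
have := component_min (_ : x \in component x s t :\: C) (stabD sC (component_stab x s t)).
rewrite inE xC component_in => /(_ isT) H; case/set0Pn: C0 => y yC.
have := fintype.subsetP H y (fintype.subsetP CA y yC).
by rewrite inE yC.
Qed.

Lemma conn_component x s t A : x \in A -> conn s t A -> component x s t = A.
Proof.
move=> xA /connP[sA H]; apply: H; first exact: component_min.
  by apply/set0Pn; exists x; exact: component_in.
exact: component_stab.
Qed.

Lemma conn_split A B s1 s2 t1 t2 : perm_on A s1 -> perm_on A t1 ->
  perm_on (B :\: A) s2 -> perm_on (B :\: A) t2 ->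
  conn (s1 * s2)%g (t1 * t2)%g A = conn s1 t1 A.
Proof.
move=> s1A t1A s2B t2B.
have E r1 r2 x : perm_on A r1 -> perm_on (B :\: A) r2 -> x \in A -> (r1 * r2)%g x = r1 x.
  by move=> r1A r2B xA; rewrite permM (perm_on_notin r2B) // !inE (perm_on_in r1A).
have S C : C \subset A -> stab (s1 * s2)%g (t1 * t2)%g C = stab s1 t1 C.
  move=> CA; apply/stabP/stabP => H x xC; have xA := fintype.subsetP CA x xC;
    by have := H x xC; rewrite !E.
apply/connP/connP => -[sA H]; (split; first by rewrite ?S // -S //) => C CA C0 sC; apply: H => //.
  by rewrite S.
by rewrite -S.
Qed.

(** A pair of permutations of B is sorted according to the orbit A of the
    chosen point x under both: on A it is transitive, on the complement of A
    it is arbitrary. *)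
Theorem exponential_formula u v B x : x \in B ->
  perm_sum u B * perm_sum v B =
  \sum_(A : {set T} | (x \in A) && (A \subset B))
    conn_sum u v A * (perm_sum u (B :\: A) * perm_sum v (B :\: A)).
Proof.
move=> xB; rewrite /perm_sum big_distrlr pair_big_dep /=.
have compB s t : perm_on B s -> perm_on B t -> component x s t \subset B.
  move=> sB tB; apply: component_min => //; apply/stabP => y yB.
  by rewrite !(perm_on_in _ yB).
rewrite (partition_big (fun st : {perm T} * {perm T} => component x st.1 st.2)
  (fun A : {set T} => (x \in A) && (A \subset B))) /=; last first.
  by move=> [s t] /= /andP[sB tB]; rewrite component_in compB.
apply: eq_bigr => A /andP[xA AB].
transitivity (\sum_(s | perm_on B s && stable1 s A) \sum_(t | perm_on B t && stable1 t A)
   (conn s t A)%:R * (cycle_weight u B s * cycle_weight v B t)).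
  rewrite pair_big_dep /= [LHS]big_mkcond [RHS]big_mkcond; apply: eq_bigr => -[s t] _ /=.
  case: (boolP (perm_on B s)) => //= sB; case: (boolP (perm_on B t)) => tB; rewrite ?andbF //=.
  case: (boolP (conn s t A)) => [c|nc]; last first.
    rewrite mul0r if_same ifN //.
    by apply: contra nc => /eqP <-; exact: component_conn.
  rewrite (conn_component xA c) eqxx mul1r.
  have [/stabP sA _] := connP _ _ _ c.
  have s1 : stable1 s A by apply/forall_inP => y /sA[].
  have t1 : stable1 t A by apply/forall_inP => y /sA[].
  by rewrite s1 t1.
rewrite split_perm //.
rewrite /conn_sum.
transitivity (\sum_(s | perm_on A s) \sum_(s' | perm_on (B :\: A) s')
  \sum_(t | perm_on A t) \sum_(t' | perm_on (B :\: A) t')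
   ((conn s t A)%:R * (cycle_weight u A s * cycle_weight v A t)) * (cycle_weight u (B :\: A) s' * cycle_weight v (B :\: A) t')).
  apply: eq_bigr => s sA; apply: eq_bigr => s' sB; rewrite split_perm //; apply: eq_bigr => t tA; apply: eq_bigr => t' tB.
  rewrite (conn_split sA tA sB tB) (cycle_weight_split u AB sA sB) (cycle_weight_split v AB tA tB); ring.
rewrite big_distrlr /= big_distrl /=; apply: eq_bigr => s sA.
rewrite exchange_big /= big_distrl /=; apply: eq_bigr => t tA.
by rewrite big_distrr /=; apply: eq_bigr => s' sB; rewrite big_distrr.
Qed.

End ExpFormula.

Section CardOnly.
Variable T : finType.
Implicit Types (s t : {perm T}) (A B C : {set T}).

Lemma sum_subsets (R : comNzRingType) (x : T) B (F : nat -> R) n : x \in B -> #|B| = n.+1 ->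
  \sum_(A : {set T} | (x \in A) && (A \subset B)) F #|A| =
  \sum_(k < n.+1) 'C(n, k)%:R * F k.+1.
Proof.
move=> xB Bn; have Bn' : #|B :\ x| = n by move: Bn; rewrite (cardsD1 x) xB => -[].
rewrite (reindex_onto (fun A => x |: A) (fun A => A :\ x)) /=; last first.
  by move=> A /andP[xA _]; rewrite finset.setD1K.
transitivity (\sum_(A : {set T} | A \subset B :\ x) \sum_(k < n.+1 | #|A| == k) F k.+1).
  apply: eq_big => A.
    apply/andP/idP => [[/andP[_ AB] /eqP <-]|AB].
      by apply: finset.setSD.
    have xA : x \notin A by apply/negP => /(fintype.subsetP AB); rewrite !inE eqxx.
    rewrite !inE eqxx /= finset.setU1K // eqxx; split=> //.
    rewrite finset.subUset finset.sub1set xB /=.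
    exact: fintype.subset_trans AB (finset.subsetDl _ _).
  move=> /andP[/andP[_ AB] /eqP AE].
  have xA : x \notin A by rewrite -AE !inE eqxx.
  have An : (#|A| < n.+1)%N.
    rewrite ltnS -Bn'; apply: subset_leq_card; rewrite -AE; exact: finset.setSD.
  by rewrite cardsU1 xA (big_pred1 (Ordinal An)).
rewrite (exchange_big_dep predT) //=; apply: eq_bigr => k _.
have C : #|[set A : {set T} | A \subset B :\ x & #|A| == k]%SET| = 'C(n, k).
  by rewrite cards_draws Bn'.
rewrite sumr_const -C mulr_natl; congr (_ *+ _).
by apply: eq_card => A; rewrite !inE.
Qed.

(** Weights vanishing on all cycles but fixed points: only the identity
    survives, which reduces statements on pairs to statements on one
    permutation. *)
Definition delta1 (R : comNzRingType) (k : nat) : R := (k == 1)%:R.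

Lemma cycle_weight_delta1 (R : comNzRingType) B s : perm_on B s -> cycle_weight (delta1 R) B s = (s == 1%g)%:R.
Proof.
move=> sB; case: eqP => [->|/eqP s1].
  rewrite /cycle_weight big1 // => c /andP[/imsetP[x _ ->] _]; rewrite /delta1.
  have : porbit 1%g x \subset [set x]%SET.
    by apply: porbit_sub; [move=> y; rewrite perm1 | rewrite inE].
  by move=> /subset_leq_card; rewrite cards1; case: #|_| (card_porbit_neq0 1%g x) => [|[|]].
have [x sx] : exists x, s x != x.
  apply/existsP; apply: contraNT s1 => /existsPn H; apply/eqP/permP => x.
  by rewrite perm1; apply/eqP/negPn/H.
rewrite /cycle_weight (bigD1 (porbit s x)) /=; last first.
  rewrite imset_f //=; apply: porbit_sub => [y|]; first exact: perm_on_in.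
  by apply: contraNT sx => xB; rewrite (perm_on_notin sB).
rewrite /delta1 (_ : (_ == 1)%N = false) ?mul0r //; apply/negbTE/negP => /cards1P[y E].
have : x \in porbit s x by exact: porbit_id.
have : s x \in porbit s x by have := mem_porbit s 1 x; rewrite expg1.
by rewrite E !inE => /eqP sy /eqP xy; move: sx; rewrite sy -xy eqxx.
Qed.

Lemma perm_sum_delta1 (R : comNzRingType) B : perm_sum (delta1 R) B = 1.
Proof.
rewrite /perm_sum (bigD1 1%g) ?perm_on1 //= cycle_weight_delta1 ?perm_on1 // eqxx big1 ?addr0 //.
by move=> s /andP[sB s1]; rewrite cycle_weight_delta1 // (negPf s1).
Qed.

Definition ncycles A := #|[set s | perm_on A s & conn s 1%g A]%SET|.

Lemma conn_sum_delta1 (R : comNzRingType) (u : nat -> R) A x : x \in A ->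
  conn_sum u (delta1 R) A = u #|A| * (ncycles A)%:R.
Proof.
move=> xA; transitivity (\sum_(s | perm_on A s) (conn s 1%g A)%:R * cycle_weight u A s).
  apply: eq_bigr => s sA; rewrite (bigD1 1%g) ?perm_on1 //= cycle_weight_delta1 ?perm_on1 // eqxx mulr1.
  by rewrite big1 ?addr0 // => t /andP[tA t1]; rewrite cycle_weight_delta1 // (negPf t1) !mulr0.
transitivity (\sum_(s | perm_on A s && conn s 1%g A) u #|A|); last first.
  rewrite sumr_const mulr_natr; congr (_ *+ _).
  by apply: eq_card => s; rewrite !inE.
rewrite big_mkcondr /=; apply: eq_bigr => s sA; case: (boolP (conn _ _ _)) => [c|]; last by rewrite mul0r.
rewrite mul1r; have /connP[stA H] := c.
have P y : y \in A -> porbit s y = A.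
  move=> yA; apply: H.
  - by apply: porbit_sub => // z; apply: perm_on_in.
  - by apply/set0Pn; exists y; exact: porbit_id.
  - apply/stabP => z zp; rewrite perm1; split=> //.
    move: zp; rewrite -!eq_porbit_mem => /eqP <-.
    by have := porbit_perm s 1 z; rewrite expg1 => ->.
rewrite /cycle_weight (big_pred1 A) // => c'; apply/andP/eqP => [[/imsetP[y _ ->] cA]|->].
  by apply: P; apply: (fintype.subsetP cA); exact: porbit_id.
by rewrite -{1}(P x xA) imset_f.
Qed.

Lemma perm_sum1 B : perm_sum (fun=> 1) B = (#|B|)`!%:R :> int.
Proof.
rewrite /perm_sum (eq_bigr (fun=> 1)) => [|s _]; last by rewrite /cycle_weight big1.
by rewrite sumr_const card_perm.
Qed.

(** The exponential formula for all-one weights and [delta1] determines the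
    number of n-cycles recursively, and (n - 1)! solves the recursion. *)
Lemma card_ncycles A : A != finset.set0 -> ncycles A = (#|A|.-1)`!.
Proof.
have [n] := ubnP #|A|; elim: n A => // n IH A; rewrite ltnS => An A0.
have /set0Pn[x xA] := A0.
have [m Am] : exists m, #|A| = m.+1 by exists #|A|.-1; rewrite prednK // card_gt0.
have E := exponential_formula (fun=> 1 : int) (delta1 int) xA.
have {}E : (m.+1`!)%:R = \sum_(B : {set T} | (x \in B) && (B \subset A))
    (ncycles B)%:R * ((m.+1 - #|B|)`!)%:R :> int.
  rewrite -Am -perm_sum1 -[LHS]mulr1 -{1}(perm_sum_delta1 int A) E; apply: eq_bigr => B /andP[xB BA].
  by rewrite (conn_sum_delta1 _ xB) perm_sum_delta1 mulr1 mul1r perm_sum1 cardsDS.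
have F : (m.+1`!)%:R = \sum_(B : {set T} | (x \in B) && (B \subset A))
    ((#|B|.-1)`!)%:R * ((m.+1 - #|B|)`!)%:R :> int.
  rewrite (@sum_subsets _ x A (fun k => (k.-1`!)%:R * ((m.+1 - k)`!)%:R) m) //.
  rewrite (eq_bigr (fun=> m`!%:R)) => [|k _]; last first.
    rewrite subSS /= -!natrM; congr _%:R.
    by rewrite bin_fact // -ltnS.
  by rewrite sumr_const card_ord -mulrnA factS mulnC.
have AA : (x \in A) && (A \subset A) by rewrite xA fintype.subxx.
rewrite (bigD1 A AA) /= Am subnn fact0 mulr1 in E.
rewrite (bigD1 A AA) /= Am subnn fact0 mulr1 in F.
have G : \sum_(B : {set T} | (x \in B) && (B \subset A) && (B != A))
      (ncycles B)%:R * ((m.+1 - #|B|)`!)%:R =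
    \sum_(B : {set T} | (x \in B) && (B \subset A) && (B != A))
      ((#|B|.-1)`!)%:R * ((m.+1 - #|B|)`!)%:R :> int.
  apply: eq_bigr => B /andP[/andP[xB BA] BnA].
  rewrite IH //; last by apply/set0Pn; exists x.
  by apply: leq_trans An; apply: proper_card; rewrite finset.properEneq BnA.
rewrite G F in E; move: E => /addIr/esym.
by move=> /eqP; rewrite eqr_nat Am => /eqP.
Qed.

End CardOnly.

Section Series.
Variable R : comNzRingType.
Implicit Types u v : nat -> R.

(** The value of [perm_sum] on sets of n elements, by the recursion that
    singles out the cycle of one point. *)
Definition perm_seq u : nat -> R :=
  srec (fun w n => if n is m.+1
    then \sum_(k < n) ('C(m, k) * k`!)%:R * (u k.+1 * w (m - k)%N) else 1).

Lemma perm_seq0 u : perm_seq u 0%N = 1. Proof. by []. Qed.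

Lemma perm_seqS u m : perm_seq u m.+1 =
  \sum_(k < m.+1) ('C(m, k) * k`!)%:R * (u k.+1 * perm_seq u (m - k)%N).
Proof.
rewrite {1}/perm_seq srecE // => f g fg; apply: eq_bigr => k _.
by rewrite fg // ltnS leq_subr.
Qed.

Lemma perm_sum_perm_seq (T : finType) u (B : {set T}) : perm_sum u B = perm_seq u #|B|.
Proof.
have [n] := ubnP #|B|; elim: n B => // n IH B; rewrite ltnS => Bn.
case: (finset.set_0Vmem B) => [->|[x xB]].
  rewrite cards0 /perm_sum (big_pred1 1%g) => [|s].
    rewrite /cycle_weight big_pred0 // => c; apply/andP => -[/imsetP[x _ ->]].
    by rewrite finset.subset0 => /eqP/setP/(_ x); rewrite porbit_id inE.
  apply/idP/eqP => [sB|->]; last exact: perm_on1.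
  by apply/permP => x; rewrite perm1 (perm_on_notin sB) ?inE.
have [m Bm] : exists m, #|B| = m.+1.
  by exists #|B|.-1; rewrite prednK // card_gt0; apply/set0Pn; exists x.
have := exponential_formula u (delta1 R) xB; rewrite perm_sum_delta1 mulr1 => ->.
pose F k := (k.-1`!)%:R * (u k * perm_seq u (m.+1 - k)%N).
rewrite Bm perm_seqS; transitivity (\sum_(A : {set T} | (x \in A) && (A \subset B)) F #|A|).
  rewrite /F; apply: eq_bigr => A /andP[xA AB]; rewrite (conn_sum_delta1 _ xA) perm_sum_delta1 mulr1 IH; last first.
    by apply: leq_trans Bn; rewrite cardsDS // Bm ltn_subrL card_gt0 andbT; apply/set0Pn; exists x.
  rewrite cardsDS // Bm card_ncycles; last by apply/set0Pn; exists x.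
  by ring.
by rewrite (sum_subsets F xB Bm); apply: eq_bigr => k _; rewrite natrM -mulrA /F subSS.
Qed.

(** The value of [conn_sum] on non-empty sets of n elements: the exponential
    formula [conn_seqP] solved for the term of the whole set. *)
Definition conn_seq u v : nat -> R :=
  srec (fun z n => if n is m.+1 then perm_seq u n * perm_seq v n -
    \sum_(k < m) 'C(m, k)%:R * (z k.+1 * (perm_seq u (m - k)%N * perm_seq v (m - k)%N)) else 0).

Lemma conn_seqP u v m : perm_seq u m.+1 * perm_seq v m.+1 =
  \sum_(k < m.+1) 'C(m, k)%:R * (conn_seq u v k.+1 * (perm_seq u (m - k)%N * perm_seq v (m - k)%N)).
Proof.
have E : conn_seq u v m.+1 = perm_seq u m.+1 * perm_seq v m.+1 -
    \sum_(k < m) 'C(m, k)%:R * (conn_seq u v k.+1 * (perm_seq u (m - k)%N * perm_seq v (m - k)%N)).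
  rewrite {1}/conn_seq srecE // => f g fg; congr (_ - _); apply: eq_bigr => k _.
  by rewrite fg // ltnS.
rewrite big_ord_recr /= subnn !perm_seq0 binn !mulr1 mul1r E.
by rewrite [RHS]addrC subrK.
Qed.

Lemma conn_sum_conn_seq (T : finType) u v (A : {set T}) : A != finset.set0 -> conn_sum u v A = conn_seq u v #|A|.
Proof.
have [n] := ubnP #|A|; elim: n A => // n IH A; rewrite ltnS => An A0.
have /set0Pn[x xA] := A0.
have [m Am] : exists m, #|A| = m.+1 by exists #|A|.-1; rewrite prednK // card_gt0.
have E := exponential_formula u v xA; rewrite !perm_sum_perm_seq Am conn_seqP in E.
pose F k := conn_seq u v k * (perm_seq u (m.+1 - k)%N * perm_seq v (m.+1 - k)%N).
rewrite (_ : \sum_(k < m.+1) _ = \sum_(k < m.+1) 'C(m, k)%:R * F k.+1) // in E.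
rewrite -(sum_subsets F xA Am) in E.
have AA : (x \in A) && (A \subset A) by rewrite xA fintype.subxx.
rewrite (bigD1 A AA) [RHS](bigD1 A AA) /= /F Am subnn !perm_sum_perm_seq cardsDS // subnn !perm_seq0 !mulr1 in E.
have G : \sum_(B : {set T} | (x \in B) && (B \subset A) && (B != A))
      conn_seq u v #|B| * (perm_seq u (m.+1 - #|B|)%N * perm_seq v (m.+1 - #|B|)%N) =
    \sum_(B : {set T} | (x \in B) && (B \subset A) && (B != A))
      conn_sum u v B * (perm_sum u (A :\: B) * perm_sum v (A :\: B)).
  apply: eq_bigr => B /andP[/andP[xB BA] BnA]; rewrite !perm_sum_perm_seq cardsDS // Am IH //.
    by apply: leq_trans An; apply: proper_card; rewrite finset.properEneq BnA.
  by apply/set0Pn; exists x.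
by rewrite G in E; move: E => /addIr/esym ->; rewrite Am.
Qed.
End Series.

(** * Moments with cumulants independent of the degree *)

Section AnnularAsymptotics.
Variables (R : realType) (r : nat -> R).

Lemma expands_bigsum (I : Type) (s : seq I) (a : nat -> I -> R) (a0 a1 : I -> R) :
  (forall i, expands (a^~ i) (a0 i) (a1 i)) ->
  expands (fun d => \sum_(i <- s) a d i) (\sum_(i <- s) a0 i) (\sum_(i <- s) a1 i).
Proof.
move=> H; elim: s => [|i s IH].
  rewrite !big_nil (_ : (fun d => _) = fun=> 0); first exact: expands_cst.
  by apply/funext => d; rewrite big_nil.
rewrite !big_cons (_ : (fun d => _) = fun d => a d i + \sum_(j <- s) a d j).
  exact: expandsD.
by apply/funext => d; rewrite big_cons.
Qed.

Lemma expands_epsX k : expands (fun d => d%:R^-1 ^+ k : R) (k == 0)%:R (k == 1)%:R.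
Proof.
elim: k => [|k IH]; first exact: expands_cst.
rewrite (_ : (fun d => _) = fun d : nat => (d%:R^-1 : R) * d%:R^-1 ^+ k); last first.
  by apply/funext => d; rewrite exprS.
have := expandsM (@expands_eps R) IH; rewrite !mul0r mul1r add0r.
by case: k {IH}.
Qed.

Section FixedDegree.
Variable d : nat.
Hypothesis d0 : (0 < d)%N.
Let dn : d%:R != 0 :> R. Proof. by rewrite pnatr_eq0 -lt0n. Qed.

(** With these weights sum_n perm_seq n t^n / n! is exp (- d sum_k r_k t^k /
    k), whose logarithmic derivative has the coefficients - d r_k. *)
Definition cumulant_weight (k : nat) : R := - d%:R * r k.

(** The exponential series of the weights is exp (d log (1 + t)) = (1 + t)^d,
    hence [perm_seq_rfall]. *)
Definition falling_weight (k : nat) : R := (-1) ^+ k.-1 * d%:R.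

Lemma perm_seq_rfall n : perm_seq falling_weight n = rfall d%:R n.
Proof.
elim: n => [|n IH]; first by rewrite /rfall big_ord0.
rewrite rfallS -IH; case: n {IH} => [|n].
  by rewrite perm_seqS big_ord1 /falling_weight perm_seq0 expr0 subr0 mul1r !mul1r mulr1.
rewrite perm_seqS big_ord_recl [in RHS]mulrBr mulrC; congr (_ + _).
  by rewrite bin0 fact0 /falling_weight /= expr0; ring.
rewrite perm_seqS mulr_suml -sumrN; apply: eq_bigr => k _.
rewrite !lift0 subSS /falling_weight /= exprS factS.
have -> : ('C(n.+1, k.+1) * (k.+1 * k`!) = n.+1 * ('C(n, k) * k`!))%N.
  by rewrite mulnA -[('C(_, _) * _)%N]mulnC -mul_bin_diag mulnA.
by rewrite natrM; ring.
Qed.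

(** The moments of the formal polynomial of degree d whose finite free
    cumulants are r_1, r_2, ..., see [const_momentE]. Newton's identity
    expresses them through the logarithmic derivative of sum_n (perm_seq n)
    (rfall n) (t / d)^n / n!, which by the exponential formula is a sum over
    transitive pairs. *)
Definition const_moment : ser R := fun n =>
  if n is k.+1 then - conn_seq cumulant_weight falling_weight n / (k`!%:R * d%:R ^+ n.+1) else 1.

Let P : ser R := fun k => perm_seq cumulant_weight k / (k`!%:R * d%:R ^+ k).

Let f0 k : k`!%:R != 0 :> R. Proof. by rewrite pnatr_eq0 -lt0n fact_gt0. Qed.

Lemma const_momentE n : const_moment n = (n == 0)%:R +
  \sum_(j < n) r j.+1 * twisted_pow d%:R (sw R * const_moment) j.+1 n.
Proof.
apply: (@moment_finite_cumulant R d%:R dn P r const_moment) => //.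
- by rewrite /P perm_seq0 fact0 expr0 mulr1 invr1 mulr1.
- case=> [|k]; first by rewrite mul0r big_ord0 oppr0.
  rewrite /P perm_seqS mulr_suml mulr_sumr -sumrN; apply: eq_bigr => j _.
  rewrite subSS factS natrM /cumulant_weight.
  have jk : (j <= k)%N by rewrite -ltnS.
  rewrite -(bin_fact jk) !natrM.
  have -> : d%:R ^+ k.+1 = d%:R * d%:R ^+ j * d%:R ^+ (k - j) :> R.
    by rewrite exprS -mulrA -exprD subnKC.
  have b0 : 'C(k, j)%:R != 0 :> R by rewrite pnatr_eq0 -lt0n bin_gt0.
  have k1 : 1 + k%:R != 0 :> R by rewrite nat1r pnatr_eq0.
  rewrite exprVn; field.
  by rewrite !expf_neq0 // !f0 ?b0 ?dn ?k1 /=.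
apply/funext => -[|k].
  by rewrite /stheta mul0r soppE smulCE smul0E saddE soppE s1E /= subrr mul0r mulr0 oppr0.
rewrite soppE smulCE smulE big_ord_recl /= saddE soppE s1E subrr mul0r add0r.
have -> : stheta (fun i => rfall d%:R i * P i) k.+1 =
    (k.+1%:R / ((k.+1)`!%:R * d%:R ^+ k.+1)) * (perm_seq cumulant_weight k.+1 * perm_seq falling_weight k.+1).
  by rewrite /stheta -perm_seq_rfall /P; ring.
rewrite conn_seqP !mulr_sumr -sumrN.
apply: eq_bigr => j _; rewrite saddE soppE s1E /= subr0 /bump /= add1n subSS -perm_seq_rfall.
have jk : (j <= k)%N by rewrite -ltnS.
rewrite factS natrM -(bin_fact jk) !natrM.
have -> : d%:R ^+ k.+1 = d%:R * d%:R ^+ j * d%:R ^+ (k - j) :> R.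
  by rewrite exprS -mulrA -exprD subnKC.
have b0 : 'C(k, j)%:R != 0 :> R by rewrite pnatr_eq0 -lt0n bin_gt0.
have k1 : 1 + k%:R != 0 :> R by rewrite nat1r pnatr_eq0.
rewrite /P /const_moment !exprS; field.
by rewrite !expf_neq0 // !f0 ?b0 ?dn ?k1 /=.
Qed.

Lemma sum_card_porbits (T : finType) (s : {perm T}) : (\sum_(c in porbits s) #|c| = #|T|)%N.
Proof.
rewrite -sum1_card (partition_big (porbit s) (fun c => c \in porbits s)); last first.
  by move=> x _; exact: imset_f.
apply: eq_bigr => c /imsetP[x _ ->]; rewrite sum1_card; apply: eq_card => y.
by rewrite [RHS]unfold_in -eq_porbit_mem.
Qed.

Lemma cycle_weight_cumulant n (s : 'S_n) : cycle_weight cumulant_weight [set: 'I_n] s =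
  (- d%:R) ^+ #|porbits s| * cycle_prod r s.
Proof.
rewrite /cycle_weight (eq_bigl (fun c => c \in porbits s)) => [|c]; last by rewrite finset.subsetT andbT.
by rewrite big_split /= prodr_const.
Qed.

Lemma cycle_weight_falling n (s : 'S_n) : cycle_weight falling_weight [set: 'I_n] s =
  (-1) ^+ (n + #|porbits s|) * d%:R ^+ #|porbits s|.
Proof.
rewrite /cycle_weight (eq_bigl (fun c => c \in porbits s)) => [|c]; last by rewrite finset.subsetT andbT.
rewrite big_split /= prodr_const; congr (_ * _).
transitivity (\prod_(c in porbits s) ((-1) ^+ #|c| * (-1)) : R); last first.
  by rewrite big_split /= prodr_const prodrXr sum_card_porbits card_ord exprD.
apply: eq_bigr => _ /imsetP[x _ ->]; case: #|_| (card_porbit_neq0 s x) => // k _.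
by rewrite exprS /=; ring.
Qed.

(** The expansion in 1/d is by the number of cycles. By the genus bound the
    exponent is at least 0, so that the truncated subtraction is a true
    difference. *)
Lemma const_moment_sum k : const_moment k.+1 = \sum_(st : 'S_k.+1 * 'S_k.+1)
   (conn st.1 st.2 [set: 'I_k.+1])%:R * (-1) ^+ (k + (#|porbits st.1| + #|porbits st.2|)) *
   cycle_prod r st.1 / k`!%:R * d%:R^-1 ^+ (k.+2 - (#|porbits st.1| + #|porbits st.2|)).
Proof.
have zE : conn_seq cumulant_weight falling_weight k.+1 = conn_sum cumulant_weight falling_weight [set: 'I_k.+1].
  rewrite conn_sum_conn_seq ?cardsT ?card_ord //.
  by apply/set0Pn; exists ord0.
rewrite /const_moment zE /conn_sum mulNr mulr_suml -sumrN -(pair_bigA _ (fun s t =>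
   (conn s t [set: 'I_k.+1])%:R * (-1) ^+ (k + (#|porbits s| + #|porbits t|)) *
   cycle_prod r s / k`!%:R * d%:R^-1 ^+ (k.+2 - (#|porbits s| + #|porbits t|)))) /=.
have pT (s : 'S_k.+1) : perm_on [set: 'I_k.+1] s.
  by apply/fintype.subsetP => x _; rewrite inE.
apply: eq_big => [s|s _]; first exact: pT.
rewrite mulr_suml -sumrN.
apply: eq_big => [t|t _]; first exact: pT.
rewrite cycle_weight_cumulant cycle_weight_falling.
case: (boolP (conn _ _ _)) => [c|_]; last by rewrite !mul0r oppr0.
rewrite !mul1r; have := genus_bound c; have := porbits_gt0 (s * t)%g ord0.
set p := #|porbits s|; set q := #|porbits t|; rewrite card_ord => p0 pq.
have le : (p + q <= k.+2)%N by lia.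
have -> : d%:R ^+ k.+2 = d%:R ^+ p * d%:R ^+ q * d%:R ^+ (k.+2 - (p + q)) :> R.
  by rewrite -!exprD subnKC.
have -> : (-1) ^+ (k.+1 + q) = - ((-1) ^+ k * (-1) ^+ q) :> R.
  by rewrite exprD exprS mulN1r mulNr.
have -> : (-1) ^+ (k + (p + q)) = (-1) ^+ k * ((-1) ^+ p * (-1) ^+ q) :> R by rewrite !exprD.
rewrite exprVn [(- d%:R) ^+ p]exprNn.
have x0 : d%:R ^+ p != 0 :> R by rewrite expf_neq0.
have y0 : d%:R ^+ q != 0 :> R by rewrite expf_neq0.
have z0 : d%:R ^+ (k.+2 - (p + q)) != 0 :> R by rewrite expf_neq0.
have := f0 k; move: x0 y0 z0; move: (d%:R ^+ p) (d%:R ^+ q) (d%:R ^+ (k.+2 - (p + q))) (k`!%:R).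
move: ((-1) ^+ k) ((-1) ^+ p) ((-1) ^+ q) (cycle_prod r s) => a b e g x y z f x0 y0 z0 fn0.
by field; rewrite x0 y0 z0 fn0.
Qed.
End FixedDegree.

(** For a transitive pair with n = k + 1 cycles in total, the product of the
    two permutations is forced to have two cycles ([planar_two_cycles]). *)
Definition annular_pairs k : R := \sum_(st : 'S_k.+1 * 'S_k.+1 |
    conn st.1 st.2 [set: 'I_k.+1] && (#|porbits st.1| + #|porbits st.2| == k.+1)%N)
  cycle_prod r st.1.

(** In [const_moment_sum] the exponent of 1/d is 1 exactly when the pair has k
    + 1 cycles in total, and the sign is then negative. *)
Lemma const_moment_expansion k : exists a0,
  expands (fun d => const_moment d k.+1) a0 (- (annular_pairs k / k`!%:R)).
Proof.
pose e (st : 'S_k.+1 * 'S_k.+1) := (#|porbits st.1| + #|porbits st.2|)%N.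
pose c (st : 'S_k.+1 * 'S_k.+1) : R :=
  (conn st.1 st.2 [set: 'I_k.+1])%:R * (-1) ^+ (k + e st) * cycle_prod r st.1 / k`!%:R.
have H st := expandsM (expands_cst (c st)) (@expands_epsX (k.+2 - e st)%N).
have := @expands_bigsum _ (index_enum _) (fun d st => c st * d%:R^-1 ^+ (k.+2 - e st)) _ _ H.
set a0 := (X in expands _ X _) => Ha.
exists a0; rewrite /annular_pairs; set a1 := (X in expands _ _ X) in Ha.
suff -> : - (annular_pairs k / k`!%:R) = a1.
  apply: expands_near Ha; apply: filterS pos_near => d dn.
  by rewrite const_moment_sum.
rewrite /annular_pairs big_mkcond /= mulr_suml -sumrN /a1; apply: eq_bigr => st _.
rewrite mul0r addr0 /c; case: (boolP (conn _ _ _)) => [C|_]; last by rewrite !mul0r oppr0.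
rewrite mul1r /= -/(e st); case: (eqVneq (e st) k.+1) => [->|ne].
  rewrite subSnn eqxx mulr1 addnS addnn exprS -signr_odd odd_double expr0; ring.
by rewrite (_ : (k.+2 - e st == 1)%N = false) ?mulr0 ?mul0r ?oppr0 //; lia.
Qed.

(** The first-order term m1 of the moments for constant cumulants is known in
    two ways: combinatorially, and from [first_order_eq] with s = 0, by which
    [finite_solve] gives w m1 = - Dq / (2 q). *)
Lemma annular_series_pairs (phi : ser R) : phi 0%N = 1 -> (forall k, phi k.+1 = r k.+1) ->
  let m0 := momser phi in
  forall n, hser m0 phi n.+2 = (annular_pairs n / n`!%:R) *+ 2.
Proof.
move=> phi0 phir m0 n; have m0E : m0 = scomp phi (sw R * m0) by exact: momserE.
pose kap (d : nat) : ser R := r.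
have mE d k : (0 < d)%N -> const_moment d k =
  (k == 0)%:R + \sum_(j < k) kap d j.+1 * twisted_pow d%:R (sw R * const_moment d) j.+1 k.
  by move=> d0; exact: const_momentE.
have Hk k : expands (fun d => kap d k.+1) (phi k.+1) ((0 : ser R) k.+1).
  by rewrite phir; exact: expands_cst.
have [m1 Hm] := moment_expansion mE phi0 m0E Hk.
have := first_order_eq mE phi0 m0E erefl Hk Hm => /= E.
have {}E := finite_solve m0E E.
have q0 : qser m0 phi 0%N != 0 by rewrite qser0 ?oner_neq0 // m0E scomp_eq0 // smulwE.
have m00 : m0 0%N = 1 by rewrite m0E scomp_eq0 ?smulwE.
have {}E : (sw R * m1) *+ 2 = - hser m0 phi.
  have Eq := ser_mulVr q0; rewrite /hser.
  set iq : ser R := fps_inv _ in Eq *; set q := qser m0 phi in E Eq *.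
  apply: (@cauchy_mulIr R m0) => //; set G := sw R * m0 in E *.
  transitivity ((sw R * m1 * G * q) *+ 2 * iq).
    by transitivity ((sw R * m1 * G * (q * iq)) *+ 2); [rewrite Eq mulr1; ring | ring].
  rewrite E (_ : scomp 0 G = 0); first by ring.
  by apply/funext => k; rewrite /scomp big1 // => i _; exact: mul0r.
have [a0 Ha] := const_moment_expansion n.
have a0E : a0 = m0 n.+1.
  exact: (cvg_unique _ (expands_cvg Ha) (expands_cvg (Hm n.+1))).
rewrite a0E in Ha; have m1E := expands_uniq (Hm n.+1) Ha.
have := congr1 (fun f : ser R => f n.+2) E; rewrite smulnE smulwE soppE m1E => H.
by apply: oppr_inj; rewrite -H mulNrn.
Qed.

End AnnularAsymptotics.

(** * Annular non-crossing permutations and relabelling *)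

Section Conjugation.
Variable T : finType.
Implicit Types (s t f g gamma sigma : {perm T}) (C : {set T}).

Lemma porbitJ s f x : porbit (s ^ f)%g (f x) = f @: porbit s x.
Proof.
have E i : ((s ^ f) ^+ i)%g (f x) = f ((s ^+ i)%g x) by rewrite -conjXg permJ.
apply/setP => y; apply/porbitP/imsetP => [[i ->]|[z /porbitP[i ->] ->]].
  by exists ((s ^+ i)%g x); rewrite ?mem_porbit.
by exists i.
Qed.

Lemma porbitsJ s f : porbits (s ^ f)%g = (fun c : {set T} => f @: c) @: porbits s.
Proof.
apply/setP => c; apply/imsetP/imsetP => [[x _ ->]|[_ /imsetP[x _ ->] ->]].
  exists (porbit s (f^-1 x)%g); first exact: imset_f.
  by rewrite -porbitJ permKV.
by exists (f x); rewrite ?porbitJ.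
Qed.

Lemma imset_perm_inj f : injective (fun c : {set T} => f @: c).
Proof. exact/imset_inj/perm_inj. Qed.

Lemma card_porbitsJ s f : #|porbits (s ^ f)%g| = #|porbits s|.
Proof. by rewrite porbitsJ card_imset //; exact: imset_perm_inj. Qed.

Lemma stabJ s t f C : stab s t C -> stab (s ^ f)%g (t ^ f)%g (f @: C).
Proof.
move=> /stabP sC; apply/stabP => _ /imsetP[x xC ->]; rewrite !permJ.
by have [sx tx] := sC x xC; split; apply: imset_f.
Qed.

Lemma conn_setTJ s t f : conn s t [set: T] -> conn (s ^ f)%g (t ^ f)%g [set: T].
Proof.
move=> /connP[_ H]; apply/connP; split=> [|C _ C0 sC]; first by apply/stabP => x; rewrite !inE.
have := stabJ f^-1%g sC; rewrite !conjgK => sD.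
have cD : #|f^-1%g @: C| = #|C| by rewrite card_imset //; exact: perm_inj.
have D0 : f^-1%g @: C != finset.set0 by rewrite -card_gt0 cD card_gt0.
have DT := H _ (finset.subsetT _) D0 sD.
by apply/eqP; rewrite eqEcard finset.subsetT -cD DT /=.
Qed.

Lemma conn_setT_conj s t f : conn (s ^ f)%g (t ^ f)%g [set: T] = conn s t [set: T].
Proof.
apply/idP/idP; last exact: conn_setTJ.
by move=> /(conn_setTJ f^-1%g); rewrite !conjgK.
Qed.

Variables (R : realType) (r : nat -> R).

Definition cycle_prodT s : R := \prod_(c in porbits s) r #|c|.

Lemma cycle_prodTJ s f : cycle_prodT (s ^ f)%g = cycle_prodT s.
Proof.
rewrite /cycle_prodT porbitsJ big_imset /=; last by move=> c c' _ _; exact: imset_perm_inj.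
by apply: eq_bigr => c _; rewrite card_imset //; exact: perm_inj.
Qed.

Definition planar_cond gamma sigma := conn sigma (sigma^-1 * gamma)%g [set: T] &&
  (#|porbits sigma| + #|porbits (sigma^-1 * gamma)%g| == #|T|)%N.

(** For gamma with two cycles this is the sum over annular non-crossing
    permutations; it depends on the conjugacy class of gamma only. *)
Definition annular_sum gamma : R := \sum_(sigma | planar_cond gamma sigma) cycle_prodT sigma.

Lemma annular_sumJ gamma f : annular_sum (gamma ^ f)%g = annular_sum gamma.
Proof.
rewrite /annular_sum (reindex_inj (@conjg_inj _ f)); apply: eq_big => s; last by rewrite cycle_prodTJ.
by rewrite /planar_cond -conjVg -conjMg conn_setT_conj !card_porbitsJ.
Qed.

(** The genus bound leaves one or two cycles, and the sign of gamma = sigma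
    (sigma^-1 gamma) excludes one. *)
Lemma planar_two_cycles gamma sigma (x : T) : planar_cond gamma sigma -> #|porbits gamma| = 2%N.
Proof.
move=> /andP[c /eqP e]; have := genus_bound c; rewrite mulKVg => le.
have g0 := porbits_gt0 gamma x.
have : odd_perm gamma = odd_perm sigma (+) odd_perm (sigma^-1 * gamma)%g.
  by rewrite -odd_permM mulKVg.
rewrite /odd_perm -[in RHS]e oddD.
move: le g0; rewrite -addnA e addnC leq_add2l.
case: #|porbits gamma| => [|[|[|k]]] //= _ _.
rewrite -e oddD; by case: (odd _); case: (odd _).
Qed.

Lemma stab_mulKV sigma gamma C : stab sigma gamma C -> stab sigma (sigma^-1 * gamma)%g C.
Proof.
move=> /stabP sC; apply/stabP => x xC; have [sx gx] := sC x xC; split=> //.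
have sN : stable1 sigma C by apply/forall_inP => y /sC[].
have gN : stable1 gamma C by apply/forall_inP => y /sC[].
have : (sigma^-1 * gamma)%g \in 'N(C | 'P)%g by rewrite groupM ?groupV ?stable1_normal.
by move=> /astabsP/(_ x); rewrite /= apermE => ->.
Qed.

(** The group generated by sigma and gamma is also generated by sigma and
    sigma^-1 gamma. *)
Lemma transitive_conn sigma gamma (x0 : T) :
  [transitive <<[set sigma; gamma]>>, on [set: T] | 'P]%g = conn sigma (sigma^-1 * gamma)%g [set: T].
Proof.
apply/idP/connP => [tr|[_ H]].
  split=> [|C _ C0 sC]; first by apply/stabP => x; rewrite !inE.
  have sC' : stab sigma gamma C.
    apply/stabP => x /(stabP _ _ _ sC)[sx _]; split=> //.
    rewrite -[gamma](mulKVg sigma) permM.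
    by have [] := stabP _ _ _ sC _ sx.
  have GN : (<<[set sigma; gamma]>> \subset 'N(C | 'P))%g.
    rewrite gen_subG; apply/fintype.subsetP => g /set2P[] ->.
      by apply: stable1_normal; apply/forall_inP => y /(stabP _ _ _ sC')[].
    by apply: stable1_normal; apply/forall_inP => y /(stabP _ _ _ sC')[].
  case/set0Pn: C0 => y yC; apply/eqP; rewrite finset.eqEsubset finset.subsetT /=.
  rewrite -(atransP tr y) ?inE //; apply/fintype.subsetP => _ /imsetP[g gG ->].
  by rewrite (astabsP (fintype.subsetP GN g gG)).
apply/imsetP; exists x0; rewrite ?inE //; apply/esym; apply: H; first exact: finset.subsetT.
  by apply/set0Pn; exists x0; exact: orbit_refl.
apply: stab_mulKV; apply/stabP => y yO.
have K h : h \in <<[set sigma; gamma]>>%g ->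
    h y \in orbit 'P <<[set sigma; gamma]>>%g x0.
  case/imsetP: yO => g gG -> hG; apply/imsetP; exists (g * h)%g; first exact: groupM.
  by rewrite /= /aperm permM.
by split; apply: K; apply: mem_gen; rewrite !inE eqxx ?orbT.
Qed.

(** A cycle of length l contributes l times 1 / l. *)
Lemma sum_inv_porbit gamma : \sum_(x : T) (#|porbit gamma x|%:R)^-1 = #|porbits gamma|%:R :> R.
Proof.
rewrite (partition_big (porbit gamma) (fun c => c \in porbits gamma)); last first.
  by move=> x _; exact: imset_f.
rewrite -sum1_card natr_sum; apply: eq_bigr => c /imsetP[x _ ->].
rewrite (eq_bigr (fun=> (#|porbit gamma x|%:R)^-1)) => [|y /andP[_ /eqP ->] //].
rewrite sumr_const (_ : #|_| = #|porbit gamma x|); last first.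
  by apply: eq_card => y; rewrite [LHS]unfold_in -eq_porbit_mem.
by rewrite -[LHS]mulr_natr mulVf // pnatr_eq0 card_porbit_neq0.
Qed.
End Conjugation.

Section TwoCycle.
Variables (t s : nat).
Hypotheses (t0 : (0 < t)%N) (s0 : (0 < s)%N).
Local Notation I := ('I_(t + s)).
Implicit Types (f g gamma : {perm I}).
Let gts : {perm I} := two_cycle t s.
Let i0 : I := lshift s (Ordinal t0).
Let i1 : I := rshift t (Ordinal s0).

Lemma two_cycle_l (j : 'I_t) : gts (lshift s j) = lshift s (ordS j).
Proof. by rewrite permE /two_cycle_fun -[lshift s j]/(unsplit (inl j)) unsplitK. Qed.

Lemma two_cycle_r (j : 'I_s) : gts (rshift t j) = rshift t (ordS j).
Proof. by rewrite permE /two_cycle_fun -[rshift t j]/(unsplit (inr j)) unsplitK. Qed.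

Lemma two_cycle_iter_l j (jt : (j < t)%N) : (gts ^+ j)%g i0 = lshift s (Ordinal jt).
Proof.
elim: j jt => [|j IH] jt; first by rewrite expg0 perm1; congr (lshift _ _); apply: val_inj.
rewrite expgSr permM (IH (ltnW jt)) two_cycle_l; congr (lshift _ _); apply: val_inj => /=.
by rewrite modn_small.
Qed.

Lemma two_cycle_iter_r j (js : (j < s)%N) : (gts ^+ j)%g i1 = rshift t (Ordinal js).
Proof.
elim: j js => [|j IH] js; first by rewrite expg0 perm1; congr (rshift _ _); apply: val_inj.
rewrite expgSr permM (IH (ltnW js)) two_cycle_r; congr (rshift _ _); apply: val_inj => /=.
by rewrite modn_small.
Qed.

Lemma porbit_two_cycle : porbit gts i0 = [set lshift s j | j : 'I_t]%SET.
Proof.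
apply/eqP; rewrite finset.eqEsubset; apply/andP; split.
  apply: porbit_sub => [_ /imsetP[j _ ->]|]; last exact: imset_f.
  by rewrite two_cycle_l imset_f.
apply/fintype.subsetP => _ /imsetP[[j jt] _ ->]; apply/porbitP; exists j.
by rewrite two_cycle_iter_l.
Qed.

(** A cycle of length t with a base point, and a base point on the remaining
    points; for gamma with two cycles these are the images of the first points
    of the two standard cycles under a relabelling. *)
Definition pointed gamma : {set I * I} :=
  [set xy | (#|porbit gamma xy.1| == t) && (xy.2 \notin porbit gamma xy.1)]%SET.

Lemma iterP f gamma i j : (gts ^ f)%g = gamma -> f ((gts ^+ j)%g i) = (gamma ^+ j)%g (f i).
Proof. by move=> <-; rewrite -conjXg permJ. Qed.

(** A permutation conjugating the standard one to gamma is determined by the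
    images of the first points of the two cycles, and every choice on distinct
    cycles of the right lengths occurs. *)
Lemma card_conjugators gamma : #|porbits gamma| = 2%N ->
  #|[set f : {perm I} | (gts ^ f)%g == gamma]%SET| = #|pointed gamma|.
Proof.
move=> g2; pose Phi f := (f i0, f i1).
have injP : {in [set f : {perm I} | (gts ^ f)%g == gamma]%SET &, injective Phi}.
  move=> f g; rewrite !inE => /eqP fE /eqP gE [e0 e1]; apply/permP => i.
  case: (split_ordP i) => -[j jt] ->.
    by rewrite -two_cycle_iter_l (iterP _ _ fE) (iterP _ _ gE) e0.
  by rewrite -two_cycle_iter_r (iterP _ _ fE) (iterP _ _ gE) e1.
rewrite -(card_in_imset injP); congr #|pred_of_set _|; apply/setP => -[x0 x1]; rewrite inE /=.
apply/imsetP/andP => [[f]|[/eqP ct nx]].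
  rewrite inE => /eqP <- [-> ->]; rewrite porbitJ porbit_two_cycle.
  rewrite card_imset ?card_imset ?card_ord; [|exact: lshift_inj | exact: perm_inj].
  split=> //; apply/negP => /imsetP[_ /imsetP[j _ ->] /perm_inj/eqP].
  by rewrite eq_rlshift.
have cs : #|porbit gamma x1| = s.
  have := sum_card_porbits gamma; rewrite card_ord.
  have n01 : porbit gamma x1 != porbit gamma x0 by rewrite eq_porbit_mem.
  have : porbits gamma = [set porbit gamma x0; porbit gamma x1]%SET.
    apply/esym/eqP; rewrite eqEcard g2 cards2 eq_sym n01 andbT.
    by apply/fintype.subsetP => c; rewrite !inE => /orP[] /eqP ->; exact: imset_f.
  move=> ->; rewrite big_setU1 ?inE 1?eq_sym // big_set1 ct => /eqP.
  by rewrite eqn_add2l => /eqP.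
(* the conjugating map determined by the base points x0 and x1 *)
pose h (i : I) : I := match fintype.split i with
  | inl j => (gamma ^+ j)%g x0 | inr j => (gamma ^+ j)%g x1 end.
have hl j : h (lshift s j) = (gamma ^+ j)%g x0.
  by rewrite /h -[lshift s j]/(unsplit (inl j)) unsplitK.
have hr j : h (rshift t j) = (gamma ^+ j)%g x1.
  by rewrite /h -[rshift t j]/(unsplit (inr j)) unsplitK.
have inj_pow x i j : (i < #|porbit gamma x|)%N -> (j < #|porbit gamma x|)%N ->
    (gamma ^+ i)%g x = (gamma ^+ j)%g x -> i = j.
  move=> ilt jlt; rewrite !permX => e.
  have := uniq_traject_porbit gamma x; set n := #|_| in ilt jlt * => U.
  apply/eqP; rewrite -(nth_uniq x _ _ U) ?size_traject //.
  by rewrite !nth_traject // e.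
have h_inj : injective h.
  move=> i j; case: (split_ordP i) => a ->; case: (split_ordP j) => b ->; rewrite ?hl ?hr => e.
  - by congr (lshift _ _); apply: val_inj; apply: (inj_pow x0) => //; rewrite ct ltn_ord.
  - case/negP: nx; rewrite -eq_porbit_mem; apply/eqP.
    by rewrite -(porbit_perm gamma b) -e porbit_perm.
  - case/negP: nx; rewrite -eq_porbit_mem; apply/eqP.
    by rewrite -(porbit_perm gamma a) e porbit_perm.
  - by congr (rshift _ _); apply: val_inj; apply: (inj_pow x1) => //; rewrite cs ltn_ord.
have step x (n : nat) (j : 'I_n) : #|porbit gamma x| = n ->
    gamma ((gamma ^+ j)%g x) = (gamma ^+ ordS j)%g x.
  move=> xn; rewrite -permM -expgSr /=; have := ltn_ord j; rewrite leq_eqVlt => /predU1P[e|lt].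
    by rewrite e modnn expg0 perm1 -{1}xn permX iter_porbit.
  by rewrite modn_small.
exists (perm h_inj); last first.
  by rewrite /Phi !permE hl hr !expg0 !perm1.
rewrite inE; apply/eqP/permP => y.
have [i <-] : exists i, perm h_inj i = y by exists ((perm h_inj)^-1%g y); rewrite permKV.
rewrite permJ ![perm h_inj _]permE; case: (split_ordP i) => j ->.
  by rewrite two_cycle_l hl hl (step x0 t j ct).
by rewrite two_cycle_r hr hr (step x1 s j cs).
Qed.

Variables (R : realType) (r : nat -> R).

Lemma card_pointed gamma : #|pointed gamma|%:R =
  \sum_(x : I) (#|porbit gamma x| == t)%:R * s%:R :> R.
Proof.
rewrite -sum1_card natr_sum.
rewrite (eq_bigl (fun xy : I * I => (#|porbit gamma xy.1| == t) && (xy.2 \notin porbit gamma xy.1))).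
  rewrite -(pair_big_dep (fun x => #|porbit gamma x| == t) (fun x y => y \notin porbit gamma x)
    (fun _ _ => 1%:R)) big_mkcond; apply: eq_bigr => x _.
  case: (eqVneq #|porbit gamma x| t) => [ct|_]; last by rewrite mul0r.
  rewrite mul1r -natr_sum sum1_card; congr _%:R.
  have := cardC (mem (porbit gamma x)); rewrite ct card_ord => /addnI H.
  by apply: etrans H; apply: eq_card => y; rewrite !inE.
by move=> xy; rewrite inE.
Qed.

(** Averaging over all relabellings: both sides are the sum over f of the
    annular sum of the conjugate by f. *)
Lemma annular_sum_two_cycle : annular_sum r gts * (t + s)`!%:R =
  \sum_(gamma : {perm I} | #|porbits gamma| == 2%N)
     annular_sum r gamma * (\sum_(x : I) (#|porbit gamma x| == t)%:R * s%:R).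
Proof.
transitivity (\sum_(f : {perm I}) annular_sum r (gts ^ f)%g).
  rewrite (eq_bigr (fun=> annular_sum r gts)) => [|f _]; last by rewrite annular_sumJ.
  by rewrite sumr_const card_Sn mulr_natr.
rewrite (partition_big (fun f => gts ^ f)%g predT) // [RHS]big_mkcond.
apply: eq_bigr => gamma _; rewrite (eq_bigr (fun=> annular_sum r gamma)) => [|f /eqP -> //].
rewrite sumr_const; case: (eqVneq #|porbits gamma| 2%N) => [g2|ng2]; last first.
  rewrite /annular_sum big_pred0 ?mul0rn // => sigma; apply: contraNF ng2 => /(planar_two_cycles i0) ->.
  by rewrite eqxx.
rewrite -[LHS]mulr_natr -card_pointed; congr (_ * _%:R).
rewrite -(card_conjugators g2); apply: eq_card => f.
by rewrite [RHS]inE [LHS]unfold_in.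
Qed.

Lemma S_NC_annular_sum : \sum_(sigma in S_NC t s) cycle_prod r sigma = annular_sum r gts.
Proof.
by apply: eq_bigl => sigma; rewrite inE (transitive_conn _ _ i0) /planar_cond card_ord.
Qed.
End TwoCycle.

Lemma annular_pairs_annular_sum (R : realType) (r : nat -> R) k :
  annular_pairs r k = \sum_(gamma : 'S_k.+1) annular_sum r gamma.
Proof.
rewrite /annular_sum pair_big_dep /= /annular_pairs.
rewrite (reindex (fun gs : 'S_k.+1 * 'S_k.+1 => (gs.2, gs.2^-1 * gs.1)%g)) /=.
  by apply: eq_bigl => -[g s] /=; rewrite /planar_cond card_ord.
exists (fun st : 'S_k.+1 * 'S_k.+1 => (st.1 * st.2, st.1)%g) => -[a b] _ /=.
  by rewrite mulKVg.
by rewrite mulKg.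
Qed.

(** In the sum over t a permutation gamma with two cycles is counted with
    weight sum_x 1 / |c(x)| = 2, where c(x) is the cycle of the point x. This
    cancels the factor 1/2 in the definition of the annular coefficients, and
    n / n! is 1 / k!. *)
Theorem annular_coef_pairs (R : realType) (m : nat -> R) k :
  annular_coef m k.+1 = annular_pairs (free_cumulant m) k / k`!%:R.
Proof.
set r := free_cumulant m; set n := k.+1.
have nf : n`!%:R != 0 :> R by rewrite pnatr_eq0 -lt0n fact_gt0.
have kf : k`!%:R != 0 :> R by rewrite pnatr_eq0 -lt0n fact_gt0.
pose Q (N t : nat) (c : R) : R := \sum_(gamma : 'S_N | #|porbits gamma| == 2%N)
  annular_sum r gamma * (\sum_(x : 'I_N) (#|porbit gamma x| == t)%:R * c).
have E t : (0 < t)%N -> (t < n)%N ->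
    \sum_(sigma in S_NC t (n - t)) cycle_prod r sigma / (t%:R * (n - t)%:R) =
    Q n t t%:R^-1 / n`!%:R.
  move=> t0 tn; have s0 : (0 < n - t)%N by rewrite subn_gt0.
  have tR : t%:R != 0 :> R by rewrite pnatr_eq0 -lt0n.
  have sR : (n - t)%:R != 0 :> R by rewrite pnatr_eq0 -lt0n.
  have Em : (t + (n - t))%N = n by rewrite subnKC // ltnW.
  rewrite -mulr_suml S_NC_annular_sum //.
  have H : annular_sum r (two_cycle t (n - t)) * (t + (n - t))`!%:R = Q (t + (n - t))%N t (n - t)%:R.
    exact: annular_sum_two_cycle.
  have EQ : Q (t + (n - t))%N t (n - t)%:R = Q n t (n - t)%:R by rewrite Em.
  have Ef : (t + (n - t))`! = n`! by rewrite Em.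
  rewrite EQ Ef in H.
  apply: (@mulIf _ n`!%:R nf); rewrite mulrAC H divfK //.
  rewrite /Q mulr_suml; apply: eq_bigr => gamma _.
  rewrite -[LHS]mulrA; congr (_ * _); rewrite mulr_suml; apply: eq_bigr => x _.
  by field; rewrite tR sR.
rewrite annular_pairs_annular_sum /annular_coef.
have small (gamma : 'S_n) x : #|porbits gamma| = 2%N -> (0 < #|porbit gamma x| < n)%N.
  move=> g2; rewrite lt0n card_porbit_neq0 /=.
  have := max_card (mem (porbit gamma x)); rewrite card_ord leq_eqVlt => /predU1P[e|//].
  have pT : porbit gamma x = [set: 'I_n].
    by apply/eqP; rewrite eqEcard finset.subsetT cardsT card_ord e /=.
  have : porbits gamma = [set porbit gamma x]%SET.
    apply/setP => c; rewrite inE; apply/imsetP/eqP => [[y _ ->]|->]; last by exists x.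
    by apply/eqP; rewrite eq_porbit_mem pT inE.
  by move=> e'; rewrite e' cards1 in g2.
rewrite (eq_big_nat _ _ (F2 := fun t => Q n t t%:R^-1 / n`!%:R)); last first.
  by move=> t /andP[t0 tn]; exact: E.
rewrite -mulr_suml /Q exchange_big /=.
rewrite (eq_bigr (fun gamma : 'S_n => annular_sum r gamma * 2)) => [|gamma /eqP g2]; last first.
  rewrite -mulr_sumr exchange_big /=; congr (_ * _).
  rewrite -[2]/(2%:R) -g2 -(sum_inv_porbit R gamma); apply: eq_bigr => x _.
  have /andP[p0 pn] := small _ x g2; rewrite (bigD1_seq #|porbit gamma x|) ?iota_uniq //=; last first.
    by rewrite mem_index_iota p0.
  rewrite eqxx mul1r big1 ?addr0 // => t; rewrite eq_sym => /negPf ->.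
  by rewrite mul0r.
rewrite -mulr_suml [X in X * 2](_ : _ = \sum_(gamma : 'S_n) annular_sum r gamma); last first.
  rewrite big_mkcond; apply: eq_bigr => gamma _; case: eqP => // ng2.
  rewrite /annular_sum big_pred0 // => sigma; apply/negP => /(planar_two_cycles ord0) //.
rewrite /n factS natrM; field.
by rewrite kf nat1r pnatr_eq0.
Qed.

(** * Real-rootedness of the finite free convolution *)

Section Grace.
Variable R : realType.
Local Notation C := R[i].
Local Notation Im := (@complex.Im R).
Local Notation Re := (@complex.Re R).
Local Notation toC := (real_complex R).
Implicit Types (c : nat -> C) (z b : C) (bs rs : seq C).

(** The umbral form of a polynomial: c^j stands for c_j in (X + c)^n. In this
    form the polar derivative acts on sequences, independently of the
    degree. *)
Definition umb c n : {poly C} := \poly_(j < n.+1) ('C(n, j)%:R * c (n - j)%N).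

(** Up to normalization, the polar derivative of [umb c n.+1] with pole b, see
    [umb_polar]. *)
Definition polar b c : nat -> C := fun k => c k.+1 + b * c k.

Lemma umb_polar b c n : n.+1%:R *: umb (polar b c) n =
  n.+1%:R *: umb c n.+1 - ('X - b%:P) * (umb c n.+1)^`().
Proof.
have F j : (umb c n.+1)`_j = if (j <= n.+1)%N then 'C(n.+1, j)%:R * c (n.+1 - j)%N else 0.
  by rewrite coef_poly ltnS.
have E j : ('X * (umb c n.+1)^`())`_j = (umb c n.+1)`_j *+ j.
  by rewrite coefXM; case: j => [|j] /=; rewrite ?mulr0n // coef_deriv.
apply/polyP => j; rewrite coefB mulrBl coefB coefCM E !coefZ coef_deriv {1}/umb coef_poly.
rewrite !F !ltnS; case: (ltngtP j n.+1) => [|jn|->].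
- rewrite ltnS => jn; rewrite jn subSS subSn // /polar.
  have e1 : n.+1%:R * 'C(n, j)%:R = (n.+1%:R - j%:R) * 'C(n.+1, j)%:R :> C.
    by rewrite -natrB ?(leqW jn) // -!natrM -mul_bin_down.
  have e2 : n.+1%:R * 'C(n, j)%:R = j.+1%:R * 'C(n.+1, j.+1)%:R :> C.
    by rewrite -!natrM -mul_bin_diag.
  move: e1 e2; rewrite -[(_ * c _) *+ j]mulr_natl -[(_ * c _) *+ j.+1]mulr_natl.
  move: ('C(n, j)%:R) ('C(n.+1, j)%:R) ('C(n.+1, j.+1)%:R) (n.+1%:R) (j%:R) (j.+1%:R).
  move=> A B D N J J1 e1 e2.
  transitivity (((N - J) * B) * c (n - j).+1 + b * ((J1 * D) * c (n - j)%N)); last by ring.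
  by rewrite -e1 -e2; ring.
- have -> : (j <= n)%N = false by lia.
  by rewrite !mul0rn !mulr0 !subr0.
by rewrite ltnn mul0rn !mulr0 subr0 -[(_ * c _) *+ n.+1]mulr_natl subrr.
Qed.

Lemma Re_sum (I : Type) (s : seq I) (F : I -> C) : Re (\sum_(i <- s) F i) = \sum_(i <- s) Re (F i).
Proof. by apply: (big_morph (Re : C -> R)) => // -[? ?] [? ?]. Qed.

Lemma Im_sum (I : Type) (s : seq I) (F : I -> C) : Im (\sum_(i <- s) F i) = \sum_(i <- s) Im (F i).
Proof. by apply: (big_morph (Im : C -> R)) => // -[? ?] [? ?]. Qed.

(** The map l -> (b - l) / (z - l) sends the closed lower half-plane into a
    disc that does not contain 0, since b and the pole z are in the upper
    half-plane. The first factor is a positive multiple of the conjugate of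
    the centre of this disc. *)
Lemma halfplane_pos b z (l : C) : 0 < Im b -> 0 < Im z -> Im l <= 0 ->
  0 < Re (Complex (Im z *+ 2 + Im (b - z)) (Re (b - z)) * ((b - l) / (z - l))).
Proof.
case: b z l => [p q] [x y] [l m] /= q0 y0 m0.
set N := (x - l) ^+ 2 + (y - m) ^+ 2.
have N0 : 0 < N.
  by rewrite /N; apply: ltr_wpDl; [exact: sqr_ge0 | apply: exprn_gt0; lra].
rewrite [X in 0 < X](_ : _ = (y * ((p - l) ^+ 2 + (q - m) ^+ 2) + q * N
   - m * ((p - x) ^+ 2 + (q - y) ^+ 2)) / N); last first.
  by rewrite /N; field; rewrite -/N gt_eqF.
apply: divr_gt0 => //.
have A0 : 0 <= y * ((p - l) ^+ 2 + (q - m) ^+ 2).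
  by apply: mulr_ge0; [exact: ltW | apply: addr_ge0; exact: sqr_ge0].
have B0 : 0 <= - m * ((p - x) ^+ 2 + (q - y) ^+ 2).
  by apply: mulr_ge0; [rewrite oppr_ge0 | apply: addr_ge0; exact: sqr_ge0].
have C0 : 0 < q * N by exact: mulr_gt0.
by rewrite -mulNr; apply: ltr_wpDr => //; apply: ltr_wpDl.
Qed.

Lemma deriv_prod_roots rs z : (forall l, l \in rs -> z - l != 0) ->
  (\prod_(l <- rs) ('X - l%:P))^`().[z] =
  (\prod_(l <- rs) ('X - l%:P)).[z] * \sum_(l <- rs) (z - l)^-1.
Proof.
elim: rs => [|l rs IH] H; first by rewrite !big_nil derivC hornerC mulr0.
rewrite !big_cons derivM hornerD !hornerM derivXsubC hornerC mul1r hornerXsubC IH; last first.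
  by move=> l' l'rs; apply: H; rewrite inE l'rs orbT.
have zl : z - l != 0 by apply: H; rewrite inE eqxx.
by field.
Qed.

(** The leading coefficient is required to be non-zero in order to exclude a
    root at infinity. *)
Definition upper c n := c 0%N != 0 /\ forall z, 0 < Im z -> (umb c n).[z] != 0.

Lemma umb_roots c n : c 0%N != 0 -> exists2 rs : seq C, size rs = n &
  umb c n = c 0%N *: \prod_(l <- rs) ('X - l%:P).
Proof.
move=> c0; have [rs E] := closed_field_poly_normal (umb c n).
have sz : size (umb c n) = n.+1 by rewrite size_poly_eq // binn subnn mul1r.
have lc : lead_coef (umb c n) = c 0%N.
  by rewrite /lead_coef sz coef_poly ltnSn binn subnn mul1r.
rewrite lc in E; exists rs => //.
by move: sz; rewrite E size_scale // size_prod_XsubC => -[].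
Qed.

(** Laguerre's theorem. At a zero z of the polar derivative, the sum of (b -
    l) / (z - l) over the roots l vanishes; but these numbers lie in an open
    half-plane by [halfplane_pos]. *)
Lemma upper_polar b c n : 0 < Im b -> upper c n.+1 -> upper (polar b c) n.
Proof.
move=> b0 [c0 H]; have [rs srs E] := umb_roots n.+1 c0.
have rsI l : l \in rs -> Im l <= 0.
  move=> lrs; rewrite leNgt; apply/negP => /H; rewrite E hornerZ.
  by rewrite (eqP (_ : root _ l)) ?mulr0 ?eqxx // root_prod_XsubC.
have N0 : n.+1%:R != 0 :> C by rewrite pnatr_eq0.
split.
  have e : (umb c n.+1)`_n = - (c 0%N * \sum_(l <- rs) l).
    by rewrite E coefZ -[n in _`_n]/(n.+1.-1) -srs coefPn_prod_XsubC ?srs // mulrN.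
  rewrite coef_poly ltnS leqnSn binSn subSnn in e.
  have : n.+1%:R * polar b c 0 = c 0%N * \sum_(l <- rs) (b - l).
    rewrite /polar mulrDr e sumrB big_const_seq count_predT srs iter_addr_0 -mulr_natl.
    by ring.
  (* the leading coefficient: the sum of the b - l has positive imaginary
     part *)
  apply: contra_eq_neq => ->; rewrite mulr0 eq_sym mulf_neq0 //.
  apply: contraTneq b0 => /(congr1 Im); rewrite Im_sum.
  have : 0 <= \sum_(l <- rs) (Im (b - l) - Im b).
    rewrite big_seq sumr_ge0 // => l /rsI; case: b l => [p q] [x y] /= y0.
    by rewrite -subr_ge0; lra.
  rewrite sumrB big_const_seq count_predT srs iter_addr_0 => h e0.
  rewrite -leNgt; move: h; rewrite e0 sub0r oppr_ge0 -mulr_natl.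
  by rewrite pmulr_rle0 // ltr0n.
move=> z z0; apply/eqP => Fz.
have := congr1 (fun q : {poly C} => q.[z]) (umb_polar b c n).
rewrite hornerZ Fz mulr0 hornerD hornerN hornerM hornerZ hornerXsubC E derivZ !hornerZ.
have zl l : l \in rs -> z - l != 0.
  move=> /rsI lI; apply: contraTneq z0 => /eqP; rewrite subr_eq0 => /eqP ->.
  by rewrite -leNgt.
rewrite deriv_prod_roots //; set P := (\prod_(l <- rs) _).[z].
have P0 : P != 0.
  by have := H z z0; rewrite E hornerZ mulf_eq0 negb_or => /andP[].
move=> e; have {}e : \sum_(l <- rs) (b - l) / (z - l) = 0.
  apply: (mulfI P0); apply: (mulfI c0); rewrite !mulr0 [RHS]e.
  have -> : n.+1%:R = \sum_(l <- rs) 1 :> C.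
    by rewrite big_const_seq count_predT srs iter_addr_0.
  transitivity (c 0%N * P * (\sum_(l <- rs) 1 - (z - b) * \sum_(l <- rs) (z - l)^-1)); last by ring.
  rewrite mulrA; congr (_ * _); rewrite mulr_sumr -sumrB big_seq [RHS]big_seq.
  by apply: eq_bigr => l lrs; field; exact: zl.
set W := Complex (Im z *+ 2 + Im (b - z)) (Re (b - z)).
have : Re (W * \sum_(l <- rs) (b - l) / (z - l)) = 0 by rewrite e mulr0.
rewrite mulr_sumr Re_sum => /eqP; rewrite big_seq gt_eqF // => {e Fz}.
case: rs srs rsI {E zl P P0} => // l rs _ rsI.
rewrite -big_seq big_cons; apply: ltr_pwDl.
  by apply: halfplane_pos => //; apply: rsI; rewrite inE eqxx.
rewrite big_seq; apply: sumr_ge0 => l' l'rs; apply: ltW.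
by apply: halfplane_pos => //; apply: rsI; rewrite inE l'rs orbT.
Qed.

Fixpoint polars bs c : nat -> C := if bs is b :: bs' then polars bs' (polar b c) else c.

Lemma polars_neq0 bs c : (forall b, b \in bs -> 0 < Im b) -> upper c (size bs) ->
  polars bs c 0%N != 0.
Proof.
elim: bs c => [|b bs IH] c H /=; first by case.
move=> /(upper_polar (H b (mem_head _ _))); apply: IH => b' b'bs.
by apply: H; rewrite inE b'bs orbT.
Qed.

(** Polar derivatives with poles b compose like the product of the X + b, with
    X acting as the shift of sequences. *)
Lemma polars_coef bs c j N : (size bs < N)%N ->
  polars bs c j = \sum_(k < N) (\prod_(b <- bs) ('X + b%:P))`_k * c (k + j)%N.
Proof.
elim: bs c N => [|b bs IH] c [//|N] /= sN.
  rewrite big_nil big_ord_recl coef1 mul1r add0n big1 ?addr0 // => k _.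
  by rewrite coef1 mul0r.
rewrite ltnS in sN; rewrite (IH _ N) // big_cons.
have sz : size (\prod_(b0 <- bs) ('X + b0%:P)) = (size bs).+1.
  rewrite -(size_prod_XsubC bs -%R); congr (size (polyseq _)).
  by apply: eq_bigr => b' _; rewrite polyCN opprK.
rewrite (eq_bigr (fun k : 'I_N.+1 => ('X * \prod_(b0 <- bs) ('X + b0%:P))`_k * c (k + j)%N
   + b * (\prod_(b0 <- bs) ('X + b0%:P))`_k * c (k + j)%N)); last first.
  by move=> k _; rewrite mulrDl coefD coefCM mulrDl.
rewrite big_split /= big_ord_recl coefXM /= mul0r add0r [X in _ + X]big_ord_recr /=.
rewrite (nth_default _ (_ : size _ <= N)%N) ?sz // mulr0 mul0r addr0 -big_split /=.
apply: eq_bigr => k _; rewrite coefXM /= /polar /bump /= add1n addSn; ring.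
Qed.

Lemma comp_shift_coef (f : {poly C}) z i N : (size f <= N)%N ->
  (f \Po ('X + z%:P))`_i = \sum_(m < N) f`_m * ('C(m, i)%:R * z ^+ (m - i)).
Proof.
move=> sN; rewrite comp_polyE coef_sum (big_ord_widen N (fun k =>
  (f`_k *: ('X + z%:P) ^+ k)`_i) sN) big_mkcond /=; apply: eq_bigr => m _.
have E : (('X + z%:P) ^+ m)`_i = 'C(m, i)%:R * z ^+ (m - i).
  rewrite addrC exprDn coef_sum.
  case: (leqP i m) => im; last first.
    rewrite bin_small // mul0r big1 // => k _; rewrite -polyC_exp coefMn coefCM coefXn.
    by rewrite (_ : (i == k)%N = false) ?mulr0 ?mul0rn //; have := ltn_ord k; lia.
  rewrite (bigD1 (Ordinal (im : i < m.+1)%N)) //= -polyC_exp coefMn coefCM coefXn eqxx mulr1.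
  rewrite big1 ?addr0 ?mulr_natl // => k ki; rewrite -polyC_exp coefMn coefCM coefXn.
  rewrite (_ : (i == k)%N = false) ?mulr0 ?mul0rn //.
  by apply: contraNF ki => /eqP e; apply/eqP/val_inj.
by case: ltnP => [_|mN]; rewrite ?coefZ ?E // nth_default // mul0r.
Qed.

Let toCM (x y : R) : toC (x * y) = toC x * toC y. Proof. exact: rmorphM. Qed.
Let toCn (k : nat) : toC k%:R = k%:R. Proof. exact: rmorph_nat. Qed.
Let toCsum (n : nat) (f : 'I_n -> R) : toC (\sum_(i < n) f i) = \sum_(i < n) toC (f i).
Proof. exact: rmorph_sum. Qed.

Lemma sum_triangle (F : nat -> nat -> C) n :
  \sum_(k < n) \sum_(i < k.+1) F i (k - i)%N = \sum_(i < n) \sum_(l < n - i) F i l.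
Proof.
elim: n => [|n IH]; first by rewrite !big_ord0.
rewrite big_ord_recr /= IH [RHS]big_ord_recr /= subSn // subnn big_ord1.
rewrite [X in _ + X = _]big_ord_recr /= subnn addrA -big_split; congr (_ + _).
by apply: eq_bigr => i _; rewrite subSn ?big_ord_recr //= ltnW.
Qed.

Lemma ffactnD (d l i : nat) : d ^_ (l + i) = (d ^_ l * (d - l) ^_ i)%N.
Proof.
elim: i => [|i IH]; first by rewrite addn0 muln1.
by rewrite addnS !ffactnSr IH -mulnA subnDA.
Qed.

(** The value of the convolution at z is the polynomial q(X + z) with X^k
    replaced by the umbral coefficient of p. In view of [polars_coef] it is an
    iterated polar derivative of p, with poles z - x at the roots x of q. *)
Lemma ffconv_eval (d : nat) (p q : {poly R}) z : (size q <= d.+1)%N ->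
  (map_poly toC (ffconv d p q)).[z] =
  \sum_(k < d.+1) (map_poly toC q \Po ('X + z%:P))`_k * (k`!%:R * toC (ffsym d p k)).
Proof.
move=> sq; have sr : (size (ffconv d p q) <= d.+1)%N.
  apply: (leq_trans (size_sum _ _ _)); apply/bigmax_leqP => i _.
  by apply: (leq_trans (size_scale_leq _ _)); rewrite size_polyXn ltnS leq_subr.
pose F i l : C := (d ^_ (i + l))%:R * toC (ffsym d p i) * toC (ffsym d q l) * z ^+ (d - (i + l)).
(* both sides are the sum of F i l over i + l <= d *)
transitivity (\sum_(k < d.+1) \sum_(i < k.+1) F i (k - i)%N).
  rewrite (@horner_coef_wide _ d.+1) ?size_map_poly // (reindex_inj rev_ord_inj) /=.
  apply: eq_bigr => k _; rewrite coef_map /= subSS; have kd : (k <= d)%N by rewrite -ltnS.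
  have -> : (ffconv d p q)`_(d - k) = pser d (ffconv d p q) k by rewrite /pser kd.
  rewrite pser_ffconv rfall_ffact smulE toCM toCsum toCn mulr_sumr mulr_suml.
  apply: eq_bigr => i _; rewrite toCM /F subnKC; last by rewrite -ltnS.
  by rewrite !mulrA.
rewrite sum_triangle; apply: eq_bigr => i _.
rewrite (big_ord_widen d.+1 (F i) (leq_subr i d.+1)) big_mkcond /=.
rewrite (@comp_shift_coef _ _ _ d.+1) ?size_map_poly // mulr_suml [RHS](reindex_inj rev_ord_inj).
apply: eq_bigr => l _ /=.
have ld : (l <= d)%N by rewrite -ltnS.
rewrite coef_map /= subSS; have -> : q`_(d - l) = pser d q l by rewrite /pser ld.
rewrite pser_ffsym rfall_ffact toCM toCn; case: ltnP => li; last first.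
  by rewrite bin_small ?mul0r ?mulr0 ?mul0r //; lia.
by rewrite /F addnC ffactnD natrM -(bin_ffact (d - l) i) natrM subnDA; ring.
Qed.

Lemma umb_ffsym (d : nat) (p : {poly R}) : (size p <= d.+1)%N ->
  umb (fun k => k`!%:R * toC (ffsym d p k)) d = map_poly toC p.
Proof.
move=> sp; apply/polyP => j; rewrite coef_poly coef_map /= ltnS; case: leqP => jd; last first.
  by rewrite nth_default //; exact: leq_trans sp jd.
have -> : p`_j = pser d p (d - j)%N by rewrite /pser leq_subr subKn.
rewrite pser_ffsym rfall_ffact [RHS]toCM toCn -bin_ffact natrM bin_sub //; ring.
Qed.

(** If z is in the upper half-plane so are the poles z - x, and Laguerre's
    theorem keeps the iterated polar derivative of the real-rooted p away from
    0. *)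
Lemma ffconv_upper (d : nat) (p q : {poly R}) z : real_rooted d p -> real_rooted d q ->
  0 < Im z -> (map_poly toC (ffconv d p q)).[z] != 0.
Proof.
move=> pr qr z0.
have size_rr (f : {poly R}) : real_rooted d f -> size f = d.+1.
  by move=> [s <- ->]; rewrite size_prod_XsubC.
rewrite ffconv_eval ?size_rr //.
pose c k : C := k`!%:R * toC (ffsym d p k).
have [t st qE] := qr; pose bs := [seq z - toC x | x <- t].
have E : \prod_(b <- bs) ('X + b%:P) = map_poly toC q \Po ('X + z%:P).
  rewrite qE rmorph_prod /= rmorph_prod /= /bs big_map; apply: eq_bigr => x _ /=.
  by rewrite map_polyXsubC comp_polyB comp_polyX comp_polyC polyCB addrA.
have sb : size bs = d by rewrite size_map.
have := @polars_coef bs c 0 d.+1; rewrite sb E => /(_ (ltnSn d)) H.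
rewrite (_ : \sum_(k < d.+1) _ = polars bs c 0%N); last first.
  by rewrite H; apply: eq_bigr => k _; rewrite addn0.
apply: polars_neq0.
  by move=> b /mapP[x _ ->]; case: z z0 {E H bs sb} => u v /=; rewrite subr0.
rewrite sb; split; first by rewrite /c fact0 mul1r ffsym0 // rmorph1 oner_neq0.
move=> y y0; rewrite umb_ffsym ?size_rr //; have [s _ ->] := pr.
rewrite rmorph_prod /= horner_prod prodf_seq_neq0; apply/allP => x _ /=.
rewrite map_polyXsubC hornerXsubC; apply: contraTneq y0; case: y => u v /eqP.
by rewrite subr_eq0 => /eqP[_ ->]; rewrite ltxx.
Qed.

(** Non-real roots come in conjugate pairs, so it is enough that none lies in
    the upper half-plane. *)
Theorem real_rooted_ffconv (d : nat) (p q : {poly R}) :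
  real_rooted d p -> real_rooted d q -> real_rooted d (ffconv d p q).
Proof.
move=> pr qr; set r := ffconv d p q.
have rd : r`_d = 1.
  have := @pser_ffconv R d 0 p q; rewrite /pser /= subn0 -/r => ->.
  by rewrite /rfall big_ord0 mul1r smul0E !ffsym0 // mulr1.
have sr : size r = d.+1.
  apply/eqP; rewrite eqn_leq; apply/andP; split.
    apply: (leq_trans (size_sum _ _ _)); apply/bigmax_leqP => i _.
    by apply: (leq_trans (size_scale_leq _ _)); rewrite size_polyXn ltnS leq_subr.
  by rewrite ltnNge; apply/negP => /leq_sizeP/(_ d (leqnn d))/eqP; rewrite rd oner_eq0.
have [rs E] := closed_field_poly_normal (map_poly toC r).
have lc : lead_coef (map_poly toC r) = 1.
  by rewrite lead_coef_map /lead_coef sr rd rmorph1.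
rewrite lc scale1r in E.
have conjE : map_poly (@conjc R) (map_poly toC r) = map_poly toC r.
  by apply/polyP => j; rewrite !coef_map; exact: conjc_real.
have up l : 0 < Im l -> l \notin rs.
  move=> l0; apply/negP => lrs; have := ffconv_upper pr qr l0; rewrite -/r E.
  by rewrite (eqP (_ : root _ l)) ?eqxx // root_prod_XsubC.
have real l : l \in rs -> Im l = 0.
  move=> lrs; apply/eqP; case: (ltgtP (Im l) 0) => // lI; last by move: (up l lI); rewrite lrs.
  have : conjc l \in rs.
    rewrite -root_prod_XsubC -E /root -conjE horner_map E.
    by rewrite (eqP (_ : root _ l)) ?rmorph0 // root_prod_XsubC.
  apply: contraTT => _; apply: up; case: l lI {lrs} => u v /=; by rewrite oppr_gt0.
exists (map Re rs).
  have := congr1 (fun f : {poly C} => size f) E.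
  by rewrite size_map_poly sr size_prod_XsubC size_map => -[].
apply: (map_poly_inj (real_complex R)); rewrite E rmorph_prod /= big_map.
rewrite big_seq [RHS]big_seq; apply: eq_bigr => l /real; rewrite map_polyXsubC.
by case: l => u v /= ->.
Qed.
End Grace.

(** * The infinitesimal distribution of the convolution *)

Section MomentFunctional.
Local Open Scope classical_set_scope.
Variables (R : realType) (x : nat -> R).

Definition moment_functional (f : {poly R}) : R := \sum_(i < size f) f`_i * x i.

Lemma moment_functional_widen (f : {poly R}) N : (size f <= N)%N ->
  moment_functional f = \sum_(i < N) f`_i * x i.
Proof.
move=> sN; rewrite /moment_functional (big_ord_widen N (fun i => f`_i * x i) sN).
rewrite big_mkcond; apply: eq_bigr => i _.
by case: ltnP => // si; rewrite nth_default ?mul0r.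
Qed.

Lemma moment_functional_scalar : scalar moment_functional.
Proof.
move=> a f g; pose N := maxn (size (a *: f + g)) (maxn (size f) (size g)).
rewrite !(@moment_functional_widen _ N) ?leq_max ?leqnn ?orbT //.
rewrite mulr_sumr -big_split; apply: eq_bigr => i _.
by rewrite coefD coefZ mulrDl -mulrA.
Qed.

HB.instance Definition _ :=
  GRing.isLinear.Build R {poly R} R _ moment_functional moment_functional_scalar.

Lemma moment_functionalXn n : moment_functional 'X^n = x n.
Proof.
rewrite /moment_functional size_polyXn big_ord_recr /= coefXn eqxx mul1r big1 ?add0r // => i _.
by rewrite coefXn (_ : (i == n :> nat) = false) ?mul0r //; have := ltn_ord i; lia.
Qed.
End MomentFunctional.

Section Assembly.
Local Open Scope classical_set_scope.
Variable R : realType.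
Local Notation w := (sw R).

Lemma moment0 (mu : probability (measurableTypeR R) R) : moment mu 0 = 1.
Proof.
rewrite /moment /Rintegral (eq_integral (fun=> 1%E)); last by move=> x _; rewrite expr0.
rewrite integral_cst // mul1e.
exact: (congr1 fine (@probability_setT _ _ _ mu)).
Qed.

Lemma poly_moment_expansion (p : nat -> {poly R}) (mu : probability (measurableTypeR R) R)
    (mu' : {scalar {poly R}}) : infinitesimal_distribution p mu mu' ->
  sexpands (fun d => poly_moment d (p d) : ser R) (moment mu) (functional_moment mu').
Proof.
move=> [pr _ _ mu1 H] [|n]; last exact: H.
rewrite moment0 /functional_moment expr0 mu1; apply: expands_near (expands_cst 1).
apply: filterS pos_near => d d0; have [sd _] := poly_rootsP (pr d d0).
rewrite /poly_moment (eq_bigr (fun=> 1)) => [|x _]; last by rewrite expr0.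
by rewrite big_const_seq count_predT iter_addr_0 sd mulVf // pnatr_eq0 -lt0n.
Qed.

Lemma subordinationE (gam mu : probability (measurableTypeR R) R) (c : nat -> R) :
  subordination gam mu c ->
  w * (moment gam : ser R) = scomp (w * (moment mu : ser R)) (omega_inv c).
Proof.
rewrite /subordination /cauchy_measure !fps_shiftE => ->.
apply/funext => n; rewrite /fps_comp_omega /scomp; apply: eq_bigr => k _.
by rewrite fps_expE.
Qed.

Lemma annular_series_hser (gam : probability (measurableTypeR R) R) :
  (annular_series gam : ser R) *+ 2 = hser (moment gam) (cumser (moment gam)).
Proof.
have m0E := moment_cumulant_series (moment0 gam).
apply/funext => -[|[|n]]; rewrite smulnE.
- by rewrite /hser smul0E mul0r mul0rn.
- by rewrite /hser smulE !big_ord_recl big_ord0 /= /bump /= mul0r mul0r oppr0 mul0r addr0 addr0 mul0rn.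
have -> : annular_series gam n.+2 = annular_coef (moment gam) n.+1.
  rewrite /annular_series /=; case: n => [|n] //=.
  by rewrite /annular_coef big_geq ?mulr0.
have H := @annular_series_pairs R (free_cumulant (moment gam)) (cumser (moment gam))
  erefl (fun=> erefl) n.
by rewrite annular_coef_pairs -H -(momser_uniq m0E).
Qed.

End Assembly.

Theorem theorem4p8 (R : realType) (p q : nat -> {poly R})
    (mu : probability (measurableTypeR R) R) (mu' : {scalar {poly R}})
    (nu : probability (measurableTypeR R) R) (nu' : {scalar {poly R}})
    (gam : probability (measurableTypeR R) R) (gam' : {scalar {poly R}})
    (omega1 omega2 : nat -> R) :
  moment_determinate mu -> moment_determinate nu ->
  infinitesimal_distribution p mu mu' ->
  infinitesimal_distribution q nu nu' ->
  inf_free_convolution mu mu' nu nu' gam gam' ->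
  subordination gam mu omega1 ->
  subordination gam nu omega2 ->
  exists rho' : {scalar {poly R}},
    infinitesimal_distribution (fun d => ffconv d (p d) (q d)) gam rho' /\
    cauchy_functional rho' =
      cauchy_functional gam' + annular_series gam
      + fps_div (omega_deriv2 omega1) (omega_deriv omega1 *+ 2)
      + fps_div (omega_deriv2 omega2) (omega_deriv omega2 *+ 2).
Proof.
move=> _ _ Hp Hq [[[fmg _] cumg] gam1 icumg] sub1 sub2.
have [prp _ _ mu1 _] := Hp; have [prq _ _ nu1 _] := Hq.
have Ep := poly_moment_expansion Hp; have Eq := poly_moment_expansion Hq.
have mu0E := moment_cumulant_series (moment0 mu).
have nu0E := moment_cumulant_series (moment0 nu).
have gam0E := moment_cumulant_series (moment0 gam).
pose Pp d := ffsym d (p d); pose Pq d := ffsym d (q d).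
pose r d := ffconv d (p d) (q d).
have Pp0 d : (0 < d)%N -> Pp d 0%N = 1 by move=> d0; apply/ffsym0/prp.
have Pq0 d : (0 < d)%N -> Pq d 0%N = 1 by move=> d0; apply/ffsym0/prq.
have Mp d n (d0 : (0 < d)%N) := poly_moment_cumulant n d0 (prp d d0) (Pp0 d d0)
  (fun k => pser_ffsym d k (p d)).
have Mq d n (d0 : (0 < d)%N) := poly_moment_cumulant n d0 (prq d d0) (Pq0 d d0)
  (fun k => pser_ffsym d k (q d)).
have prr d : (0 < d)%N -> real_rooted d (r d).
  by move=> d0; apply: real_rooted_ffconv; [exact: prp | exact: prq].
have Pr0 d : (0 < d)%N -> (Pp d * Pq d) 0%N = 1.
  by move=> d0; rewrite smul0E Pp0 // Pq0 // mulr1.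
have Mr d n (d0 : (0 < d)%N) := poly_moment_cumulant n d0 (prr d d0) (Pr0 d d0)
  (fun k => pser_ffconv d k (p d) (q d)).
pose mp d : ser R := poly_moment d (p d); pose kp d := ffcumulant d%:R (Pp d).
pose mq d : ser R := poly_moment d (q d); pose kq d := ffcumulant d%:R (Pq d).
pose mr d : ser R := poly_moment d (r d); pose kr d := ffcumulant d%:R (Pp d * Pq d).
have [s1 s10 Hs1] := @cumulant_expansion R mp kp _ _ Mp erefl mu0E _ Ep.
have [s2 s20 Hs2] := @cumulant_expansion R mq kq _ _ Mq erefl nu0E _ Eq.
have Hs n : expands (fun d => ffcumulant d%:R (Pp d * Pq d) n.+1)
    (cumser (moment gam) n.+1) ((s1 + s2) n.+1).
  rewrite /= cumg // ; apply: expands_near (expandsD (Hs1 n) (Hs2 n)).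
  apply: filterS pos_near => d d0.
  by rewrite ffcumulantM ?saddE ?Pp0 ?Pq0 ?oner_neq0.
have [m1 Hm1] := @moment_expansion R mr kr _ _ Mr erefl gam0E _ Hs.
have s0 : (s1 + s2) 0%N = 0 by rewrite saddE s10 s20 addr0.
have F1 := @first_order_eq R mp kp _ _ Mp erefl mu0E _ _ s10 Hs1 Ep.
have F2 := @first_order_eq R mq kq _ _ Mq erefl nu0E _ _ s20 Hs2 Eq.
have Fg := @first_order_eq R mr kr _ _ Mr erefl gam0E _ _ s0 Hs Hm1.
have m10 : m1 0%N = 0.
  apply: (expands_uniq (Hm1 0%N)); rewrite moment0; apply: expands_near (expands_cst 1).
  by apply: filterS pos_near => d d0; rewrite /mr Mr // big_ord0 addr0.
pose L : {scalar {poly R}} := moment_functional m1.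
have LE n : functional_moment L n = m1 n by exact: moment_functionalXn.
exists L; split.
  split=> //.
  - by move=> n; exact: expands_cvg (Hm1 n).
  - by rewrite -m10 -moment_functionalXn expr0.
  - by move=> n _; rewrite LE; exact: Hm1.
have f0 (l : {scalar {poly R}}) : l 1 = 0 -> functional_moment l 0%N = 0.
  by rewrite /functional_moment expr0.
have I1 := inf_moment_cumulant_series (moment0 mu) (f0 _ mu1).
have I2 := inf_moment_cumulant_series (moment0 nu) (f0 _ nu1).
have Ig := inf_moment_cumulant_series (moment0 gam) (f0 _ gam1).
have cE : infcumser (moment gam) (functional_moment gam') =
    infcumser (moment mu) (functional_moment mu') + infcumser (moment nu) (functional_moment nu').
  by apply/funext => -[|n]; rewrite saddE /= ?addr0 ?icumg.
rewrite cE in Ig.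
have := convolution_identity (moment0 gam) mu0E nu0E gam0E (subordinationE sub1)
  (subordinationE sub2) I1 I2 Ig F1 F2 Fg.
rewrite -annular_series_hser => E; apply: (@ser_double_inj R).
have -> : cauchy_functional L = sw R * m1 :> ser R.
  rewrite /cauchy_functional fps_shiftE; congr (_ * _); apply/funext => n.
  exact: LE.
rewrite E /cauchy_functional fps_shiftE.
have W0 c : (omega_deriv c : ser R) 0%N != 0.
  by rewrite (_ : omega_deriv c 0%N = 1) ?oner_neq0 //; exact: addr0.
rewrite -(fps_div_double (omega_deriv2 omega1) (W0 omega1)).
rewrite -(fps_div_double (omega_deriv2 omega2) (W0 omega2)).
by rewrite -!mulrnDl.
Qed.
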